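(* Consider the parabolic Anderson model $\partial_t u=\frac12\Delta u+u\dot W$ on $\mathbb{R}_+\times\mathbb{R}^d$. Suppose $u_0\equiv1$ and $H_0=\frac12$ (the noise is white in time). Then $\mathbb{E}[u(t,x)^2]<+\infty$ for every $(t,x)\in\mathbb{R}_+\times\mathbb{R}^d$ if and only if $$|H|>d-1\qquad\text{and}\qquad H_*>\tfrac34 d_*-\tfrac12.$$
   Context: Parameters. $d\ge1$ is an integer, $H_1,\dots,H_d\in(0,1)$. The spatial parameters are ordered so that, for some integer $0\le d_*\le d$, $H_k<3/4$ for $k\le d_*$ and $H_k\ge 3/4$ for $k>d_*$. Set $H_*:=\sum_{k=1}^{d_*}H_k$ and $|H|:=\sum_{k=1}^dH_k$ (empty sums are $0$). Noise (case $H_0=1/2$). $\widehat{\varphi}(s,\xi)=\int_{\mathbb{R}^d}e^{-\iota \xi\cdot x}\varphi(s,x)dx$ denotes the Fourier transform in the spatial variables ($\iota=\sqrt{-1}$). $\mathfrak{H}$ is the Hilbert space completion of $C_0^\infty(\mathbb{R}_+\times\mathbb{R}^d)$ for $\langle\varphi,\psi\rangle_{\mathfrak H}=\int_{\mathbb{R}_+\times\mathbb{R}^d}\widehat\varphi(s,\xi)\overline{\widehat\psi(s,\xi)}\prod_{k=1}^d|\xi_k|^{1-2H_k}\,ds\,d\xi$, and $W$ is an isonormal Gaussian process over $\mathfrak H$ (centered, $\mathbb{E}[W(\varphi)W(\psi)]=\langle\varphi,\psi\rangle_{\mathfrak H}$). $I_n$ is the $n$-th multiple Itô–Wiener integral with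 respect to $W$, so that $\mathbb{E}[I_n(f)^2]=n!\|f\|^2_{\mathfrak H^{\otimes n}}$ for symmetric $f$. Solution candidate. The product $u\dot W$ is in the Itô–Skorohod sense. The solution candidate is $u(t,x)=\sum_{n=0}^\infty u_n(t,x)$, where $u_0(t,x)=1$ is the zeroth chaos and, for $n\ge1$, with $G_t(x)=(2\pi t)^{-d/2}e^{-|x|^2/(2t)}$ and initial condition $\equiv1$, $u_n(t,x)=I_n(\tilde f_n(t,x))$, $$\tilde f_n(t,x;s_1,x_1,\dots,s_n,x_n)=\frac1{n!}\sum_\sigma\prod_{i=1}^nG_{s_{\sigma(i+1)}-s_{\sigma(i)}}(x_{\sigma(i+1)}-x_{\sigma(i)})\mathbf 1_{\{0<s_{\sigma(1)}<\cdots<s_{\sigma(n)}<t\}},$$ where $\sigma$ runs over permutations of $\{1,\dots,n\}$, $\sigma(n+1)=n+1$, $s_{n+1}=t$, $x_{n+1}=x$. Thus $\mathbb{E}[u_n(t,x)^2]=n!\|\tilde f_n(t,x)\|^2_{\mathfrak H^{\otimes n}}\in[0,\infty]$, with $$\|f\|^2_{\mathfrak H^{\otimes n}}=\int_{\mathbb{R}_+^{n}\times\mathbb{R}^{nd}}|\widehat f(s_1,\xi_1,\dots,s_n,\xi_n)|^2\prod_{i=1}^n\prod_{k=1}^d|\xi_{ik}|^{1-2H_k}\,ds\,d\xi .$$ By orthogonality of the chaoses, $\mathbb{E}[u(t,x)^2]$ means $\sum_{n=0}^\infty\mathbb{E}[u_n(t,x)^2]\in[0,\infty]$; it is finite exactly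 when the chaos expansion converges in $L^2(\Omega)$. *)

(* Defs.v *)
From HB Require Import structures.
From mathcomp Require Import all_boot all_order all_fingroup all_algebra.
From mathcomp Require Import all_classical all_reals all_analysis.
From mathcomp Require Import complex.

Set Implicit Arguments.
Unset Strict Implicit.
Unset Printing Implicit Defensive.
Import Order.TTheory GRing.Theory Num.Theory.
Import numFieldNormedType.Exports.
Import ComplexField.Normc.

Local Open Scope classical_set_scope.
Local Open Scope ring_scope.

Section cons_product.
Context {d : measure_display} {T : measurableType d} {R : realType} {n : nat}.

Definition tuple_cons (p : T * n.-tuple T) : n.+1.-tuple T :=
  [tuple of p.1 :: p.2].

Lemma measurable_tuple_cons : measurable_fun [set: T * n.-tuple T] tuple_cons.
Proof. exact: measurable_cons. Qed.

Variable mu : {sigma_finite_measure set T -> \bar R}.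
Variable nu : {sigma_finite_measure set (n.-tuple T) -> \bar R}.

(* mu \x nu, carried from T * T^n to T^(n+1). *)
Definition cons_product : set (n.+1.-tuple T) -> \bar R :=
  pushforward (mu \x nu)%E tuple_cons.

Let cons_product0 : (cons_product set0 = 0)%E.
Proof. by rewrite /cons_product /pushforward preimage_set0 measure0. Qed.

Let cons_product_ge0 A : (0 <= cons_product A)%E.
Proof. by rewrite /cons_product /pushforward. Qed.

Let cons_product_sigma_additive : semi_sigma_additive cons_product.
Proof.
move=> F mF tF mUF; rewrite /cons_product /pushforward preimage_bigcup.
have mpre A : measurable A -> measurable (tuple_cons @^-1` A).
  by move=> mA; rewrite -[X in measurable X]setTI; exact: measurable_tuple_cons.
apply: measure_semi_sigma_additive.
- by move=> k; exact: mpre.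
- apply/trivIsetP => /= i j _ _ ij; rewrite -preimage_setI.
  by move/trivIsetP : tF => /(_ _ _ _ _ ij) ->//; rewrite preimage_set0.
- by rewrite -preimage_bigcup; exact: mpre.
Qed.

HB.instance Definition _ :=
  isMeasure.Build _ _ _ cons_product cons_product0 cons_product_ge0 cons_product_sigma_additive.

Let cons_product_sigma_finite : sigma_finite setT cons_product.
Proof.
have /sigma_finiteP[F [FT ndF Fm]] := sigma_finiteT mu.
have /sigma_finiteP[G [GT ndG Gm]] := sigma_finiteT nu.
pose g (x : n.+1.-tuple T) : T * n.-tuple T := (thead x, [tuple of behead x]).
have mg : measurable_fun setT g.
  apply/measurable_fun_pairP; split; first exact: measurable_tnth.
  exact: measurable_behead.
exists (fun i => g @^-1` (F i `*` G i)).
  rewrite -preimage_bigcup (_ : \bigcup_i _ = setT) ?preimage_setT//.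
  apply/seteqP; split => // -[x y] _.
  have [k _ Fx] : (\bigcup_i F i) x by rewrite -FT.
  have [l _ Gy] : (\bigcup_i G i) y by rewrite -GT.
  exists (maxn k l) => //; split => /=.
  - by move: x Fx; exact/subsetPset/ndF/leq_maxl.
  - by move: y Gy; exact/subsetPset/ndG/leq_maxr.
move=> i; have [mF oF] := Fm i; have [mG oG] := Gm i; split.
  by rewrite -[X in measurable X]setTI; apply: mg => //; exact: measurableX.
rewrite /cons_product /pushforward -comp_preimage (_ : g \o _ = id).
  by rewrite preimage_id product_measure1E// lte_mul_pinfty// ge0_fin_numE.
by apply/funext => -[a b]; congr pair; exact/val_inj.
Qed.

HB.instance Definition _ :=
  Measure_isSigmaFinite.Build _ _ _ cons_product cons_product_sigma_finite.

End cons_product.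

Fixpoint tuple_measure {d : measure_display} {T : measurableType d}
    {R : realType} (mu : {sigma_finite_measure set T -> \bar R}) (n : nat) :
    {sigma_finite_measure set (n.-tuple T) -> \bar R} :=
  match n with
  | 0%N => dirac [tuple of [::]]
  | n'.+1 => cons_product mu (tuple_measure mu n')%E
  end.

Section parabolic_anderson.
Context {R : realType} (d : nat).
Implicit Types (n : nat) (t : R) (x : d.-tuple R).

Definition lebesgue_tuple n :
    {sigma_finite_measure set (n.-tuple (measurableTypeR R)) -> \bar R} :=
  tuple_measure (@lebesgue_measure R) n.

Definition heat_kernel t (z : 'I_d -> R) : R :=
  (2 * pi * t) `^ (- (d%:R / 2)) * expR (- (\sum_(k < d) z k ^+ 2) / (2 * t)).

(* With i counted from 0, the i-th term of v_(sigma 0), ..., v_(sigma (n-1)),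
   continued by the endpoint w (s_(n+1) = t and x_(n+1) = x). *)
Definition chain (A : Type) n (sigma : {perm 'I_n}) (v : n.-tuple A) (w : A)
    (i : nat) : A :=
  nth w [tuple tnth v (sigma j) | j < n] i.

(* The symmetrized kernel. The path condition is the indicator of
   0 < s_(sigma 0) < ... < s_(sigma (n-1)) < t; outside of it the (meaningless)
   values of heat_kernel at non-positive times are multiplied by 0. *)
Definition chaos_kernel n t x (s : n.-tuple R) (y : n.-tuple (d.-tuple R)) : R :=
  n`!%:R^-1 * \sum_(sigma : {perm 'I_n})
    (\prod_(i < n) heat_kernel (chain sigma s t i.+1 - chain sigma s t i)
       (fun k => tnth (chain sigma y x i.+1) k - tnth (chain sigma y x i) k))
    * (path <%R 0 (rcons [tuple tnth s (sigma j) | j < n] t))%:R.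

Definition dot n (xi y : n.-tuple (d.-tuple R)) : R :=
  \sum_(i < n) \sum_(k < d) tnth (tnth xi i) k * tnth (tnth y i) k.

(* The integral of exp(- i xi . y) f(y) dy over (R^d)^n, for real-valued f. *)
Definition fourier n (f : n.-tuple (d.-tuple R) -> R)
    (xi : n.-tuple (d.-tuple R)) : R[i] :=
  let mu := tuple_measure (lebesgue_tuple d) n in
  Complex (\int[mu]_y (cos (dot xi y) * f y))
          (- \int[mu]_y (sin (dot xi y) * f y)).

Variable H : 'I_d -> R.

(* The squared norm of f in the n-th tensor power of the Hilbert space of a
   noise that is white in time and has Hurst parameters H in space. The library
   sets 0 `^ a = 0 for a <> 0, which only affects a null set of frequencies. *)
Definition noise_sqnorm n (f : n.-tuple R -> n.-tuple (d.-tuple R) -> R) : \bar R :=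
  (\int[lebesgue_tuple n \x tuple_measure (lebesgue_tuple d) n]_(p in
       [set p | forall i, (0 <= tnth p.1 i)%R])
     (normc (fourier (f p.1) p.2) ^+ 2
      * \prod_(i < n) \prod_(k < d)
          `|tnth (tnth p.2 i) k| `^ (1 - 2 * H k))%R%:E)%E.

(* E[u_n(t,x)^2] for u_n = I_n(chaos_kernel), with value +oo when the kernel has
   infinite norm; the zeroth chaos u_0 is the constant 1. *)
Definition chaos_second_moment n t x : \bar R :=
  (if n is 0%N then 1 else (n`!%:R)%:E * noise_sqnorm (@chaos_kernel n t x))%E.

(* E[u(t,x)^2] for u = \sum_n u_n, the chaoses being orthogonal in L^2. *)
Definition second_moment t x : \bar R :=
  (\sum_(0 <= n <oo) chaos_second_moment n t x)%E.

End parabolic_anderson.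

(* Main.v *)
Require Import Defs.
From HB Require Import structures.
From mathcomp Require Import all_boot all_order all_fingroup all_algebra.
From mathcomp Require Import all_classical all_reals all_analysis.
From mathcomp Require Import measurable_realfun.
From mathcomp Require Import complex.
From mathcomp Require Import ring lra.

(** The second moment of the n-th chaos is computed exactly. For given times at
    most one summand of the symmetrized kernel is nonzero, its Fourier transform
    is a phase times a Gaussian, and the summands contribute equally. With
    s_(n+1) = t and e_i = xi_1 + ... + xi_i, the second moment is the integral,
    over 0 < s_1 < ... < s_n < t and over all frequencies, of
      prod_i exp(- (s_(i+1) - s_i) |e_i|^2) prod_k |e_ik - e_(i-1)k|^(a_k),
    where a_k = 1 - 2 H_k and e_0 = 0 ([chaos_second_momentE]). In terms of the
    a_k, let D be the sum of all 1 + a_k, and S the sum of 1 + 2 a_k over the rough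
    coordinates, those with H_k < 3/4, that is, a_k > -1/2. The two conditions
    of the theorem read D < 2 and S < 2.

    Necessity. By scaling, a time gap w before the final time contributes
    w^(-D/2) to the first chaos, which is not integrable when D >= 2
    ([first_chaos_infty]). In the second chaos let w be the gap between the two
    times. The first frequency has size w^(-1/2) and the second one brings the sum
    back to size 1; a rough coordinate then contributes w^(-(1+2a_k)/2), and a
    smooth one, in which the frequencies stay of size 1, a constant. The result
    w^(-S/2) is not integrable when S >= 2 ([second_chaos_infty]).

    Sufficiency. All coordinates share the same times, so a bound that is optimal
    coordinate by coordinate but treats each time gap on its own is not enough
    when rough and smooth coordinates coexist: the time gaps have to be kept
    together. For fixed times the integral over the frequencies factorizes over
    the coordinates. In each coordinate it is estimated by integrating out the
    frequencies from the last to the first, with the profile max(r, |e|)^(-b_k) of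
    the remaining integral as an induction hypothesis, where r = w^(-1/2) for the
    first remaining gap w ([smoothing_step]). Such a profile is preserved as soon
    as b_k <= - a_k and b_k < 1 + a_k. If the sum B of the b_k is nonpositive, the
    product over the coordinates is at most C^n prod_i w_i^(-kappa) with
    kappa = (D - B)/2 ([spectral_integral_le]), and the two conditions say exactly
    that the b_k can be chosen with kappa < 1 ([decay_exponents]). An exponential
    weight in time then makes the integral over each gap as small as desired, and
    the chaoses decay geometrically ([chaos_second_moment_geometric]). *)

Set Implicit Arguments.
Unset Strict Implicit.
Unset Printing Implicit Defensive.
Import Order.TTheory GRing.Theory Num.Theory.
Import numFieldNormedType.Exports.
Local Open Scope classical_set_scope.
Local Open Scope ring_scope.

(** * Integration over powers of a measure *)

Lemma emeasurable_prod {d} {T : measurableType d} {R : realType} (I : Type)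
    (s : seq I) (P : pred I) (f : I -> T -> \bar R) :
  (forall i, measurable_fun setT (f i)) ->
  measurable_fun setT (fun x => \prod_(i <- s | P i) f i x)%E.
Proof.
move=> mf; elim: s => [|i s IH].
  by under eq_fun do rewrite big_nil; exact: measurable_cst.
case Pi: (P i); under eq_fun do rewrite big_cons Pi; last exact: IH.
exact: emeasurable_funM.
Qed.

Section tuple_integration.
Context {dT : measure_display} {T : measurableType dT} {R : realType}.
Variable mu : {sigma_finite_measure set T -> \bar R}.
Local Open Scope ereal_scope.

Lemma integral_tuple0 (f : 0.-tuple T -> \bar R) :
  \int[tuple_measure mu 0]_v f v = f [tuple].
Proof.
rewrite integral_dirac//; last first.
  move=> _ Y mY; rewrite setTI.
  have [h|h] := pselect (Y (f [tuple])).
    rewrite (_ : _ @^-1` _ = setT)//; apply/seteqP; split=> // v _ /=.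
    by rewrite tuple0.
  rewrite (_ : _ @^-1` _ = set0)//; apply/seteqP; split=> // v /=.
  by rewrite tuple0.
by rewrite diracT mul1e; congr f; exact/val_inj.
Qed.

Lemma ge0_integral_tupleS n (f : n.+1.-tuple T -> \bar R) :
  measurable_fun [set: n.+1.-tuple T] f -> (forall v, 0 <= f v) ->
  \int[tuple_measure mu n.+1]_v f v =
  \int[mu]_x \int[tuple_measure mu n]_v f (tuple_cons (x, v)).
Proof.
move=> mf f0.
transitivity (\int[mu \x tuple_measure mu n]_p (f \o tuple_cons) p).
  have := ge0_integral_pushforward measurable_tuple_cons (mu \x tuple_measure mu n)
    measurableT mf (fun v _ => f0 v).
  rewrite preimage_setT => <-.
  by apply: eq_measure_integral => [|mc A mA AT]; first exact: measurable_tuple_cons.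
rewrite fubini_tonelli1//.
- by apply: (measurableT_comp mf); exact: measurable_tuple_cons.
- by move=> x; exact: f0.
Qed.

Lemma ge0_integral_tupleS_swap n (f : n.+1.-tuple T -> \bar R) :
  measurable_fun [set: n.+1.-tuple T] f -> (forall v, 0 <= f v) ->
  \int[tuple_measure mu n.+1]_v f v =
  \int[tuple_measure mu n]_v \int[mu]_x f (tuple_cons (x, v)).
Proof.
move=> mf f0; rewrite ge0_integral_tupleS//.
rewrite (@fubini_tonelli _ _ _ _ _ mu (tuple_measure mu n) (f \o tuple_cons))//.
- by apply: (measurableT_comp mf); exact: measurable_tuple_cons.
- by move=> x; exact: f0.
Qed.

Lemma ge0_integral_tuple_prod n (f : 'I_n -> T -> \bar R) :
  (forall k, measurable_fun setT (f k)) -> (forall k x, 0 <= f k x) ->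
  \int[tuple_measure mu n]_v \prod_(k < n) f k (tnth v k) =
  \prod_(k < n) \int[mu]_x f k x.
Proof.
elim: n => [|n IH] in f *; first by move=> _ _; rewrite integral_tuple0 !big_ord0.
move=> mf f0.
have mprod m (g : 'I_m -> T -> \bar R) : (forall k, measurable_fun setT (g k)) ->
    (forall k x, 0 <= g k x) ->
    measurable_fun setT (fun v : m.-tuple T => \prod_(k < m) g k (tnth v k)).
  move=> mg g0; apply: emeasurable_prod => k.
  by apply: (measurableT_comp (mg k)); exact: measurable_tnth.
rewrite ge0_integral_tupleS//; last 2 first.
- exact: mprod.
- by move=> v; exact: prode_ge0.
transitivity (\int[mu]_x (f ord0 x *
    \int[tuple_measure mu n]_v \prod_(k < n) f (lift ord0 k) (tnth v k))).
  apply: eq_integral => x _; rewrite -ge0_integralZl//; last 2 first.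
  - by apply: (mprod _ (fun k => f (lift ord0 k))) => k; [exact: mf|move=> x0; exact: f0].
  - by move=> v _; exact: prode_ge0.
  apply: eq_integral => v _; rewrite big_ord_recl /= tnth0; congr (_ * _).
  by apply: eq_bigr => k _; rewrite tnthS (tnth_nth (tnth v k)) (tnth_nth (tnth v k)).
rewrite ge0_integralZr//; last by apply: integral_ge0 => v _; exact: prode_ge0.
by rewrite (IH (fun k => f (lift ord0 k)))// big_ord_recl.
Qed.

Lemma measurable_box n (A : 'I_n -> set T) : (forall k, measurable (A k)) ->
  measurable [set v : n.-tuple T | forall k, A k (tnth v k)].
Proof.
move=> mA.
rewrite (_ : mkset _ =
    \bigcap_(k in setT) ((fun v : n.-tuple T => tnth v k) @^-1` A k)); last first.
  by apply/seteqP; split=> v /= h k => [_|]; apply: h.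
apply: fin_bigcap_measurable; first exact: finite_finset.
by move=> k _; rewrite -[X in measurable X]setTI; exact: measurable_tnth.
Qed.

Lemma tuple_measure_box n (A : 'I_n -> set T) :
  (forall k, measurable (A k)) ->
  tuple_measure mu n [set v | forall k, A k (tnth v k)] = \prod_(k < n) mu (A k).
Proof.
move=> mA.
transitivity (\int[tuple_measure mu n]_v
    (\1_[set v : n.-tuple T | forall k, A k (tnth v k)] v)%:E).
  by rewrite integral_indic ?setIT//; exact: measurable_box.
transitivity (\int[tuple_measure mu n]_v \prod_(k < n) (\1_(A k) (tnth v k))%:E).
  apply: eq_integral => v _; rewrite indicE.
  rewrite [in RHS](eq_bigr (fun k => (tnth v k \in A k)%:R%:E)); last by move=> k _; rewrite indicE.
  rewrite prodEFin; congr EFin.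
  have [vA|vA] := boolP [forall k, tnth v k \in A k].
    rewrite mem_set/=; last by move=> k; move/forallP/(_ k) : vA; rewrite inE.
    by rewrite big1// => k _; rewrite (forallP vA k).
  rewrite memNset/=; last first.
    by move=> h; move/negP : vA; apply; apply/forallP => k; rewrite inE; exact: h.
  move: vA; rewrite negb_forall => /existsP[k /negbTE vk].
  by rewrite (bigD1 k)//= vk mul0r.
rewrite (ge0_integral_tuple_prod (f := fun k x => (\1_(A k) x)%:E))//.
  by apply: eq_bigr => k _; rewrite integral_indic ?setIT.
by move=> k; exact/measurable_EFinP/measurable_indic.
Qed.

(** The sigma-algebra is defined by the coordinates, one at a time; uniqueness
    of measures needs a generator that is stable under intersection. *)
Lemma tuple_measurableE n : @measurable _ (n.-tuple T) =
  <<s [set B | exists2 A : 'I_n -> set T, (forall k, measurable (A k)) &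
               B = [set v | forall k, A k (tnth v k)]] >>.
Proof.
apply/seteqP; split; last first.
  apply: smallest_sub; first exact: sigma_algebra_measurable.
  by move=> B [A mA ->]; exact: measurable_box.
apply: smallest_sub; first exact: smallest_sigma_algebra.
move=> B; rewrite -bigcup_seq => -[i _ [Y mY <-]].
apply: sub_sigma_algebra; exists (fun k => if k == i then Y else setT).
  by move=> k; case: ifPn.
apply/seteqP; split=> v /=.
  by move=> [_ Yv] k; case: eqP => // ->.
by move=> /(_ i); rewrite eqxx.
Qed.

Definition perm_tuple (A : Type) n (sigma : {perm 'I_n}) (v : n.-tuple A) :=
  [tuple tnth v (sigma j) | j < n].

Lemma measurable_perm_tuple n (sigma : {perm 'I_n}) :
  measurable_fun [set: n.-tuple T] (perm_tuple sigma : n.-tuple T -> n.-tuple T).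
Proof.
apply/measurable_fun_tnthP => i.
rewrite (_ : _ \o _ = fun v : n.-tuple T => tnth v (sigma i)).
  exact: measurable_tnth.
by apply/funext => v /=; rewrite tnth_mktuple.
Qed.

(** A permutation of the coordinates sends boxes to boxes and permutes the
    factors of their measure; boxes form a pi-system that generates the sigma-
    algebra. *)
Lemma tuple_measure_perm n (sigma : {perm 'I_n}) (A : set (n.-tuple T)) :
  measurable A ->
  tuple_measure mu n (perm_tuple sigma @^-1` A) = tuple_measure mu n A.
Proof.
pose ms := @measurable_perm_tuple n sigma.
pose nu : {measure set (n.-tuple T) -> \bar R} :=
  measure_function_pushforward__canonical__measure_function_Measure
    (tuple_measure mu n) ms.
have /sigma_finiteP[F [FT ndF Fm]] := sigma_finiteT mu.
apply: (@measure_unique _ _ _ _ (fun i => [set v : n.-tuple T | forall k, F i (tnth v k)])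
  (tuple_measurableE n) _ _ _ nu (tuple_measure mu n)).
- move=> _ _ [B mB ->] [C mC ->]; exists (fun k => B k `&` C k).
    by move=> k; exact: measurableI.
  apply/seteqP; split=> v /=; first by move=> [h1 h2] k.
  by move=> h; split=> k; case: (h k).
- by move=> i; exists (fun=> F i) => // k; have [] := Fm i.
- apply/seteqP; split=> // v _.
  have h (k : 'I_n) : exists i, F i (tnth v k).
    have [i _ Fi] : (\bigcup_i F i) (tnth v k) by rewrite -FT.
    by exists i.
  have [g Hg] := choice h.
  exists (\max_(k < n) g k)%N => // k /=.
  by move: (Hg k); apply/subsetPset/ndF; exact: leq_bigmax.
- move=> _ [B mB ->]; rewrite /nu /= /pushforward.
  rewrite (_ : _ @^-1` _ = [set v : n.-tuple T | forall k, B (sigma^-1%g k) (tnth v k)]).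
    rewrite (tuple_measure_box (A := fun k => B (sigma^-1%g k)))//.
    rewrite (tuple_measure_box (A := B))//.
    rewrite (reindex_inj (@perm_inj _ sigma))/=.
    by apply: eq_bigr => k _; rewrite permK.
  apply/seteqP; split=> v /= h k.
    by have := h (sigma^-1%g k); rewrite tnth_mktuple permKV.
  by have := h (sigma k); rewrite tnth_mktuple permK.
- move=> i; rewrite /nu /= /pushforward.
  rewrite (_ : _ @^-1` _ = [set v : n.-tuple T | forall k, F i (tnth v k)]).
    rewrite (tuple_measure_box (A := fun=> F i)); last by move=> k; have [] := Fm i.
    rewrite -ge0_fin_numE; last exact: prode_ge0.
    by apply: prode_fin_num => k _; have [_ ?] := Fm i; rewrite ge0_fin_numE.
  apply/seteqP; split=> v /= h k.
    by have := h (sigma^-1%g k); rewrite tnth_mktuple permKV.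
  by rewrite tnth_mktuple.
Qed.

Lemma ge0_integral_perm n (sigma : {perm 'I_n}) (f : n.-tuple T -> \bar R) :
  measurable_fun [set: n.-tuple T] f -> (forall v, 0 <= f v) ->
  \int[tuple_measure mu n]_v f (perm_tuple sigma v) = \int[tuple_measure mu n]_v f v.
Proof.
move=> mf f0.
have := ge0_integral_pushforward (@measurable_perm_tuple n sigma)
  (tuple_measure mu n) measurableT mf (fun v _ => f0 v).
rewrite preimage_setT => <-.
apply: eq_measure_integral => [|mc A mA AT]; first exact: measurable_perm_tuple.
exact: tuple_measure_perm.
Qed.

Lemma integral_perm n (sigma : {perm 'I_n}) (f : n.-tuple T -> \bar R) :
  measurable_fun [set: n.-tuple T] f ->
  \int[tuple_measure mu n]_v f (perm_tuple sigma v) = \int[tuple_measure mu n]_v f v.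
Proof.
move=> mf; rewrite integralE [RHS]integralE; congr (_ - _).
- transitivity (\int[tuple_measure mu n]_v f^\+ (perm_tuple sigma v)).
    by apply: eq_integral => v _; rewrite !funeposE.
  exact: ge0_integral_perm (measurable_funepos mf) (funepos_ge0 f).
- transitivity (\int[tuple_measure mu n]_v f^\- (perm_tuple sigma v)).
    by apply: eq_integral => v _; rewrite !funenegE.
  exact: ge0_integral_perm (measurable_funeneg mf) (funeneg_ge0 f).
Qed.

End tuple_integration.

(** * Affine substitutions on the line *)

Section lebesgue_affine.
Context {R : realType}.
Local Notation leb := (@lebesgue_measure R).

Let affine (c h : R) (x : measurableTypeR R) : measurableTypeR R := c * x + h.

Let measurable_affine c h : measurable_fun setT (affine c h).
Proof.
apply: (@measurable_funD _ R R) => //; apply: (@measurable_funM _ R R) => //.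
Qed.

Let preimage_affine (c h a b : R) : c != 0 ->
  (leb (affine c h @^-1` `]a, b]) = (`|c|^-1)%:E * leb `]a, b])%E.
Proof.
move=> c0; have [cneg|cpos|] := ltgtP c 0; last by move/eqP: c0.
- rewrite (_ : _ @^-1` _ = `[(b - h) / c, (a - h) / c[%classic); last first.
    apply/seteqP; split=> x /=; rewrite !in_itv/= /affine => /andP[xa xb];
      apply/andP; split.
    + by rewrite ler_ndivrMr//; lra.
    + by rewrite ltr_ndivlMr//; lra.
    + by move: xb; rewrite ltr_ndivlMr//; lra.
    + by move: xa; rewrite ler_ndivrMr//; lra.
  rewrite !lebesgue_measure_itv/= !lte_fin ltr_nM2r ?invr_lt0// ltrD2r ltr0_norm//.
  case: ifPn => ab; last by rewrite mule0.
  by rewrite -!EFinD -EFinM; congr EFin; field.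
- rewrite (_ : _ @^-1` _ = `](a - h) / c, (b - h) / c]%classic); last first.
    apply/seteqP; split=> x /=; rewrite !in_itv/= /affine => /andP[xa xb];
      apply/andP; split.
    + by rewrite ltr_pdivrMr//; lra.
    + by rewrite ler_pdivlMr//; lra.
    + by move: xa; rewrite ltr_pdivrMr//; lra.
    + by move: xb; rewrite ler_pdivlMr//; lra.
  rewrite !lebesgue_measure_itv/= !lte_fin ltr_pM2r ?invr_gt0// ltrD2r gtr0_norm//.
  case: ifPn => ab; last by rewrite mule0.
  by rewrite -!EFinD -EFinM; congr EFin; field.
Qed.

(** The image of the Lebesgue measure under the substitution, multiplied by the
    slope, gives every half-open interval its length. *)
Lemma ge0_integral_affine (c h : R) (f : R -> \bar R) : c != 0 ->
  measurable_fun setT f -> (forall x, 0 <= f x)%E ->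
  (\int[leb]_x f (c * x + h)%R = (`|c|^-1)%:E * \int[leb]_x f x)%E.
Proof.
move=> c0 mf f0.
pose nu : {measure set (measurableTypeR R) -> \bar R} :=
  measure_function_pushforward__canonical__measure_function_Measure
    leb (@measurable_affine c h).
have c1 : 0 <= `|c| by [].
have lebE A : measurable A -> leb A = mscale (NngNum c1) nu A.
  apply: lebesgue_measure_unique => _ [[a b] _ <-].
  transitivity (`|c|%:E * leb (affine c h @^-1` `]a, b]))%E; last by [].
  rewrite preimage_affine// muleA -EFinM.
  by rewrite divff ?normr_eq0// mul1e.
rewrite [in RHS](eq_measure_integral (mscale (NngNum c1) nu)); last first.
  by move=> A mA _; exact: lebE.
rewrite ge0_integral_mscale//= muleA -EFinM mulVf ?normr_eq0// mul1e.
have := ge0_integral_pushforward (@measurable_affine c h) leb measurableT mf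
  (fun v _ => f0 v).
by rewrite preimage_setT => ->.
Qed.

End lebesgue_affine.

(** * The Fourier transform of the Gaussian *)

Section gaussian_cosine_transform.
Context {R : realType}.
Local Notation leb := (@lebesgue_measure R).

Lemma is_derive_scaled_sqr (c z : R) :
  is_derive z (1 : R) (fun y : R => c * y ^+ 2) (2 * c * z).
Proof.
rewrite (_ : (fun y : R => _) = c \*: (@id R ^+ 2)); last first.
  by apply/funext => y /=; rewrite exprfctE.
have h := is_deriveX 2 (is_derive_id z (1 : R)).
have h' := @is_deriveZ _ _ _ _ c _ _ _ h.
apply: (is_derive_eq h').
by rewrite /GRing.scale/= expr1; ring.
Qed.

Lemma is_derive_gauss_fun (z : R) :
  is_derive z (1 : R) (@gauss_fun R) (- (2 * z) * gauss_fun z).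
Proof.
have h : is_derive z (1 : R) (fun y : R => - y ^+ 2) (- (2 * z)).
  under eq_fun do rewrite -mulN1r.
  by apply: (is_derive_eq (is_derive_scaled_sqr _ _)); lra.
by apply: (is_derive_eq (is_derive1_comp (is_derive_expR _) h)); rewrite mulrC.
Qed.

Lemma is_derive_scale (b z : R) : is_derive z (1 : R) (fun y : R => b * y) b.
Proof.
apply: (is_derive_eq (is_deriveZ b (is_derive_id z 1))).
by rewrite /GRing.scale/= mulr1.
Qed.

Lemma integral_expR_sqr (c : R) : 0 < c ->
  (\int[leb]_z (expR (- (c * z ^+ 2)))%:E = ((Num.sqrt c)^-1 * Num.sqrt pi)%:E)%E.
Proof.
move=> c0; have sc : 0 < Num.sqrt c by rewrite sqrtr_gt0.
rewrite EFinM -integralT_gauss -(gtr0_norm sc).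
rewrite -(ge0_integral_affine 0 (f := EFin \o gauss_fun)) ?gt_eqF//.
- apply: eq_integral => z _; rewrite /= /gauss_fun addr0 exprMn sqr_sqrtr//.
  exact: ltW.
- by apply/measurable_EFinP; exact: measurable_gauss_fun.
- by move=> x; rewrite lee_fin gauss_fun_ge0.
Qed.

Lemma measurable_expR_sqr (c : R) :
  measurable_fun setT (fun z : R => expR (- (c * z ^+ 2))).
Proof.
apply: measurableT_comp => //; apply: measurable_funN.
by apply: measurable_funM => //; exact: measurable_funX.
Qed.

Lemma integrable_expR_sqr (c : R) : 0 < c ->
  leb.-integrable setT (fun z => (expR (- (c * z ^+ 2)))%:E).
Proof.
move=> c0; apply/integrableP; split.
  by apply/measurable_EFinP; exact: measurable_expR_sqr.
under eq_integral do rewrite gee0_abs ?lee_fin ?expR_ge0//.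
by rewrite integral_expR_sqr// ltry.
Qed.

(** Domination that is uniform in the frequency, for differentiating the cosine
    transform under the integral sign: |z| <= 1 + z^2/2 <= exp(z^2/2). *)
Lemma norm_gauss_le (z : R) : `|z| * gauss_fun z <= expR (- (2^-1 * z ^+ 2)).
Proof.
have -> : gauss_fun z = expR (- (2^-1 * z ^+ 2)) * expR (- (2^-1 * z ^+ 2)).
  by rewrite -expRD /gauss_fun; congr expR; lra.
rewrite mulrA ler_piMl ?expR_ge0// expRN ler_pdivrMr ?expR_gt0// mul1r.
apply: le_trans (expR_ge1Dx _).
have := sqr_ge0 (`|z| - 1); rewrite sqrrB expr1n mulr1 -normrX.
by rewrite ger0_norm ?sqr_ge0//; lra.
Qed.

(** Integration by parts on the whole line is this statement applied to a
    product that vanishes at infinity. *)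
Lemma Rintegral_derivative_eq0 (S g : R -> R) :
  (forall x, is_derive x (1 : R) S (g x)) -> continuous g ->
  leb.-integrable setT (EFin \o g) ->
  S n%:R @[n --> \oo] --> 0 -> S (- n%:R) @[n --> \oo] --> 0 ->
  \int[leb]_x g x = 0.
Proof.
move=> dS cg ig S1 S2.
pose I n : interval R := `[(- n%:R : R), n%:R].
have mg : measurable_fun setT g by exact: continuous_measurable_fun.
have h1 : (\int[leb]_(x in [set` I n]) (g x)%:E)%E @[n --> \oo] -->
    (\int[leb]_x (g x)%:E)%E.
  under eq_fun do rewrite integral_mkcond.
  apply: (@dominated_cvg _ _ _ leb setT measurableT
    (fun n => (EFin \o g) \_ [set` I n]) (EFin \o g) (fun x => `|(g x)%:E|%E)).
  - move=> n; apply/(measurable_restrictT _ _).1 => //.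
    by apply/measurable_EFinP; exact: measurable_funTS.
  - move=> x _; apply: cvg_near_cst; near=> n.
    rewrite patchE mem_set//= in_itv/= -ler_norml.
    by near: n; exact: nbhs_infty_ger.
  - by [].
  - exact: integrable_abse.
  - by move=> n x _; rewrite patchE; case: ifPn => // _; rewrite abse0.
have h2 : (\int[leb]_(x in [set` I n]) (g x)%:E)%E @[n --> \oo] --> 0%E.
  have h3 : ((S n%:R)%:E - (S (- n%:R))%:E)%E @[n --> \oo] --> 0%E.
    rewrite -(sube0 0%E); apply: cvgeB => //.
      by apply: cvg_EFin S1; exact: nearW.
    by apply: cvg_EFin S2; exact: nearW.
  apply: cvg_trans h3; apply: near_eq_cvg; near=> n.
  have cS : continuous S.
    move=> x; apply: differentiable_continuous; apply/derivable1_diffP.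
    by have [] := dS x.
  rewrite (@continuous_FTC2 _ g S)//.
  - rewrite gtrN// ltr0n; near: n; exact: nbhs_infty_gt.
  - by apply: continuous_subspaceT => x; exact: cg.
  - split.
    + by move=> x _; have [] := dS x.
    + by apply: cvg_at_right_filter; exact: cS.
    + by apply: cvg_at_left_filter; exact: cS.
  - by move=> x _; rewrite derive1E; have [_ ->] := dS x.
by rewrite /Rintegral (cvg_unique _ h1 h2).
Unshelve. all: end_near. Qed.

Lemma gauss_fun_sqr_cvg0 : @gauss_fun R n%:R @[n --> \oo] --> 0.
Proof.
apply: (@squeeze_cvgr _ _ _ _ (cst 0) (fun n => expR (- n%:R))); last 2 first.
- exact: cvg_cst.
- exact: cvgn_expR.
near=> n; rewrite expR_ge0/= ler_expR lerN2 expr2.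
by rewrite ler_peMr// ler1n; near: n; exact: nbhs_infty_gt.
Unshelve. all: end_near. Qed.

Let F (b : R) := \int[leb]_z (cos (b * z) * gauss_fun z).

Let norm_cos_le1 (x : R) : `|cos x| <= 1.
Proof. by rewrite ler_norml cos_geN1 cos_le1. Qed.

Let norm_sin_le1 (x : R) : `|sin x| <= 1.
Proof. by rewrite ler_norml sin_geN1 sin_le1. Qed.

Lemma measurable_cos_scale (b : R) : measurable_fun setT (fun z : R => cos (b * z)).
Proof.
have mcos : measurable_fun setT (@cos R).
  by apply: continuous_measurable_fun; exact: continuous_cos.
by apply: (measurableT_comp mcos); exact: measurable_funM.
Qed.

Lemma measurable_sin_scale (b : R) : measurable_fun setT (fun z : R => sin (b * z)).
Proof.
have msin : measurable_fun setT (@sin R).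
  by apply: continuous_measurable_fun; exact: continuous_sin.
by apply: (measurableT_comp msin); exact: measurable_funM.
Qed.

Lemma integrable_cos_gauss b :
  leb.-integrable setT (fun z : R => (cos (b * z) * gauss_fun z)%:E).
Proof.
apply: (@le_integrable _ (measurableTypeR R) R leb setT measurableT _ (EFin \o gauss_fun)) => //.
- apply/measurable_EFinP; apply: measurable_funM.
    exact: measurable_cos_scale.
  exact: measurable_gauss_fun.
- move=> x _; rewrite lee_fin normrM ler_piMl//; exact: norm_cos_le1.
- exact: integrableT_gauss.
Qed.

Let integrable_sin_gauss b :
  leb.-integrable setT (fun z : R => (z * sin (b * z) * gauss_fun z)%:E).
Proof.
apply: (@le_integrable _ (measurableTypeR R) R leb setT measurableT _
  (fun z => (expR (- (2^-1 * z ^+ 2)))%:E)).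
- apply/measurable_EFinP; apply: measurable_funM.
    apply: measurable_funM => //.
    exact: measurable_sin_scale.
  exact: measurable_gauss_fun.
- move=> x _; rewrite lee_fin !normrM (ger0_norm (expR_ge0 _)).
  apply: le_trans (norm_gauss_le x).
  rewrite (ger0_norm (gauss_fun_ge0 _)) ler_wpM2r ?gauss_fun_ge0//.
  by rewrite ler_piMr.
- by apply: integrable_expR_sqr; rewrite invr_gt0.
Qed.

Let gauss_byparts b :
  2 * \int[leb]_z (z * sin (b * z) * gauss_fun z) = b * F b.
Proof.
pose S (z : R) := sin (b * z) * gauss_fun z.
pose g (z : R) := b * (cos (b * z) * gauss_fun z) - 2 * (z * sin (b * z) * gauss_fun z).
have dS x : is_derive x (1 : R) S (g x).
  have h := is_derive1_comp (is_derive_sin (b * x)) (is_derive_scale b x).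
  apply: (is_derive_eq (is_deriveM h (is_derive_gauss_fun x))).
  by rewrite /GRing.scale/= /g; ring.
have i1 : leb.-integrable setT (fun z => (b * (cos (b * z) * gauss_fun z))%:E).
  exact: (integrableZl measurableT b (integrable_cos_gauss b)).
have i2 : leb.-integrable setT (fun z => (2 * (z * sin (b * z) * gauss_fun z))%:E).
  exact: (integrableZl measurableT 2 (integrable_sin_gauss b)).
have S0 (u : nat -> R) : (forall n, gauss_fun (u n) = gauss_fun n%:R) ->
    S (u n) @[n --> \oo] --> 0.
  move=> uE; apply: norm_cvg0.
  apply: (@squeeze_cvgr _ _ _ _ (cst 0) (fun n => gauss_fun n%:R)); last 2 first.
  - exact: cvg_cst.
  - exact: gauss_fun_sqr_cvg0.
  apply: nearW => n; rewrite normr_ge0/= normrM (ger0_norm (gauss_fun_ge0 _)) uE.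
  by rewrite ler_piMl// gauss_fun_ge0.
have : \int[leb]_x g x = 0.
  apply: (Rintegral_derivative_eq0 dS).
  - move=> x.
    have cb : {for x, continuous (fun y : R => b * y)} by apply: cvgZl_tmp; exact: cvg_id.
    have cc : {for x, continuous (fun y : R => cos (b * y))}.
      by apply: (continuous_comp cb); exact: continuous_cos.
    have cs : {for x, continuous (fun y : R => sin (b * y))}.
      by apply: (continuous_comp cb); exact: continuous_sin.
    have cgs := @continuous_gauss_fun R x.
    apply: cvgB; first by apply: cvgM; [exact: cvg_cst|apply: cvgM].
    apply: cvgM; first exact: cvg_cst.
    by apply: cvgM => //; apply: cvgM => //; exact: cvg_id.
  - exact: (integrableB (measurableT : measurable [set: measurableTypeR R]) i1 i2).
  - exact: S0.
  - by apply: S0 => n; rewrite /gauss_fun sqrrN.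
rewrite /g RintegralB// !RintegralZl//; last 2 first.
- exact: integrable_sin_gauss.
- exact: integrable_cos_gauss.
by move/eqP; rewrite subr_eq0 => /eqP <-.
Qed.

Let F_derive b : is_derive b (1 : R) F (- (b / 2) * F b).
Proof.
pose f (x y : R) := cos (x * y) * gauss_fun y.
have df (x y : R) : is_derive x (1 : R) (f^~ y) (- (y * sin (x * y) * gauss_fun y)).
  have h0 : is_derive x (1 : R) (fun t : R => t * y) y.
    by under eq_fun do rewrite mulrC; exact: is_derive_scale.
  have h := @is_derive1_comp _ cos (fun t : R => t * y) x _ _ (is_derive_cos _) h0.
  apply: (is_derive_eq (is_deriveM h (is_derive_cst (gauss_fun y) x 1))).
  by rewrite /GRing.scale/=; ring.
have dfE (x y : R) : partial1of2 f x y = - (y * sin (x * y) * gauss_fun y).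
  by rewrite partial1of2E; have [_ ->] := df x y.
pose G (y : R) := expR (- (2^-1 * y ^+ 2)).
have ab : `](b - 1), (b + 1)[%classic b by rewrite /= in_itv/=; lra.
have h1 (x : R) : `](b - 1), (b + 1)[%classic x -> leb.-integrable setT (EFin \o f x).
  by move=> _; exact: integrable_cos_gauss.
have h2 (x y : R) : `](b - 1), (b + 1)[%classic x -> [set: R] y -> derivable (f^~ y) x 1.
  by move=> _ _; have [] := df x y.
have h3 (y : R) : 0 <= G y by exact: expR_ge0.
have h4 : leb.-integrable setT (EFin \o G).
  by apply: integrable_expR_sqr; rewrite invr_gt0.
have h5 (x y : R) : `](b - 1), (b + 1)[%classic x -> [set: R] y ->
    `|partial1of2 f x y| <= G y.
  move=> _ _; rewrite dfE normrN !normrM.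
  apply: le_trans (norm_gauss_le y).
  by rewrite (ger0_norm (gauss_fun_ge0 _)) ler_wpM2r ?gauss_fun_ge0// ler_piMr.
have D1 := derivable_under_integral measurableT ab h1 h2 h3 h4 h5.
have D2 := differentiation_under_integral measurableT ab h1 h2 h3 h4 h5.
apply: DeriveDef; first exact: D1.
rewrite -derive1E; apply: (eq_trans D2).
under eq_Rintegral do rewrite dfE.
rewrite (_ : (fun _ => _) = (fun y => -1 * (y * sin (b * y) * gauss_fun y))); last first.
  by apply/funext => y; rewrite mulN1r.
rewrite RintegralZl//; last exact: integrable_sin_gauss.
by have := gauss_byparts b; lra.
Qed.

(** The transform F satisfies F' = - (b/2) F: differentiate under the integral
    sign, then integrate by parts. Hence F(b) exp(b^2/4) is constant. *)
Lemma Rintegral_cos_gauss b :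
  \int[leb]_z (cos (b * z) * gauss_fun z) = Num.sqrt pi * expR (- (b ^+ 2 / 4)).
Proof.
pose K (x : R) := F x * expR (4^-1 * x ^+ 2).
have dK x : is_derive x (1 : R) K 0.
  have h0 : is_derive x (1 : R) (fun t : R => 4^-1 * t ^+ 2) (x / 2).
    by apply: (is_derive_eq (is_derive_scaled_sqr _ _)); lra.
  have h := is_derive1_comp (is_derive_expR _) h0.
  apply: (is_derive_eq (is_deriveM (F_derive x) h)).
  by rewrite /GRing.scale/=; ring.
have KE := is_derive_0_is_cst b 0 dK.
have F0 : F 0 = Num.sqrt pi.
  rewrite /F; under eq_Rintegral do rewrite mul0r cos0 mul1r.
  by rewrite /Rintegral integralT_gauss.
have -> : expR (- (b ^+ 2 / 4)) = (expR (4^-1 * b ^+ 2))^-1.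
  by rewrite -expRN; congr expR; lra.
apply: (@mulIf _ (expR (4^-1 * b ^+ 2))); first by rewrite gt_eqF ?expR_gt0.
rewrite mulfVK ?gt_eqF ?expR_gt0// -F0.
by rewrite -/(F b) -/(K b) KE /K expr0n/= mulr0 expR0 mulr1.
Qed.

End gaussian_cosine_transform.

(** * Integrals of powers near the origin *)

Section power_integrals.
Context {R : realType}.
Local Notation leb := (@lebesgue_measure R).

Lemma measurable_normr_powR (c h : R) : measurable_fun setT (fun u : R => `|u - h| `^ c).
Proof.
apply: (measurableT_comp (measurable_powR c)).
by apply: measurableT_comp => //; exact: measurable_funB.
Qed.

Lemma continuous_within_powR (c a b : R) : 0 < a ->
  {within `[a, b], continuous (fun u : R => u `^ c)}.
Proof.
move=> a0; apply: derivable_within_continuous => x; rewrite in_itv/= => /andP[ax _].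
by apply: ex_derive; apply: is_derive1_powR; exact: lt_le_trans ax.
Qed.

Lemma integral_powR_itv (c a b : R) : -1 < c -> 0 < a -> a < b ->
  (\int[leb]_(u in `[a, b]) (u `^ c)%:E =
   ((b `^ (c + 1) - a `^ (c + 1)) / (c + 1))%:E)%E.
Proof.
move=> c1 a0 ab; have c0 : c + 1 != 0 by rewrite gt_eqF//; lra.
have dF (x : R) : 0 < x -> is_derive x (1 : R) (fun u : R => (c + 1)^-1 * u `^ (c + 1)) (x `^ c).
  move=> x0; have h := @is_deriveZ _ _ _ _ (c + 1)^-1 _ _ _ (is_derive1_powR (c + 1) x0).
  apply: (is_derive_eq h).
  by rewrite /GRing.scale/= addrK mulrA mulVf// mul1r.
have cF (x : R) : 0 < x -> {for x, continuous (fun u : R => (c + 1)^-1 * u `^ (c + 1))}.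
  move=> x0; apply: differentiable_continuous; apply/derivable1_diffP.
  by have [] := dF x x0.
rewrite (@continuous_FTC2 _ _ (fun u => (c + 1)^-1 * u `^ (c + 1)))//.
- by rewrite -EFinB; congr EFin; field.
- exact: continuous_within_powR.
- split.
  + by move=> x; rewrite in_itv/= => /andP[ax _]; have [] := dF x (lt_trans a0 ax).
  + by apply: cvg_at_right_filter; exact: cF.
  + by apply: cvg_at_left_filter; apply: cF; exact: lt_trans ab.
- move=> x; rewrite in_itv/= => /andP[ax _].
  by rewrite derive1E; have [_ ->] := dF x (lt_trans a0 ax).
Qed.

(** The interval is exhausted by compact intervals away from 0, where a
    primitive is available, and the bound does not depend on the exhaustion. *)
Lemma integral_powR_le (c T : R) : -1 < c -> 0 < T ->
  (\int[leb]_(u in `]0%R, T]) (u `^ c)%:E <= (T `^ (c + 1) / (c + 1))%:E)%E.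
Proof.
move=> c1 T0.
pose F (n : nat) : set R := `[T * (n.+2%:R)^-1, T]%classic.
have FE : `]0, T]%classic = \bigcup_n F n.
  apply/seteqP; split=> x /=; rewrite in_itv/=.
    move=> /andP[x0 xT]; exists (Num.truncn (T / x)) => //=.
    rewrite /F/= in_itv/= xT andbT ler_pdivrMr// mulrC -ler_pdivrMr//.
    by apply: ltW; apply: lt_trans (truncnS_gt _) _; rewrite ltr_nat.
  move=> [n _]; rewrite /F/= in_itv/= => /andP[h ->]; rewrite andbT.
  by apply: lt_le_trans h; rewrite mulr_gt0// invr_gt0.
rewrite FE.
have mf : measurable_fun setT (fun u : R => (u `^ c)%:E).
  by apply/measurable_EFinP; exact: measurable_powR.
have cvgF := @ge0_nondecreasing_set_cvg_integral _ (measurableTypeR R) R F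
  (fun u : R => (u `^ c)%:E) leb.
apply: (@cvge_to_le _ _ _ _ _ _ _ (cvgF _ _ _ _)).
- apply/nondecreasing_seqP => n; rewrite subsetEset => x; rewrite /F/= !in_itv/=.
  move=> /andP[h ->]; rewrite andbT; apply: le_trans h.
  by rewrite ler_pM2l// lef_pV2 ?posrE// ler_nat.
- by move=> n; exact: measurable_itv.
- by move=> n; exact: measurable_funTS.
- by move=> n x _; rewrite lee_fin powR_ge0.
apply: nearW => n; rewrite integral_powR_itv//.
- rewrite lee_fin ler_wpM2r ?invr_ge0//; first lra.
  by rewrite lerBlDr lerDl powR_ge0.
- by rewrite mulr_gt0// invr_gt0.
- by rewrite gtr_pMr// invf_lt1// ltr1n.
Qed.

Lemma integral_invr_infty (r : R) : 0 < r ->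
  (\int[leb]_(w in `]0%R, r]) (w^-1)%:E = +oo)%E.
Proof.
move=> r0; apply/eqyP => A A0.
(* Over [e, r] the integral is ln (r / e) = A. *)
pose e := r * expR (- A).
have e0 : 0 < e by rewrite mulr_gt0// expR_gt0.
have er : e < r by rewrite gtr_pMr// expR_lt1; lra.
have dF (x : R) : 0 < x -> is_derive x (1 : R) (@ln R) x^-1 by exact: is_derive1_ln.
have cF (x : R) : 0 < x -> {for x, continuous (@ln R)}.
  move=> x0; apply: differentiable_continuous; apply/derivable1_diffP.
  by have [] := dF x x0.
have mf : measurable_fun `]0, r]%classic (fun w : R => (w^-1)%:E).
  apply/measurable_EFinP; apply: (eq_measurable_fun (fun w : R => w `^ (-1))).
    by move=> x; rewrite inE/= in_itv/= => /andP[x0 _]; rewrite powR_inv1 ?ltW.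
  by apply: measurable_funTS; exact: measurable_powR.
have : (\int[leb]_(w in `[e, r]) (w^-1)%:E = A%:E)%E.
  rewrite (@continuous_FTC2 _ _ (@ln R))//.
  - rewrite -EFinB; congr EFin; rewrite /e lnM ?posrE ?expR_gt0// expRK; lra.
  - apply: derivable_within_continuous => x; rewrite in_itv/= => /andP[ax _].
    apply: derivableV; first by rewrite gt_eqF//; exact: lt_le_trans ax.
    exact: derivable_id.
  - split.
    + by move=> x; rewrite in_itv/= => /andP[ax _]; have [] := dF x (lt_trans e0 ax).
    + by apply: cvg_at_right_filter; exact: cF.
    + by apply: cvg_at_left_filter; exact: cF.
  - move=> x; rewrite in_itv/= => /andP[ax _].
    by rewrite derive1E; have [_ ->] := dF x (lt_trans e0 ax).
move=> <-; apply: ge0_subset_integral => //.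
- by move=> x /=; rewrite in_itv/= => /andP[x0 _]; rewrite lee_fin invr_ge0 ltW.
- move=> x /=; rewrite !in_itv/= => /andP[ex ->]; rewrite andbT.
  exact: lt_le_trans ex.
Qed.

End power_integrals.

(** * Gaussian averages of shifted powers *)

Section smoothing_estimate.
Context {R : realType}.
Local Notation leb := (@lebesgue_measure R).
Implicit Types a b c p q x y z h : R.

Lemma gt0_ler_powRN p x y : p <= 0 -> 0 < x -> x <= y -> y `^ p <= x `^ p.
Proof.
move=> p0 x0 xy; rewrite -(opprK p) !(powRN _ (- p)) lef_pV2 ?posrE ?powR_gt0//.
  by apply: ge0_ler_powR => //; rewrite ?nnegrE; lra.
exact: lt_le_trans xy.
Qed.

Lemma ge1_powR_ge1 p x : 1 <= x -> 0 <= p -> 1 <= x `^ p.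
Proof. by move=> x1 p0; rewrite -(powRr0 x); exact: ler_powR. Qed.

Lemma powR0_le1 p : (0 : R) `^ p <= 1.
Proof. by have [->|p0] := eqVneq p 0; rewrite ?powRr0// powR0. Qed.

Let m z := Num.max 1 `|z|.

Let m_ge1 z : 1 <= m z. Proof. by rewrite le_max lexx. Qed.
Let m_gt0 z : 0 < m z. Proof. exact: lt_le_trans (m_ge1 z). Qed.
Let m_norm z : `|z| <= m z. Proof. by rewrite le_max lexx orbT. Qed.

(** With x = max(1,|z|): ln x < x and p x <= p^2 + x^2/4, while x^2 <= 1 + z^2.
    *)
Lemma max1_powR_le_expR p z :
  m z `^ p <= expR (p ^+ 2 + 4^-1) * expR (4^-1 * z ^+ 2).
Proof.
rewrite -expRD.
have [p0|p0] := leP p 0.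
  apply: (@le_trans _ _ 1); first by rewrite -(powRr0 (m z)) ler_powR.
  by rewrite -expR0 ler_expR addr_ge0// ?addr_ge0 ?sqr_ge0// mulr_ge0// sqr_ge0.
rewrite /powR gt_eqF// ler_expR.
apply: (@le_trans _ _ (p * m z)).
  by rewrite ler_pM2l//; apply/ltW/ln_sublinear.
have h : m z ^+ 2 <= 1 + z ^+ 2.
  have := sqr_ge0 z; rewrite /m /Num.max; case: ifP => _ z2.
    by rewrite real_normK ?num_real//; lra.
  by rewrite expr1n; lra.
have := sqr_ge0 (p - 2^-1 * m z); rewrite sqrrB exprMn; lra.
Qed.

(** Shifting by h costs the factor max(1,|h|)^a, with the right decay when a <
    0: either z - h is at least half as large as max(1,|h|), or max(1,|z|) is.
    *)
Let shifted_powR_le a z h :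
  `|z - h| `^ a <= 2 `^ `|a| * m h `^ a * m z `^ `|a| * (1 + `|z - h| `^ Num.min a 0).
Proof.
have [a0|a0] := leP 0 a.
  rewrite (ger0_norm a0).
  have -> : 2 `^ a * m h `^ a * m z `^ a = (2 * m h * m z) `^ a.
    by rewrite !powRM// ?mulr_ge0// ltW.
  apply: (@le_trans _ _ ((2 * m h * m z) `^ a)); last first.
    by rewrite ler_peMr ?powR_ge0// lerDl powR_ge0.
  apply: ge0_ler_powR; rewrite ?nnegrE// ?mulr_ge0// ?(ltW (m_gt0 _))//.
  apply: (le_trans (ler_normB _ _)).
  have := m_norm z; have := m_norm h; have := m_ge1 z; have := m_ge1 h.
  by move: (m z) (m h) `|z| `|h| => *; nra.
rewrite (ltr0_norm a0).
have na0 : 0 <= - a by lra.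
have mz1 : 1 <= m z `^ (- a) by exact: ge1_powR_ge1.
have [hz|hz] := leP (m h) (2 * `|z - h|).
  have zh0 : 0 < `|z - h| by have := m_gt0 h; lra.
  apply: (@le_trans _ _ (2 `^ (- a) * m h `^ a)); last first.
    rewrite -mulrA ler_peMr ?mulr_ge0 ?powR_ge0//.
    by rewrite mulr_ege1// lerDl powR_ge0.
  have -> : 2 `^ (- a) * m h `^ a = (2^-1 * m h) `^ a.
    rewrite powRM ?invr_ge0 ?(ltW (m_gt0 _))//; congr (_ * _).
    by rewrite -(powR_inv1 (_ : 0 <= 2 :> R))// -powRrM mulN1r.
  apply: gt0_ler_powRN; first exact: ltW.
    by rewrite mulr_gt0 ?invr_gt0.
  lra.
(* Now |z - h| < m h / 2; if m h = |h|, then |z| > |h| / 2. *)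
have hz2 : m h <= 2 * m z.
  have h1 : `|h| <= `|z - h| + `|z|.
    by have := ler_normD (h - z) z; rewrite subrK distrC.
  have [e|e] : m h = 1 \/ m h = `|h|.
    by rewrite /m /Num.max; case: ifP; [right|left].
  - by have := m_ge1 z; rewrite e; lra.
  - by move: hz h1 (m_norm z); rewrite e; move: (m z) `|z| `|z - h| `|h| => *; lra.
have k : 1 <= 2 `^ (- a) * m h `^ a * m z `^ (- a).
  have -> : m h `^ a = (m h `^ (- a))^-1 by rewrite -powRN opprK.
  rewrite mulrAC -powRM ?(ltW (m_gt0 _))//.
  rewrite ler_pdivlMr ?powR_gt0// mul1r.
  by apply: ge0_ler_powR; rewrite ?nnegrE ?mulr_ge0 ?(ltW (m_gt0 _)).
apply: (@le_trans _ _ (1 * `|z - h| `^ a)); first by rewrite mul1r.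
apply: (@le_trans _ _ (2 `^ (- a) * m h `^ a * m z `^ (- a) * `|z - h| `^ a)).
  by rewrite ler_wpM2r ?powR_ge0.
by rewrite ler_wpM2l ?mulr_ge0 ?powR_ge0// lerDr.
Qed.

Let powR_le_min b z : `|z| `^ b <= m z `^ `|b| * `|z| `^ Num.min b 0.
Proof.
have [b0|b0] := leP 0 b.
  rewrite (ger0_norm b0) powRr0 mulr1.
  by apply: ge0_ler_powR; rewrite ?nnegrE ?(ltW (m_gt0 _)).
by rewrite ler_peMl ?powR_ge0// ge1_powR_ge1.
Qed.

(** A product of two negative powers is at most the sum of the two powers with
    the added exponent, since the smaller of x and y dominates. The constant
    term covers x >= 1 and the conventions at 0. *)
Let powR_mul_le p q x y : p <= 0 -> q <= 0 -> 0 <= x -> 0 <= y ->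
  (1 + y `^ p) * x `^ q <= 2 * (1 + x `^ (p + q) + y `^ (p + q)).
Proof.
move=> p0 q0 x0 y0; have gx := powR_ge0 x (p + q); have gy := powR_ge0 y (p + q).
have hx : x `^ q <= 1 + x `^ (p + q).
  have [->|xn0] := eqVneq x 0.
    by apply: le_trans (powR0_le1 q) _; rewrite lerDl powR_ge0.
  have xp : 0 < x by rewrite lt_neqAle eq_sym xn0.
  have [x1|x1] := leP 1 x.
    by apply: (@le_trans _ _ 1); [rewrite -(powRr0 x) ler_powR|rewrite lerDl].
  apply: (@le_trans _ _ (x `^ (p + q))); last by rewrite lerDr.
  by apply: ger_powR; [rewrite xp (ltW x1)|lra].
have hxy : y `^ p * x `^ q <= x `^ (p + q) + y `^ (p + q).
  have [->|xn0] := eqVneq x 0.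
    have [->|qn0] := eqVneq q 0; first by rewrite powRr0 mulr1 addr0 lerDr powR_ge0.
    by rewrite (powR0 qn0) mulr0 addr_ge0// powR_ge0.
  have [->|yn0] := eqVneq y 0.
    have [->|pn0] := eqVneq p 0; first by rewrite powRr0 mul1r add0r lerDl powR_ge0.
    by rewrite (powR0 pn0) mul0r addr_ge0// powR_ge0.
  have xp : 0 < x by rewrite lt_neqAle eq_sym xn0.
  have yp : 0 < y by rewrite lt_neqAle eq_sym yn0.
  rewrite !powRD ?xn0 ?yn0 ?implybT//.
  have [xy|yx] := leP x y.
    apply: (@le_trans _ _ (x `^ p * x `^ q)); last by rewrite lerDl mulr_ge0 ?powR_ge0.
    by rewrite ler_wpM2r ?powR_ge0// gt0_ler_powRN.
  apply: (@le_trans _ _ (y `^ p * y `^ q)); last by rewrite lerDr mulr_ge0 ?powR_ge0.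
  by rewrite ler_wpM2l ?powR_ge0// gt0_ler_powRN// ltW.
lra.
Qed.

Let gauss_half z := expR (- (2^-1 * z ^+ 2)).

(** Collects the three previous bounds. The point is that h enters through
    max(1,|h|)^a and through singularities whose integrals are bounded
    uniformly in h. *)
Let pointwise a b : exists2 C : R, 0 < C & forall z h,
  expR (- z ^+ 2) * (`|z - h| `^ a * `|z| `^ b) <=
  C * m h `^ a * (gauss_half z * (1 + `|z| `^ (Num.min a 0 + Num.min b 0)
                                    + `|z - h| `^ (Num.min a 0 + Num.min b 0))).
Proof.
set c := Num.min a 0 + _; pose p := `|a| + `|b|.
pose C1 : R := 2 `^ `|a|; pose C2 := expR (p ^+ 2 + 4^-1).
exists (C1 * C2 * 2); first by rewrite !mulr_gt0 ?powR_gt0 ?expR_gt0.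
move=> z h.
set X := `|z - h|; set Y := `|z|.
have a0 : Num.min a 0 <= 0 by rewrite ge_min lexx orbT.
have b0 : Num.min b 0 <= 0 by rewrite ge_min lexx orbT.
have k1 := shifted_powR_le a z h; have k2 := powR_le_min b z.
have k3 := @powR_mul_le _ _ Y X a0 b0 (normr_ge0 _) (normr_ge0 _).
have k4 := max1_powR_le_expR p z; rewrite -/C2 in k4.
rewrite -/X -/C1 in k1; rewrite -/Y in k2; rewrite -/c in k3.
have e3 : expR (- z ^+ 2) * expR (4^-1 * z ^+ 2) <= gauss_half z.
  by rewrite -expRD ler_expR; have := sqr_ge0 z; lra.
have mp : m z `^ `|a| * m z `^ `|b| = m z `^ p by rewrite -powRD//; apply/implyP => _; rewrite gt_eqF.
apply: (@le_trans _ _ (expR (- z ^+ 2) * ((C1 * m h `^ a * m z `^ `|a| * (1 + X `^ Num.min a 0)) *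
  (m z `^ `|b| * Y `^ Num.min b 0)))).
  by rewrite ler_wpM2l ?expR_ge0//; apply: ler_pM; rewrite ?powR_ge0.
have -> : expR (- z ^+ 2) * (C1 * m h `^ a * m z `^ `|a| * (1 + X `^ Num.min a 0) *
  (m z `^ `|b| * Y `^ Num.min b 0)) =
  C1 * m h `^ a * (expR (- z ^+ 2) * m z `^ p) * ((1 + X `^ Num.min a 0) * Y `^ Num.min b 0).
  by rewrite -mp; ring.
have -> : C1 * C2 * 2 * m h `^ a * (gauss_half z * (1 + Y `^ c + X `^ c)) =
  C1 * m h `^ a * (C2 * gauss_half z) * (2 * (1 + Y `^ c + X `^ c)) by ring.
apply: ler_pM => //.
- by rewrite !mulr_ge0 ?powR_ge0 ?expR_ge0.
- by rewrite mulr_ge0 ?powR_ge0// addr_ge0 ?powR_ge0.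
- rewrite ler_wpM2l ?mulr_ge0 ?powR_ge0//.
  apply: (@le_trans _ _ (expR (- z ^+ 2) * (C2 * expR (4^-1 * z ^+ 2)))).
    by rewrite ler_wpM2l ?expR_ge0.
  by rewrite mulrCA ler_wpM2l ?expR_ge0.
Qed.

Let measurable_gauss_half : measurable_fun setT gauss_half.
Proof. exact: measurable_expR_sqr. Qed.

(** The singular part |z - h| <= 1 is a translate of an integrable function,
    and outside of it the power is at most 1. *)
Let integral_gauss_half_shift c : -1 < c -> c <= 0 -> exists2 C : R, 0 <= C & forall h,
  (\int[leb]_z (gauss_half z * `|z - h| `^ c)%:E <= C%:E)%E.
Proof.
move=> c1 c0.
pose k : R -> \bar R := (fun u : R => (u `^ c)%:E) \_ `]0, 1].
have k0 u : (0 <= k u)%E by rewrite /k patchE; case: ifPn => // _; rewrite lee_fin powR_ge0.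
have mk : measurable_fun setT k.
  apply/(measurable_restrictT _ _).1; first exact: measurable_itv.
  by apply/measurable_EFinP/measurable_funTS; exact: measurable_powR.
have ik : (\int[leb]_u k u <= (1 / (c + 1))%:E)%E.
  rewrite /k -integral_mkcond; apply: le_trans (integral_powR_le c1 _) _ => //.
  by rewrite powR1.
have me : measurable_fun setT (fun z => (gauss_half z)%:E).
  exact/measurable_EFinP.
have ks1 h : (\int[leb]_z k (z - h)%R = \int[leb]_u k u)%E.
  have := @ge0_integral_affine R 1 (- h) k (oner_neq0 _) mk k0.
  by rewrite normr1 invr1 mul1e => <-; apply: eq_integral => z _; rewrite mul1r.
have ks2 h : (\int[leb]_z k (- (z - h))%R = \int[leb]_u k u)%E.
  have n1 : (-1 : R) != 0 by rewrite oppr_eq0 oner_neq0.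
  have := @ge0_integral_affine R (-1) h k n1 mk k0.
  rewrite normrN normr1 invr1 mul1e => <-; apply: eq_integral => z _.
  by congr k; ring.
have mk1 h : measurable_fun setT (fun z => k (z - h)).
  by apply: (measurableT_comp mk); exact: measurable_funB.
have mk2 h : measurable_fun setT (fun z => k (- (z - h))).
  apply: (measurableT_comp mk); apply: measurable_funN; exact: measurable_funB.
pose G : R := (Num.sqrt 2^-1)^-1 * Num.sqrt pi.
have iG : (\int[leb]_z (gauss_half z)%:E = G%:E)%E.
  by rewrite integral_expR_sqr// invr_gt0.
exists (2 * G + (1 / (c + 1) + 1 / (c + 1))).
  have G0 : 0 <= G by apply: mulr_ge0; rewrite ?invr_ge0 sqrtr_ge0.
  have c2 : 0 <= 1 / (c + 1) by apply: divr_ge0; lra.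
  lra.
move=> h.
apply: (@le_trans _ _ (\int[leb]_z (2%:E * (gauss_half z)%:E + (k (z - h)%R + k (- (z - h))%R)))%E).
  apply: ge0_le_integral => //.
  - by move=> z _; rewrite lee_fin mulr_ge0 ?expR_ge0 ?powR_ge0.
  - apply/measurable_EFinP; apply: measurable_funM => //.
    exact: measurable_normr_powR.
  - by apply: emeasurable_funD; [exact: measurable_funeM|exact: (emeasurable_funD (mk1 h) (mk2 h))].
  move=> z _; have g0 : 0 <= gauss_half z by exact: expR_ge0.
  have g1 : gauss_half z <= 1.
    by rewrite -expR0 ler_expR oppr_le0 mulr_ge0// sqr_ge0.
  have bound (x : R) : x `^ c <= 1 -> ((gauss_half z * x `^ c)%:E <=
      2%:E * (gauss_half z)%:E + (k (z - h)%R + k (- (z - h))%R))%E.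
    move=> xc; apply: (@le_trans _ _ (2%:E * (gauss_half z)%:E)%E); last first.
      by rewrite leeDl// adde_ge0.
    by rewrite -EFinM lee_fin; have := powR_ge0 x c; nra.
  have boundk (x : R) : 0 < x -> (x <= 1 -> k x = k (z - h)%R \/ k x = k (- (z - h))%R) ->
     ((gauss_half z * x `^ c)%:E <=
      2%:E * (gauss_half z)%:E + (k (z - h)%R + k (- (z - h))%R))%E.
    move=> x0 kx; have [x1|x1] := leP x 1; last first.
      by apply: bound; rewrite -(powRr0 x) ler_powR// ltW.
    apply: (@le_trans _ _ (k x)).
      rewrite /k patchE mem_set/=; last by rewrite in_itv/= x0 x1.
      by rewrite lee_fin ler_piMl ?powR_ge0.
    apply: (@le_trans _ _ (k (z - h)%R + k (- (z - h))%R)%E).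
      by have [->|->] := kx x1; [rewrite leeDl|rewrite leeDr].
    by rewrite leeDr// mule_ge0.
  have [zh|zh|zh] := ltgtP (z - h) 0.
  - by rewrite ltr0_norm//; apply: boundk => [|_]; [lra|right].
  - by rewrite gtr0_norm//; apply: boundk => // _; left.
  - by apply: bound; rewrite zh normr0; exact: powR0_le1.
rewrite ge0_integralD//; last 4 first.
- by move=> z _; rewrite mule_ge0// lee_fin expR_ge0.
- exact: measurable_funeM.
- by move=> z _; rewrite adde_ge0.
- exact: (emeasurable_funD (mk1 h) (mk2 h)).
rewrite ge0_integralZl//; last by move=> z _; rewrite lee_fin expR_ge0.
have -> : (\int[leb]_z (k (z - h)%R + k (- (z - h))%R) =
    \int[leb]_z k (z - h)%R + \int[leb]_z k (- (z - h))%R)%E.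
  exact: (ge0_integralD leb measurableT (fun z _ => k0 _) (mk1 h)
    (fun z _ => k0 _) (mk2 h)).
rewrite ks1 ks2 iG -EFinM.
by rewrite EFinD leeD2l// EFinD leeD.
Qed.

(** The decay max(1,|h|)^a of the unaveraged power survives the averaging,
    although the weight |z|^b is allowed to be singular at 0 and the two
    singularities may collide. *)
Lemma gauss_shifted_power_le a b : -1 < a -> -1 < b -> -1 < a + b ->
  exists2 C : R, 0 < C & forall h,
  (\int[leb]_z (expR (- z ^+ 2) * (`|z - h| `^ a * `|z| `^ b))%:E <=
   (C * m h `^ a)%:E)%E.
Proof.
move=> a1 b1 ab1; set c := Num.min a 0 + Num.min b 0.
have c1 : -1 < c by rewrite /c /Num.min; case: ifP; case: ifP => *; lra.
have c0 : c <= 0 by rewrite /c /Num.min; case: ifP; case: ifP => *; lra.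
have [C C0 pw] := pointwise a b.
have [D D0 iD] := integral_gauss_half_shift c1 c0.
have [E E0 iE] := @integral_gauss_half_shift 0 (ltrN10 _) (lexx _).
exists (C * (E + D + D + 1)); first by rewrite mulr_gt0// ltr_wpDl// !addr_ge0.
move=> h.
have mh (x c' : R) : measurable_fun setT (fun z => (gauss_half z * `|z - x| `^ c')%:E).
  apply/measurable_EFinP; apply: measurable_funM => //.
  exact: measurable_normr_powR.
have ph (x c' z : R) : (0 <= (gauss_half z * `|z - x| `^ c')%:E)%E.
  by rewrite lee_fin mulr_ge0 ?expR_ge0 ?powR_ge0.
have mhc := powR_ge0 (m h) a.
have m2 := emeasurable_funD (mh 0 c) (mh h c).
have m3 := emeasurable_funD (mh 0 0) m2.
apply: (@le_trans _ _ (\int[leb]_z ((C * m h `^ a)%:E * ((gauss_half z * `|z - 0| `^ 0)%:E +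
   ((gauss_half z * `|z - 0| `^ c)%:E + (gauss_half z * `|z - h| `^ c)%:E))))%E).
  apply: ge0_le_integral => //.
  - apply/measurable_EFinP; apply: measurable_funM.
      exact: measurable_gauss_fun.
    apply: measurable_funM; first exact: measurable_normr_powR.
    by have := @measurable_normr_powR R b 0; under eq_fun do rewrite subr0.
  - exact: measurable_funeM.
  - move=> z _; rewrite -!EFinD -EFinM lee_fin powRr0 subr0 mulr1.
    apply: le_trans (pw z h) _; rewrite -/c ler_wpM2l ?mulr_ge0 ?(ltW C0)//.
    lra.
rewrite ge0_integralZl//; last 2 first.
- by move=> z _; rewrite !adde_ge0.
- by rewrite lee_fin mulr_ge0// ltW.
rewrite (ge0_integralD leb measurableT (fun z _ => ph 0 0 z) (mh 0 0)
  (fun z _ => adde_ge0 (ph 0 c z) (ph h c z)) m2).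
rewrite (ge0_integralD leb measurableT (fun z _ => ph 0 c z) (mh 0 c)
  (fun z _ => ph h c z) (mh h c)).
apply: (@le_trans _ _ ((C * m h `^ a)%:E * (E%:E + (D%:E + D%:E)))%E).
  by apply: lee_wpmul2l; rewrite ?lee_fin ?mulr_ge0// ?(ltW C0)//; rewrite !leeD.
rewrite -!EFinD -EFinM lee_fin [leRHS]mulrAC -!mulrA ler_wpM2l ?(ltW C0)//.
by rewrite ler_wpM2l//; lra.
Qed.

End smoothing_estimate.

(** * One frequency step in one coordinate *)

Section smoothing_step.
Context {R : realType}.
Local Notation leb := (@lebesgue_measure R).
Implicit Types a b r s h : R.

(** Rescaling by r reduces to a Gaussian of unit width; the hypothesis a <= b
    trades the decay exponent a for the weaker exponent b. The pointwise bound
    on g is not asked at 0, where the convention on powers of 0 would break it.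
    *)
Lemma gauss_weighted_power_le a b : -1 < a -> -1 < b -> -1 < a + b -> a <= b ->
  exists2 C : R, 0 < C & forall r h A (g : R -> R), 0 < r -> 0 <= A ->
    measurable_fun setT g -> (forall y, 0 <= g y) ->
    (forall z, z != 0 -> g (r * z) <= A * (1 + `|z| `^ b)) ->
  (\int[leb]_y (expR (- (y / r) ^+ 2) * (`|y - h| `^ a * g y))%:E <=
   (C * (r `^ (1 + a - b) * A * Num.max r `|h| `^ b))%:E)%E.
Proof.
move=> a1 b1 ab1 ab.
have [C0 C0p h0] := @gauss_shifted_power_le R a 0 a1 (ltrN10 _) ltac:(by rewrite addr0).
have [C1 C1p h1] := @gauss_shifted_power_le R a b a1 b1 ab1.
exists (C0 + C1); first exact: addr_gt0.
move=> r h A g r0 A0 mg g0 gA.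
pose f y := expR (- (y / r) ^+ 2) * (`|y - h| `^ a * g y).
have f0 y : 0 <= f y by rewrite /f !mulr_ge0 ?expR_ge0 ?powR_ge0.
have mexp : measurable_fun setT (fun z : R => expR (- z ^+ 2)).
  exact: measurable_gauss_fun.
have mf : measurable_fun setT f.
  apply: measurable_funM.
    by apply: (measurableT_comp mexp); exact: measurable_funM.
  by apply: measurable_funM => //; exact: measurable_normr_powR.
have rn0 : r != 0 by rewrite gt_eqF.
have sc : (\int[leb]_y (f y)%:E = r%:E * \int[leb]_z (f (r * z))%:E)%E.
  transitivity (r%:E * \int[leb]_z (EFin \o f) (r * z + 0)%R)%E; last first.
    by congr (_ * _)%E; apply: eq_integral => z _; rewrite /= addr0.
  have mEf : measurable_fun setT (EFin \o f) by exact/measurable_EFinP.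
  rewrite (ge0_integral_affine 0 rn0 mEf); last by move=> x; rewrite lee_fin.
  by rewrite gtr0_norm// muleA -EFinM divff// mul1e.
rewrite -/f sc.
pose e c z : R := expR (- z ^+ 2) * (`|z - h / r| `^ a * `|z| `^ c).
have e0 c z : (0 <= (e c z)%:E)%E by rewrite lee_fin !mulr_ge0 ?expR_ge0 ?powR_ge0.
have me c : measurable_fun setT (fun z => (e c z)%:E).
  apply/measurable_EFinP; apply: measurable_funM => //.
  apply: measurable_funM; first exact: measurable_normr_powR.
  by have := @measurable_normr_powR R c 0; under eq_fun do rewrite subr0.
have rA : 0 <= r `^ a * A by rewrite mulr_ge0 ?powR_ge0.
have msum : measurable_fun setT (fun z => (e 0 z)%:E + (e b z)%:E)%E.
  exact: emeasurable_funD.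
have bnd : (\int[leb]_z (f (r * z))%:E <=
    (r `^ a * A)%:E * ((C0 + C1) * Num.max 1 `|h / r| `^ b)%:E)%E.
  apply: (@le_trans _ _ (\int[leb]_z ((r `^ a * A)%:E * ((e 0 z)%:E + (e b z)%:E)))%E).
    apply: ae_ge0_le_integral => //.
    - by move=> z _; rewrite lee_fin.
    - apply/measurable_EFinP; apply: (measurableT_comp mf); exact: measurable_funM.
    - by move=> z _; rewrite mule_ge0// adde_ge0.
    - exact: measurable_funeM.
    (* The exceptional point z = 0 is a null set. *)
    exists [set 0]; split=> //; first exact: lebesgue_measure_set1.
    move=> z /= nz; apply: contrapT => /eqP z0; apply: nz => _.
    rewrite -EFinD -EFinM lee_fin /f /e powRr0 mulr1.
    have -> : r * z / r = z by rewrite mulrC mulKf.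
    have -> : `|r * z - h| `^ a = r `^ a * `|z - h / r| `^ a.
      rewrite -powRM ?normr_ge0 ?(ltW r0)//; congr (_ `^ _).
      by rewrite -{2}(gtr0_norm r0) -normrM mulrBr; congr `| _ - _|; rewrite mulrC divfK.
    have := gA z z0; set X := expR (- z ^+ 2); set Y := `|z - h / r| `^ a; set Z := `|z| `^ b => gz.
    have -> : r `^ a * A * (X * Y + X * (Y * Z)) = X * (r `^ a * Y * (A * (1 + Z))) by ring.
    by rewrite ler_wpM2l ?expR_ge0// ler_wpM2l// mulr_ge0 ?powR_ge0.
  rewrite ge0_integralZl//; last by move=> z _; rewrite adde_ge0.
  rewrite lee_wpmul2l ?lee_fin//.
  rewrite (ge0_integralD leb measurableT (fun z _ => e0 0 z) (me 0)
    (fun z _ => e0 b z) (me b)).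
  have mb : Num.max 1 `|h / r| `^ a <= Num.max 1 `|h / r| `^ b.
    by apply: ler_powR => //; rewrite le_max lexx.
  rewrite mulrDl EFinD leeD//.
    by apply: (le_trans (h0 (h / r))); rewrite lee_fin ler_wpM2l// ltW.
  by apply: (le_trans (h1 (h / r))); rewrite lee_fin ler_wpM2l// ltW.
apply: (@le_trans _ _ (r%:E * ((r `^ a * A)%:E * ((C0 + C1) * Num.max 1 `|h / r| `^ b)%:E))%E).
  by rewrite lee_wpmul2l// lee_fin ltW.
rewrite -!EFinM lee_fin.
have -> : Num.max r `|h| `^ b = r `^ b * Num.max 1 `|h / r| `^ b.
  have m0 : 0 <= Num.max 1 `|h / r| by rewrite le_max ler01.
  rewrite -powRM ?(ltW r0)//.
  have hr : r * `|h / r| = `|h|.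
    by rewrite normrM normfV (gtr0_norm r0) mulrC divfK.
  by congr (_ `^ _); rewrite maxr_pMr ?(ltW r0)// mulr1 hr.
have -> : r `^ (1 + a - b) = r * r `^ a / r `^ b.
  by rewrite -powRN -{2}(powRr1 (ltW r0)) -!powRD ?rn0 ?implybT.
have rb : r `^ b != 0 by rewrite gt_eqF// powR_gt0.
rewrite le_eqVlt; apply/orP; left; apply/eqP.
by field.
Qed.

(** The inductive step of the upper bound, in one coordinate. A Gaussian of
    width r, that is, a time gap r^-2, is integrated against the kernel |y -
    h|^a and against the profile max(s,|y|)^-b left by the next time gap s^-2;
    the outcome is a profile of the same shape in h. The limit b < 1 + a allows
    for rough and smooth noises alike: for a <= -1/2 it keeps two colliding
    singularities integrable. *)
Lemma smoothing_step a b : -1 < a -> b <= - a -> b < 1 + a -> b < 1 ->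
  exists2 C : R, 0 < C & forall r s h, 0 < r -> 0 < s ->
  (\int[leb]_y (expR (- (y / r) ^+ 2) * (`|y - h| `^ a * Num.max s `|y| `^ (- b)))%:E <=
   (C * (r `^ (1 + a + b) * Num.max r s `^ (- b) * Num.max r `|h| `^ (- b)))%:E)%E.
Proof.
move=> a1 ba ba1 b1.
have [||||C C0 hC] := @gauss_weighted_power_le a (- b); [lra..|].
exists C => // r s h r0 s0.
have -> : 1 + a + b = 1 + a - - b by rewrite opprK.
apply: hC => //.
- exact: powR_ge0.
- apply: (measurableT_comp (measurable_powR (- b))).
  by apply: measurable_maxr => //; exact: measurableT_comp.
- by move=> y; exact: powR_ge0.
move=> z z0; rewrite normrM (gtr0_norm r0).
have zp : 0 < `|z| by rewrite normr_gt0.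
have [b0|b0] := leP b 0.
  apply: (@le_trans _ _ ((Num.max r s * Num.max 1 `|z|) `^ (- b))).
    apply: ge0_ler_powR; rewrite ?nnegrE ?oppr_ge0//.
    - by rewrite le_max (ltW s0).
    - by rewrite mulr_ge0// le_max ?ler01// (ltW r0).
    rewrite ge_max; apply/andP; split.
      by rewrite -[leLHS]mulr1 ler_pM ?(ltW s0)// le_max lexx ?orbT.
    by rewrite ler_pM ?(ltW r0)// le_max lexx ?orbT.
  rewrite powRM ?le_max ?(ltW r0) ?ler01// ler_wpM2l ?powR_ge0//.
  rewrite /Num.max; case: ifP => _; first by rewrite lerDr.
  by rewrite powR1 lerDl powR_ge0.
have [sr|rs] := leP r s.
  apply: (@le_trans _ _ (s `^ (- b))).
    by apply: gt0_ler_powRN; rewrite ?oppr_le0 ?(ltW b0)// le_max lexx.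
  by rewrite ler_peMr ?powR_ge0// lerDl powR_ge0.
apply: (@le_trans _ _ ((r * `|z|) `^ (- b))).
  apply: gt0_ler_powRN; rewrite ?oppr_le0 ?(ltW b0) ?mulr_gt0//.
  by rewrite le_max lexx orbT.
by rewrite powRM ?(ltW r0)// ler_wpM2l ?powR_ge0// lerDr.
Qed.

(** The last step of a path, where no later profile is present. *)
Lemma smoothing_base a b : -1 < a -> b <= - a -> b < 1 + a -> b < 1 ->
  exists2 C : R, 0 < C & forall r h, 0 < r ->
  (\int[leb]_y (expR (- (y / r) ^+ 2) * `|y - h| `^ a)%:E <=
   (C * (r `^ (1 + a + b) * Num.max r `|h| `^ (- b)))%:E)%E.
Proof.
move=> a1 ba ba1 b1.
have [||||C C0 hC] := @gauss_weighted_power_le a (- b); [lra..|].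
exists C => // r h r0.
have -> : 1 + a + b = 1 + a - - b by rewrite opprK.
have := hC r h 1 (cst 1) r0 ler01; rewrite mulr1.
under eq_integral do rewrite mulr1.
apply => // z _.
by rewrite mul1r lerDl powR_ge0.
Qed.

End smoothing_step.

(** * Phases averaged by the heat kernel *)

Section gaussian_phase.
Context {R : realType}.
Local Notation leb := (@lebesgue_measure R).
Implicit Types w h theta b rho : R.

(** Oscillating integrands are handled through the nonnegative functions 1 +
    rho cos: they are closed under averaging by heat kernels, which only
    shrinks rho, and Tonelli's theorem applies to them without integrability
    conditions. *)
Lemma phase_ge0 rho x : `|rho| <= 1 -> 0 <= 1 + rho * cos x.
Proof.
move=> r1; have : `|rho * cos x| <= 1.
  by rewrite normrM mulr_ile1// ler_norml cos_geN1 cos_le1.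
by rewrite ler_norml => /andP[h _]; lra.
Qed.

(** The heat kernel in dimension 1. *)
Definition heat_kernel1 w z : R := (2 * pi * w) `^ (- 2^-1) * expR (- (z ^+ 2) / (2 * w)).

Lemma heat_kernel1_ge0 w z : 0 <= heat_kernel1 w z.
Proof. by rewrite mulr_ge0 ?powR_ge0 ?expR_ge0. Qed.

Lemma measurable_heat_kernel1 w : measurable_fun setT (heat_kernel1 w).
Proof.
apply: measurable_funM => //; apply: measurableT_comp => //.
apply: measurable_funM => //; apply: measurable_funN.
exact: measurable_funX.
Qed.

Lemma measurable_cosT : measurable_fun setT (@cos R).
Proof. by apply: continuous_measurable_fun; exact: continuous_cos. Qed.

Let measurable_phase rho theta b : measurable_fun setT (fun y : R => 1 + rho * cos (theta + b * y)).
Proof.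
apply: measurable_funD => //; apply: measurable_funM => //.
by apply: (measurableT_comp measurable_cosT); apply: measurable_funD.
Qed.

Let integral_phase_gauss rho b : `|rho| <= 1 ->
  (\int[leb]_z ((1 + rho * cos (b * z)) * gauss_fun z)%:E =
   (Num.sqrt pi * (1 + rho * expR (- (b ^+ 2 / 4))))%:E)%E.
Proof.
move=> r1.
have i1 := @integrableT_gauss R.
have i2 : leb.-integrable setT (fun z => (rho * (cos (b * z) * gauss_fun z))%:E).
  exact: (integrableZl measurableT rho (integrable_cos_gauss b)).
transitivity (\int[leb]_z ((gauss_fun z)%:E + (rho * (cos (b * z) * gauss_fun z))%:E))%E.
  by apply: eq_integral => z _; rewrite -EFinD; congr EFin; ring.
rewrite (integralD measurableT i1 i2)/= integralT_gauss.
rewrite (_ : (\int[leb]_x _)%E = (rho * (Num.sqrt pi * expR (- (b ^+ 2 / 4))))%:E).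
  by rewrite -EFinD; congr EFin; ring.
rewrite -Rintegral_cos_gauss -RintegralZl//; last exact: integrable_cos_gauss.
rewrite /Rintegral fineK//; exact: (integrable_fin_num measurableT i2).
Qed.

(** Averaging the phases theta + b z and theta - b z removes the odd part and
    leaves the cosine transform. *)
Let integral_phase_gauss_shift rho theta b : `|rho| <= 1 ->
  (\int[leb]_z ((1 + rho * cos (theta + b * z)) * gauss_fun z)%:E =
   (Num.sqrt pi * (1 + rho * expR (- (b ^+ 2 / 4)) * cos theta))%:E)%E.
Proof.
move=> r1.
pose f c z : R := (1 + rho * cos (theta + c * z)) * gauss_fun z.
have f0 c z : (0 <= (f c z)%:E)%E.
  by rewrite lee_fin mulr_ge0 ?gauss_fun_ge0// phase_ge0.
have mf c : measurable_fun setT (fun z => (f c z)%:E).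
  apply/measurable_EFinP; apply: measurable_funM; last exact: measurable_gauss_fun.
  exact: measurable_phase.
have fN : (\int[leb]_z (f (- b) z)%:E = \int[leb]_z (f b z)%:E)%E.
  have n1 : (-1 : R) != 0 by rewrite oppr_eq0 oner_neq0.
  have := @ge0_integral_affine R (-1) 0 (fun z => (f b z)%:E) n1 (mf b) (f0 b).
  rewrite normrN normr1 invr1 mul1e => <-; apply: eq_integral => z _.
  by rewrite /f addr0 mulN1r mulrN mulNr /gauss_fun sqrrN.
have r2 : `|rho * cos theta| <= 1.
  by rewrite normrM mulr_ile1// ler_norml cos_geN1 cos_le1.
have : (\int[leb]_z (f b z)%:E + \int[leb]_z (f (- b) z)%:E =
   (2 * (Num.sqrt pi * (1 + rho * expR (- (b ^+ 2 / 4)) * cos theta)))%:E)%E.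
  rewrite -(ge0_integralD leb measurableT (fun z _ => f0 b z) (mf b)
    (fun z _ => f0 (- b) z) (mf (- b))).
  transitivity (\int[leb]_z (2%:E * ((1 + (rho * cos theta) * cos (b * z)) * gauss_fun z)%:E))%E.
    apply: eq_integral => z _; rewrite -EFinD -EFinM; congr EFin.
    rewrite /f mulNr !cosD cosN sinN; ring.
  rewrite ge0_integralZl//; last 2 first.
  - apply/measurable_EFinP; apply: measurable_funM; last exact: measurable_gauss_fun.
    by have := measurable_phase (rho * cos theta) 0 b; under eq_fun do rewrite add0r.
  - by move=> z _; rewrite lee_fin mulr_ge0 ?gauss_fun_ge0// phase_ge0.
  rewrite integral_phase_gauss// -EFinM; congr EFin; ring.
rewrite fN -/(f b).
case: (\int[leb]_z (f b z)%:E)%E => //= r [] E.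
by congr EFin; lra.
Qed.

(** The substitution y = h - (2w)^(1/2) z turns the heat kernel into the
    Gaussian exp(-z^2) up to normalization. *)
Lemma integral_phase_heat_kernel1 w rho theta b h : 0 < w -> `|rho| <= 1 ->
  (\int[leb]_y ((1 + rho * cos (theta + b * y)) * heat_kernel1 w (h - y))%:E =
   (1 + rho * expR (- (2^-1 * w * b ^+ 2)) * cos (theta + b * h))%:E)%E.
Proof.
move=> w0 r1; pose c := Num.sqrt (2 * w).
have c0 : 0 < c by rewrite sqrtr_gt0 mulr_gt0.
have c2 : c ^+ 2 = 2 * w by rewrite sqr_sqrtr// mulr_ge0// ltW.
have nc0 : - c != 0 by rewrite oppr_eq0 gt_eqF.
pose f y := (1 + rho * cos (theta + b * y)) * heat_kernel1 w (h - y).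
have f0 y : (0 <= (f y)%:E)%E by rewrite lee_fin mulr_ge0 ?heat_kernel1_ge0// phase_ge0.
have mf : measurable_fun setT (fun y => (f y)%:E).
  apply/measurable_EFinP; apply: measurable_funM; first exact: measurable_phase.
  by apply: (measurableT_comp (measurable_heat_kernel1 w)); exact: measurable_funB.
have A := @ge0_integral_affine R (- c) h (fun y => (f y)%:E) nc0 mf f0.
have pw : (2 * pi * w) `^ (- 2^-1) = c^-1 * (Num.sqrt pi)^-1 :> R.
  rewrite powRN powR12_sqrt; last by rewrite !mulr_ge0 ?pi_ge0 ?ltW.
  by rewrite mulrAC sqrtrM ?mulr_ge0 ?(ltW w0)// invfM.
have spi : Num.sqrt pi != 0 :> R by rewrite gt_eqF// sqrtr_gt0 pi_gt0.
have B : (\int[leb]_x (f (- c * x + h))%:E =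
    (c^-1 * (1 + rho * expR (- (2^-1 * w * b ^+ 2)) * cos (theta + b * h)))%:E)%E.
  transitivity (\int[leb]_z ((c^-1 * (Num.sqrt pi)^-1)%:E *
      ((1 + rho * cos ((theta + b * h) + (- (b * c)) * z)) * gauss_fun z)%:E))%E.
    apply: eq_integral => z _; rewrite -EFinM; congr EFin.
    rewrite /f /heat_kernel1 pw /gauss_fun.
    have -> : - (h - (- c * z + h)) ^+ 2 / (2 * w) = - z ^+ 2.
      have -> : h - (- c * z + h) = c * z by ring.
      rewrite exprMn c2; field.
      by rewrite gt_eqF.
    have -> : theta + b * (- c * z + h) = theta + b * h + - (b * c) * z by ring.
    by ring.
  rewrite ge0_integralZl//; last 3 first.
  - apply/measurable_EFinP; apply: measurable_funM; last exact: measurable_gauss_fun.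
    exact: measurable_phase.
  - by move=> z _; rewrite lee_fin mulr_ge0 ?gauss_fun_ge0// phase_ge0.
  - by rewrite lee_fin mulr_ge0 ?invr_ge0 ?sqrtr_ge0 ?(ltW c0).
  rewrite integral_phase_gauss_shift// -EFinM; congr EFin.
  have -> : (- (b * c)) ^+ 2 / 4 = 2^-1 * w * b ^+ 2 by rewrite sqrrN exprMn c2; field.
  by field; rewrite gt_eqF.
move: A; rewrite B normrN (gtr0_norm c0).
case: (\int[leb]_y (f y)%:E)%E => //=; last 2 first.
- by rewrite gt0_muley// lte_fin invr_gt0.
- by rewrite gt0_muleNy// lte_fin invr_gt0.
move=> r; rewrite -EFinM => -[] /mulfI E; congr EFin; symmetry; apply: E.
by rewrite invr_eq0 gt_eqF.
Qed.

Lemma heat_kernel_prod d w (z : 'I_d -> R) :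
  heat_kernel w z = \prod_(k < d) heat_kernel1 w (z k).
Proof.
rewrite /heat_kernel /heat_kernel1 big_split/= -expR_sum; congr (_ * expR _).
  rewrite prodr_const card_ord.
  rewrite (_ : - (d%:R / 2) = (- 2^-1) * d%:R); last by rewrite mulNr mulrC.
  by rewrite powRrM powR_mulrn// powR_ge0.
by rewrite -sumrN mulr_suml.
Qed.

Lemma integral_phase_prod_heat_kernel1 d w rho theta (xi h : 'I_d -> R) :
  0 < w -> `|rho| <= 1 ->
  (\int[lebesgue_tuple d]_y ((1 + rho * cos (theta + \sum_(k < d) xi k * tnth y k)) *
       \prod_(k < d) heat_kernel1 w (h k - tnth y k))%:E =
   (1 + rho * expR (- (2^-1 * w * \sum_(k < d) xi k ^+ 2)) *
    cos (theta + \sum_(k < d) xi k * h k))%:E)%E.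
Proof.
move=> w0; elim: d => [|d IH] in rho theta xi h *; move=> r1.
  by rewrite integral_tuple0 !big_ord0 !(mulr0, oppr0, expR0, mulr1, addr0).
have mtn n (k : 'I_n) : measurable_fun setT (fun y : n.-tuple (measurableTypeR R) => (tnth y k : R)).
  exact: measurable_tnth.
have mint n r th (a c : 'I_n -> R) :
    measurable_fun setT (fun y : n.-tuple (measurableTypeR R) =>
      ((1 + r * cos (th + \sum_(k < n) a k * tnth y k)) *
       \prod_(k < n) heat_kernel1 w (c k - tnth y k))%:E).
  apply/measurable_EFinP; apply: measurable_funM.
    apply: measurable_funD => //; apply: measurable_funM => //.
    apply: (measurableT_comp measurable_cosT); apply: measurable_funD => //.
    by apply: measurable_sum => k; exact: (measurable_funM (measurable_cst _) (mtn _ k)).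
  apply: measurable_prod => k _; apply: (measurableT_comp (measurable_heat_kernel1 w)).
  exact: (measurable_funB (measurable_cst _) (mtn _ k)).
rewrite ge0_integral_tupleS; last 2 first.
- exact: mint.
- by move=> v; rewrite lee_fin mulr_ge0 ?phase_ge0// prodr_ge0// => k _; exact: heat_kernel1_ge0.
pose xi' k := xi (lift ord0 k); pose h' k := h (lift ord0 k).
transitivity (\int[leb]_x ((1 + (rho * expR (- (2^-1 * w * \sum_(k < d) xi' k ^+ 2))) *
    cos ((theta + \sum_(k < d) xi' k * h' k) + xi ord0 * x)) * heat_kernel1 w (h ord0 - x))%:E)%E.
  apply: eq_integral => x _.
  transitivity (\int[lebesgue_tuple d]_v ((heat_kernel1 w (h ord0 - x))%:E *
    ((1 + rho * cos ((theta + xi ord0 * x) + \sum_(k < d) xi' k * tnth v k)) *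
       \prod_(k < d) heat_kernel1 w (h' k - tnth v k))%:E))%E.
    apply: eq_integral => v _; rewrite -EFinM; congr EFin.
    rewrite !big_ord_recl/= tnth0 addrA.
    under eq_bigr do rewrite tnthS.
    under [X in _ * (_ * X)]eq_bigr do rewrite tnthS.
    by rewrite mulrCA.
  rewrite ge0_integralZl//; last 3 first.
  - exact: mint.
  - move=> v _; rewrite lee_fin mulr_ge0 ?phase_ge0// prodr_ge0// => k _.
    exact: heat_kernel1_ge0.
  - by rewrite lee_fin heat_kernel1_ge0.
  rewrite IH// -EFinM; congr EFin; rewrite mulrC; congr (_ * _).
  by congr (1 + _ * cos _); ring.
have e1 (u : R) : 0 <= u -> expR (- u) <= 1 by move=> u0; rewrite -expR0 ler_expR oppr_le0.
rewrite integral_phase_heat_kernel1//; last first.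
  rewrite normrM mulr_ile1// ger0_norm ?expR_ge0// e1//.
  by rewrite !mulr_ge0 ?(ltW w0)// sumr_ge0// => k _; exact: sqr_ge0.
congr EFin; rewrite !big_ord_recl/= -(mulrA rho) -expRD; congr (1 + rho * expR _ * cos _).
  by rewrite -/(xi' _); ring.
by ring.
Qed.

End gaussian_phase.

(** * The Fourier transform of a path of heat kernels *)

Lemma measurable_nth {dT} {T : measurableType dT} n (x : T) i :
  measurable_fun [set: n.-tuple T] (fun y : n.-tuple T => nth x y i).
Proof.
have [ni|ni] := ltnP i n; last first.
  rewrite (_ : (fun y => _) = cst x); first exact: measurable_cst.
  by apply/funext => y; rewrite nth_default// size_tuple.
rewrite (_ : (fun y => _) = fun y : n.-tuple T => tnth y (Ordinal ni)).
  exact: measurable_tnth.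
by apply/funext => y; rewrite (tnth_nth x).
Qed.

Lemma tuple_consP {dT} {T : measurableType dT} n (v : n.+1.-tuple T) :
  exists a u, v = tuple_cons (a, u).
Proof. by exists (thead v), [tuple of behead v]; exact: tuple_eta. Qed.

Section path_fourier.
Context {R : realType} (d : nat).
Local Notation RR := (measurableTypeR R).
Local Notation V := (d.-tuple (measurableTypeR R)).
Implicit Types (n : nat) (t c : R) (x : V) (e : 'I_d -> R).

(** One summand of the chaos kernel, for points already listed in the order of
    their times; position n is the endpoint (t, x), supplied by the default
    value of nth. *)
Definition path_kernel n t x (s : n.-tuple RR) (y : n.-tuple V) : R :=
  \prod_(i < n) heat_kernel (nth t s i.+1 - nth t s i)
    (fun k => tnth (nth x y i.+1) k - tnth (nth x y i) k).

(** The squared modulus, for c = 1, of the Fourier transform of path_kernel: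
    the i-th time gap damps the partial sum of the frequencies up to i. The
    vector e is a frequency accumulated before the path starts; it makes the
    formula recursive in the path. *)
Definition damping c n t e (s : n.-tuple RR) (xi : n.-tuple V) : R :=
  \prod_(i < n) expR (- (c * (nth t s i.+1 - nth t s i) *
    \sum_(k < d) (e k + \sum_(j < n | (j <= i)%N) tnth (tnth xi j) k) ^+ 2)).

Definition increasing_to n t (s : n.-tuple RR) :=
  [forall i : 'I_n, nth t s i < nth t s i.+1].

Lemma path_kernel_cons n t x s0 y0 (s : n.-tuple RR) (y : n.-tuple V) :
  path_kernel t x (tuple_cons (s0, s)) (tuple_cons (y0, y)) =
  heat_kernel (nth t s 0 - s0) (fun k => tnth (nth x y 0) k - tnth y0 k) *
  path_kernel t x s y.
Proof. by rewrite /path_kernel big_ord_recl. Qed.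

Lemma dot_cons n x0 y0 (xi y : n.-tuple V) :
  dot (tuple_cons (x0, xi)) (tuple_cons (y0, y)) =
  \sum_(k < d) tnth x0 k * tnth y0 k + dot xi y.
Proof.
rewrite /dot big_ord_recl; congr (_ + _).
by apply: eq_bigr => i _; apply: eq_bigr => k _; rewrite !tnthS.
Qed.

Lemma damping_cons c n t e s0 x0 (s : n.-tuple RR) (xi : n.-tuple V) :
  damping c t e (tuple_cons (s0, s)) (tuple_cons (x0, xi)) =
  expR (- (c * (nth t s 0 - s0) * \sum_(k < d) (e k + tnth x0 k) ^+ 2)) *
  damping c t (fun k => e k + tnth x0 k) s xi.
Proof.
rewrite /damping big_ord_recl /=; congr (expR (- (_ * _)) * _).
  apply: eq_bigr => k _; rewrite (bigD1 ord0)//= tnth0 big1 ?addr0// => j.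
  by move=> /andP[]; rewrite leqn0 => /eqP j0 /eqP[]; exact: val_inj.
apply: eq_bigr => i _; congr (expR (- (_ * _))).
apply: eq_bigr => k _; congr (_ ^+ 2); rewrite big_mkcond big_ord_recl/= tnth0 -addrA.
congr (_ + (_ + _)); rewrite -big_mkcond/=; apply: eq_big => j.
  by rewrite /bump !leq0n !add1n ltnS.
by move=> _; rewrite tnthS; congr (tnth (tnth _ _) _); exact: val_inj.
Qed.

Lemma increasing_to_cons n t s0 (s : n.-tuple RR) :
  increasing_to t (tuple_cons (s0, s)) = (s0 < nth t s 0) && increasing_to t s.
Proof.
apply/forallP/andP => [h|[h0 /forallP h] i].
  by split; [exact: (h ord0)|apply/forallP => i; exact: (h (lift ord0 i))].
by have [j ->|->] := unliftP ord0 i; [exact: (h j)|exact: h0].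
Qed.

Lemma path_rcons_increasing n t (s : n.-tuple RR) :
  path <%R 0 (rcons s t) = (0 < nth t s 0) && increasing_to t s.
Proof.
suff gen (a : R) : path <%R a (rcons s t) = (a < nth t s 0) && increasing_to t s by [].
elim: n s a => [|n IH] s a.
  rewrite tuple0/= andbT; apply/idP/andP => [->|[]//]; split=> //.
  by apply/forallP => -[].
by have [s0 [s' ->]] := tuple_consP s; rewrite increasing_to_cons -IH.
Qed.

Lemma increasing_to_nth0_le n t (s : n.-tuple RR) : increasing_to t s -> nth t s 0 <= t.
Proof.
elim: n s => [|n IH] s; first by rewrite tuple0.
have [s0 [s' ->]] := tuple_consP s; rewrite increasing_to_cons => /andP[h1 h2].
by apply/ltW/(lt_le_trans h1); exact: IH.
Qed.

Local Notation lebX n := (tuple_measure (lebesgue_tuple d) n).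

Lemma heat_kernel_ge0 t (z : 'I_d -> R) : 0 <= heat_kernel t z.
Proof. by rewrite mulr_ge0 ?powR_ge0 ?expR_ge0. Qed.

Lemma path_kernel_ge0 n t x (s : n.-tuple RR) (y : n.-tuple V) :
  0 <= path_kernel t x s y.
Proof. by apply: prodr_ge0 => i _; exact: heat_kernel_ge0. Qed.

Lemma damping_ge0 c n t e (s : n.-tuple RR) (xi : n.-tuple V) :
  0 <= damping c t e s xi.
Proof. by apply: prodr_ge0 => i _; exact: expR_ge0. Qed.

Lemma measurable_nth_tnth n (x : V) i k :
  measurable_fun [set: n.-tuple V] (fun y : n.-tuple V => (tnth (nth x y i) k : R)).
Proof.
apply: (@measurableT_comp _ _ _ _ V _ (fun v : V => tnth v k)).
  exact: measurable_tnth.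
exact: measurable_nth.
Qed.

Lemma measurable_tnth_tnth n i k :
  measurable_fun [set: n.-tuple V] (fun y : n.-tuple V => (tnth (tnth y i) k : R)).
Proof.
apply: (@measurableT_comp _ _ _ _ V _ (fun v : V => tnth v k)); exact: measurable_tnth.
Qed.

Lemma measurable_path_kernel n t x (s : n.-tuple RR) :
  measurable_fun [set: n.-tuple V] (path_kernel t x s).
Proof.
apply: measurable_prod => i _; under eq_fun do rewrite heat_kernel_prod.
apply: measurable_prod => k _.
apply: (measurableT_comp (measurable_heat_kernel1 _)).
exact: (measurable_funB (measurable_nth_tnth _ _ _) (measurable_nth_tnth _ _ _)).
Qed.

Lemma measurable_dot n (xi : n.-tuple V) :
  measurable_fun [set: n.-tuple V] (fun y : n.-tuple V => dot xi y).
Proof.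
apply: measurable_sum => i; apply: measurable_sum => k.
exact: (measurable_funM (measurable_cst _) (measurable_tnth_tnth _ _)).
Qed.

(** The first point of a path occurs in a single heat kernel, so it is
    integrated out first: this damps the phase and hands its frequency over to
    the next point. The phase phi is left unspecified because only the modulus
    is needed. *)
Lemma integral_phase_path n t x e (s : n.-tuple RR) (xi : n.-tuple V) :
  increasing_to t s ->
  exists phi : R, forall rho theta : R, `|rho| <= 1 ->
  (\int[lebX n]_y ((1 + rho * cos (theta + \sum_(k < d) e k * tnth (nth x y 0) k
       + dot xi y)) * path_kernel t x s y)%:E =
   (1 + rho * damping 2^-1 t e s xi * cos (theta + phi))%:E)%E.
Proof.
elim: n => [|n IH] in e s xi *.
  move=> _; exists (\sum_(k < d) e k * tnth x k) => rho theta _.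
  rewrite integral_tuple0 /dot /path_kernel /damping !big_ord0 addr0 !mulr1.
  by rewrite nth_default ?size_tuple.
have [s0 [s' ->]] := tuple_consP s; have [x0 [xi' ->]] := tuple_consP xi.
move: s' xi' => {}s {}xi; rewrite increasing_to_cons => /andP[w0 inc].
pose e' k := e k + tnth x0 k.
have [phi hphi] := IH e' s xi inc; exists phi => rho theta r1.
set w := nth t s 0 - s0; have wp : 0 < w by rewrite subr_gt0.
set D := expR (- (2^-1 * w * \sum_(k < d) e' k ^+ 2)).
have D1 : `|D| <= 1.
  rewrite ger0_norm ?expR_ge0// -expR0 ler_expR oppr_le0.
  by rewrite !mulr_ge0 ?(ltW wp)// sumr_ge0// => k _; exact: sqr_ge0.
(* The first point is the inner variable of integration. *)
rewrite ge0_integral_tupleS_swap; last 2 first.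
- apply/measurable_EFinP; apply: measurable_funM; last exact: measurable_path_kernel.
  apply: measurable_funD => //; apply: measurable_funM => //.
  apply: (measurableT_comp (@measurable_cosT R)).
  apply: measurable_funD; last exact: measurable_dot.
  apply: measurable_funD => //; apply: measurable_sum => k.
  exact: (measurable_funM (measurable_cst _) (measurable_nth_tnth _ _ _)).
- by move=> y; rewrite lee_fin mulr_ge0 ?path_kernel_ge0// phase_ge0.
transitivity (\int[lebX n]_y ((1 + (rho * D) * cos (theta +
     \sum_(k < d) e' k * tnth (nth x y 0) k + dot xi y)) * path_kernel t x s y)%:E)%E.
  apply: eq_integral => y _.
  transitivity (\int[lebesgue_tuple d]_v ((path_kernel t x s y)%:E *
     ((1 + rho * cos ((theta + dot xi y) + \sum_(k < d) e' k * tnth v k)) *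
     \prod_(k < d) heat_kernel1 w (tnth (nth x y 0) k - tnth v k))%:E))%E.
    apply: eq_integral => v _; rewrite -EFinM path_kernel_cons heat_kernel_prod.
    congr EFin; rewrite -/w [RHS]mulrC -[RHS]mulrA; congr (_ * _).
    congr (1 + rho * cos _); rewrite dot_cons addrA -(addrA theta) -big_split/=.
    rewrite addrAC; congr (_ + _ + _).
    by apply: eq_bigr => k _; rewrite /e' mulrDl.
  rewrite ge0_integralZl//; last 3 first.
  - apply/measurable_EFinP; apply: measurable_funM.
      apply: measurable_funD => //; apply: measurable_funM => //.
      apply: (measurableT_comp (@measurable_cosT R)); apply: measurable_funD => //.
      apply: measurable_sum => k.
      exact: (measurable_funM (measurable_cst _) (measurable_tnth _)).
    apply: measurable_prod => k _; apply: (measurableT_comp (measurable_heat_kernel1 w)).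
    exact: (measurable_funB (measurable_cst _) (measurable_tnth _)).
  - move=> v _; rewrite lee_fin mulr_ge0 ?phase_ge0// prodr_ge0// => k _.
    exact: heat_kernel1_ge0.
  - by rewrite lee_fin path_kernel_ge0.
  rewrite (@integral_phase_prod_heat_kernel1 R d w rho _ e' (fun k => tnth (nth x y 0) k))//.
  by rewrite -EFinM mulrC addrAC.
rewrite hphi; last by rewrite normrM mulr_ile1.
by rewrite damping_cons -/w -/D mulrA.
Qed.

End path_fourier.

(** * The second moment of a chaos as an integral over increasing times *)

Section second_moment_formula.
Context {R : realType} (d : nat).
Local Notation RR := (measurableTypeR R).
Local Notation V := (d.-tuple (measurableTypeR R)).
Local Notation lebX n := (tuple_measure (lebesgue_tuple d) n).
Implicit Types (n : nat) (t c : R) (x : V) (e : 'I_d -> R).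

Let integral_path n t x (s : n.-tuple RR) (xi : n.-tuple V) : increasing_to t s ->
  exists phi : R, forall rho theta : R, `|rho| <= 1 ->
  (\int[lebX n]_y ((1 + rho * cos (theta + dot xi y)) * path_kernel t x s y)%:E =
   (1 + rho * damping 2^-1 t (fun=> 0) s xi * cos (theta + phi))%:E)%E.
Proof.
move=> /(integral_phase_path x (fun=> 0) xi)[phi h]; exists phi => rho theta r1.
rewrite -h//; apply: eq_integral => y _.
by rewrite big1 ?addr0// => k _; rewrite mul0r.
Qed.

Lemma measurable_cos_path n t x (s : n.-tuple RR) (xi : n.-tuple V) theta :
  measurable_fun setT (fun y : n.-tuple V => cos (theta + dot xi y) * path_kernel t x s y).
Proof.
apply: measurable_funM; last exact: measurable_path_kernel.
apply: (measurableT_comp (@measurable_cosT R)).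
by apply: measurable_funD => //; exact: measurable_dot.
Qed.

Lemma integrable_path n t x (s : n.-tuple RR) : increasing_to t s ->
  (lebX n).-integrable setT (EFin \o path_kernel t x s).
Proof.
move=> inc; apply/integrableP; split.
  by apply/measurable_EFinP; exact: measurable_path_kernel.
have [phi h] := integral_path x (nseq_tuple n (nseq_tuple d (0 : RR)) : n.-tuple V) inc.
have := h 0 0; rewrite normr0 ler01 => /(_ isT) E.
rewrite (_ : (\int[_]_x _)%E = 1%E) ?ltry//.
transitivity ((1 + 0 * damping 2^-1 t (fun=> 0) s
   (nseq_tuple n (nseq_tuple d (0 : RR)) : n.-tuple V) * cos (0 + phi))%:E)%E.
  rewrite -E; apply: eq_integral => y _; rewrite /= mul0r addr0 mul1r.
  by rewrite ger0_norm// path_kernel_ge0.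
by rewrite !mul0r addr0.
Qed.

Lemma integrable_cos_path n t x (s : n.-tuple RR) (xi : n.-tuple V) theta :
  increasing_to t s -> (lebX n).-integrable setT
    (fun y => (cos (theta + dot xi y) * path_kernel t x s y)%:E).
Proof.
move=> inc; apply: (le_integrable _ _ _ (integrable_path x inc)) => //.
  by apply/measurable_EFinP; exact: measurable_cos_path.
move=> y _; rewrite lee_fin normrM ler_piMl// ler_norml.
by rewrite cos_geN1 cos_le1.
Qed.

(** The difference of the integrals with rho = 1 and rho = 0. *)
Lemma Rintegral_cos_path n t x (s : n.-tuple RR) (xi : n.-tuple V) :
  increasing_to t s -> exists phi, forall theta,
  \int[lebX n]_y (cos (theta + dot xi y) * path_kernel t x s y) =
  damping 2^-1 t (fun=> 0) s xi * cos (theta + phi).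
Proof.
move=> inc; have [phi h] := integral_path x xi inc; exists phi => theta.
have i1 := integrable_path x inc; have i2 := integrable_cos_path x xi theta inc.
have e0 : (\int[lebX n]_y (path_kernel t x s y)%:E = 1)%E.
  have := h 0 0; rewrite normr0 ler01 => /(_ isT); rewrite !mul0r addr0 => <-.
  by apply: eq_integral => y _; rewrite mul0r addr0 mul1r.
have e1 := h 1 theta; rewrite normr1 lexx in e1; have {}e1 := e1 isT.
have e2 : (\int[lebX n]_y ((1 + 1 * cos (theta + dot xi y)) * path_kernel t x s y)%:E =
    \int[lebX n]_y (path_kernel t x s y)%:E +
    \int[lebX n]_y (cos (theta + dot xi y) * path_kernel t x s y)%:E)%E.
  rewrite -(integralD measurableT i1 i2); apply: eq_integral => y _.
  by rewrite -EFinD; congr EFin; rewrite mulrDl !mul1r.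
move: e2; rewrite e1 e0 /Rintegral.
case: (\int[lebX n]_y _)%E => //= r; rewrite -EFinD => -[] E.
by move: E; rewrite mul1r => /addrI <-.
Qed.

Lemma damping_half_sqr n t e (s : n.-tuple RR) (xi : n.-tuple V) :
  damping 2^-1 t e s xi ^+ 2 = damping 1 t e s xi.
Proof.
rewrite /damping -prodrXl; apply: eq_bigr => i _.
by rewrite expr2 -expRD; congr expR; lra.
Qed.

(** The sine is a cosine with the phase shifted by a quarter turn, so cosine
    and sine integrals have the same amplitude, and their squares add up to its
    square. *)
Lemma fourier_path n t x (s : n.-tuple RR) (xi : n.-tuple V) (c : R) :
  increasing_to t s ->
  ComplexField.Normc.normc (fourier (fun y => c * path_kernel t x s y) xi) ^+ 2 =
  c ^+ 2 * damping 1 t (fun=> 0) s xi.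
Proof.
move=> inc; have [phi h] := Rintegral_cos_path x xi inc.
have E theta : \int[lebX n]_y (cos (theta + dot xi y) * (c * path_kernel t x s y)) =
    c * (damping 2^-1 t (fun=> 0) s xi * cos (theta + phi)).
  rewrite -h -RintegralZl//; last exact: integrable_cos_path.
  by apply: eq_Rintegral => y _; rewrite mulrCA.
rewrite /fourier /=.
rewrite (_ : \int[lebX n]_y (cos (dot xi y) * _) =
    c * (damping 2^-1 t (fun=> 0) s xi * cos phi)); last first.
  by rewrite -(add0r phi) -E; apply: eq_Rintegral => y _; rewrite add0r.
rewrite (_ : \int[lebX n]_y (sin (dot xi y) * _) =
    c * (damping 2^-1 t (fun=> 0) s xi * sin phi)); last first.
  have sinE (z : R) : sin z = cos (- (pi / 2) + z).
    by rewrite cosD cosN sinN cos_pihalf sin_pihalf mul0r mulNr opprK mul1r add0r.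
  by rewrite sinE -E; apply: eq_Rintegral => y _; rewrite sinE.
rewrite sqr_sqrtr; last by rewrite addr_ge0 ?sqr_ge0.
rewrite sqrrN !exprMn damping_half_sqr -mulrDr -mulrDr.
by rewrite cos2Dsin2 mulr1.
Qed.

Lemma dot_perm n (sigma : {perm 'I_n}) (xi y : n.-tuple V) :
  dot (perm_tuple sigma xi) (perm_tuple sigma y) = dot xi y.
Proof.
rewrite /dot [RHS](reindex_inj (@perm_inj _ sigma))/=; apply: eq_bigr => i _.
by apply: eq_bigr => k _; rewrite !tnth_mktuple.
Qed.

Lemma fourier_perm n (sigma : {perm 'I_n}) (f : n.-tuple V -> R) (xi : n.-tuple V) :
  measurable_fun setT f ->
  fourier (fun y => f (perm_tuple sigma y)) xi = fourier f (perm_tuple sigma xi).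
Proof.
move=> mf; rewrite /fourier; congr Complex; last congr (- _).
  rewrite /Rintegral -[in RHS](integral_perm _ sigma); last first.
    apply/measurable_EFinP; apply: measurable_funM => //.
    by apply: (measurableT_comp (@measurable_cosT R)); exact: measurable_dot.
  by congr fine; apply: eq_integral => y _; rewrite dot_perm.
rewrite /Rintegral -[in RHS](integral_perm _ sigma); last first.
  apply/measurable_EFinP; apply: measurable_funM => //.
  apply: (@measurableT_comp _ _ _ _ R _ (@sin R)); last exact: measurable_dot.
  by apply: continuous_measurable_fun; exact: continuous_sin.
by congr fine; apply: eq_integral => y _; rewrite dot_perm.
Qed.

(** Two sorted rearrangements of the same distinct times are equal. *)
Lemma path_perm_inj n t (s : n.-tuple RR) (sigma tau : {perm 'I_n}) :
  path <%R 0 (rcons (perm_tuple sigma s) t) ->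
  path <%R 0 (rcons (perm_tuple tau s) t) -> sigma = tau.
Proof.
rewrite !rcons_path => /andP[/path_sorted s1 _] /andP[/path_sorted s2 _].
have mem (a : {perm 'I_n}) : perm_tuple a s =i s.
  move=> z; apply/tnthP/tnthP => -[i ->]; first by exists (a i); rewrite tnth_mktuple.
  by exists (a^-1%g i); rewrite tnth_mktuple permKV.
have E : perm_tuple sigma s = perm_tuple tau s :> seq R.
  apply: (irr_sorted_eq (@lt_trans _ R) (@ltxx _ R) s1 s2) => z.
  by rewrite !mem.
have inj : injective (tnth (perm_tuple sigma s)).
  by apply/tuple_uniqP; apply: sorted_uniq s1 => //; exact: lt_trans.
apply/permP => j.
have : tnth (perm_tuple sigma s) j = tnth (perm_tuple sigma s) (sigma^-1%g (tau j)).
  have tp (a : {perm 'I_n}) i : tnth (perm_tuple a s) i = tnth s (a i).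
    exact: tnth_mktuple.
  by rewrite [RHS]tp permKV -tp !(tnth_nth (0 : R)) E.
by move/inj => jE; rewrite {1}jE permKV.
Qed.

(** For given times at most one permutation sorts them, so at most one summand
    of the symmetrized kernel is nonzero and the square of the sum is the sum
    of the squares. *)
Lemma fourier_chaos_kernel n t x (s : n.-tuple RR) (xi : n.-tuple V) :
  ComplexField.Normc.normc (fourier (@chaos_kernel R d n t x s) xi) ^+ 2 =
  (n`!%:R^-1) ^+ 2 * \sum_(sigma : {perm 'I_n})
    (path <%R 0 (rcons (perm_tuple sigma s) t))%:R *
    damping 1 t (fun=> 0) (perm_tuple sigma s) (perm_tuple sigma xi).
Proof.
have kE (y : n.-tuple V) : chaos_kernel t x s y = n`!%:R^-1 * \sum_(sigma : {perm 'I_n})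
    path_kernel t x (perm_tuple sigma s) (perm_tuple sigma y) *
    (path <%R 0 (rcons (perm_tuple sigma s) t))%:R by [].
have [[sigma h]|no] := pselect (exists sigma : {perm 'I_n},
    path <%R 0 (rcons (perm_tuple sigma s) t)); last first.
  have no' (sigma : {perm 'I_n}) : path <%R 0 (rcons (perm_tuple sigma s) t) = false.
    by apply/negP => h; apply: no; exists sigma.
  have k0 : @chaos_kernel R d n t x s = fun=> 0.
    apply/funext => y; rewrite kE big1 ?mulr0// => sigma _.
    by rewrite no' mulr0.
  rewrite k0 big1 ?mulr0; last by move=> sigma _; rewrite no' mul0r.
  have z0 (g : n.-tuple V -> R) : \int[lebX n]_y (g y * 0) = 0.
    by rewrite /Rintegral integral0_eq// => y _; rewrite mulr0.
  by rewrite /fourier/= !z0 oppr0 expr0n/= addr0 sqrtr0 expr0n.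
have no' (tau : {perm 'I_n}) : tau != sigma ->
    path <%R 0 (rcons (perm_tuple tau s) t) = false.
  by move=> ts; apply/negP => h'; move/eqP: ts; apply; exact: path_perm_inj h' h.
rewrite [in RHS](bigD1 sigma)//= h mul1r [in RHS]big1 ?addr0; last first.
  by move=> tau ts; rewrite no'// mul0r.
have inc : increasing_to t (perm_tuple sigma s).
  by move: h; rewrite path_rcons_increasing => /andP[].
have kE' : @chaos_kernel R d n t x s = (fun y => n`!%:R^-1 *
    path_kernel t x (perm_tuple sigma s) (perm_tuple sigma y)).
  apply/funext => y; rewrite kE (bigD1 sigma)//= h mulr1 big1 ?addr0// => tau ts.
  by rewrite no'// mulr0.
pose f (y : n.-tuple V) := n`!%:R^-1 * path_kernel t x (perm_tuple sigma s) y.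
have mf : measurable_fun setT f.
  by apply: measurable_funM => //; exact: measurable_path_kernel.
have := fourier_path x (perm_tuple sigma xi) n`!%:R^-1 inc.
by rewrite -/f -(fourier_perm sigma xi mf) kE' => <-.
Qed.

Variable H : 'I_d -> R.

Definition spectral_weight n (xi : n.-tuple V) : R :=
  \prod_(i < n) \prod_(k < d) `|tnth (tnth xi i) k| `^ (1 - 2 * H k).

Lemma spectral_weight_perm n (sigma : {perm 'I_n}) (xi : n.-tuple V) :
  spectral_weight (perm_tuple sigma xi) = spectral_weight xi.
Proof.
rewrite /spectral_weight [RHS](reindex_inj (@perm_inj _ sigma))/=.
by apply: eq_bigr => i _; apply: eq_bigr => k _; rewrite tnth_mktuple.
Qed.

Definition chaos_density n t (p : n.-tuple RR * n.-tuple V) : R :=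
  (path <%R 0 (rcons p.1 t))%:R * (damping 1 t (fun=> 0) p.1 p.2 * spectral_weight p.2).

Lemma chaos_density_ge0 n t p : 0 <= @chaos_density n t p.
Proof.
rewrite mulr_ge0// mulr_ge0 ?damping_ge0// prodr_ge0// => i _.
by apply: prodr_ge0 => k _; exact: powR_ge0.
Qed.

Lemma measurable_chaos_density n t :
  measurable_fun setT (@chaos_density n t).
Proof.
have mn i : measurable_fun setT (fun p : n.-tuple RR * n.-tuple V => (nth t p.1 i : R)).
  apply: (measurableT_comp (@measurable_nth _ RR n t i)); exact: measurable_fst.
have mlt (f g : n.-tuple RR * n.-tuple V -> R) : measurable_fun setT f ->
    measurable_fun setT g -> measurable_fun setT (fun p => (f p < g p)%R%:R : R).
  move=> mf mg.
  rewrite (_ : (fun p => _) = (fun p => if f p < g p then 1 else 0)); last first.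
    by apply/funext => p; case: ifP.
  apply: measurable_fun_ifT => //; exact: measurable_fun_ltr.
have mx i k : measurable_fun setT
    (fun p : n.-tuple RR * n.-tuple V => (tnth (tnth p.2 i) k : R)).
  apply: (measurableT_comp (@measurable_tnth_tnth R d n i k)); exact: measurable_snd.
apply: measurable_funM.
  rewrite (_ : (fun p => _) = (fun p : n.-tuple RR * n.-tuple V =>
    (0 < nth t p.1 0)%R%:R * \prod_(i < n) (nth t p.1 i < nth t p.1 i.+1)%R%:R)); last first.
    apply/funext => p; rewrite path_rcons_increasing -mulnb natrM; congr (_ * _).
    have [/forallP h|] := boolP (increasing_to t p.1).
      by rewrite big1// => i _; rewrite h.
    rewrite negb_forall => /existsP[i /negbTE h].
    by rewrite (bigD1 i)//= h mul0r.
  apply: measurable_funM; first exact: mlt.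
  by apply: measurable_prod => i _; exact: mlt.
apply: measurable_funM.
  apply: measurable_prod => i _; apply: measurableT_comp => //.
  apply: measurable_funN; apply: measurable_funM.
    by apply: measurable_funM => //; exact: measurable_funB.
  apply: measurable_sum => k; apply: measurable_funX; apply: measurable_funD => //.
  rewrite (_ : (fun p => _) = (fun p : n.-tuple RR * n.-tuple V =>
    \sum_(j < n) if (j <= i)%N then tnth (tnth p.2 j) k else 0)); last first.
    by apply/funext => p; rewrite big_mkcond.
  by apply: measurable_sum => j; case: (j <= i)%N; [exact: mx|exact: measurable_cst].
apply: measurable_prod => i _; apply: measurable_prod => k _.
apply: (measurableT_comp (measurable_powR _)).
exact: (measurableT_comp (@normr_measurable R setT) (mx i k)).
Qed.

Lemma noise_sqnorm_chaos n t x :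
  (noise_sqnorm H (@chaos_kernel R d n t x) = (n`!%:R^-1)%:E *
  \int[lebesgue_tuple n]_s \int[lebX n]_xi (chaos_density t (s, xi))%:E)%E.
Proof.
have f0 : (n`!%:R : R) != 0 by rewrite pnatr_eq0 -lt0n fact_gt0.
pose G (p : n.-tuple RR * n.-tuple V) : \bar R := (chaos_density t p)%:E.
have mG : measurable_fun setT G by apply/measurable_EFinP; exact: measurable_chaos_density.
have G0 p : (0 <= G p)%E by rewrite lee_fin chaos_density_ge0.
pose ps (sigma : {perm 'I_n}) (p : n.-tuple RR * n.-tuple V) :=
  (perm_tuple sigma p.1, perm_tuple sigma p.2).
have mps sigma : measurable_fun setT (ps sigma).
  apply: measurable_fun_pair.
    by apply: (measurableT_comp (@measurable_perm_tuple _ RR n sigma)); exact: measurable_fst.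
  by apply: (measurableT_comp (@measurable_perm_tuple _ V n sigma)); exact: measurable_snd.
have mGp sigma : measurable_fun setT (G \o ps sigma) by exact: measurableT_comp.
pose I : \bar R := (\int[lebesgue_tuple n]_s \int[lebX n]_xi G (s, xi))%E.
have Gp sigma : (\int[lebesgue_tuple n \x lebX n]_p G (ps sigma p) = I)%E.
  have F1 := @fubini_tonelli1 _ _ _ _ R (lebesgue_tuple n) (lebX n) (G \o ps sigma)
    (mGp sigma) (fun p => G0 (ps sigma p)).
  apply: (eq_trans F1).
  have mF := @measurable_fun_fubini_tonelli_F _ _ _ _ R (lebX n) G mG G0.
  have F2 := @ge0_integral_perm _ RR R (@lebesgue_measure R) n sigma (fubini_F (lebX n) G) mF
    (fun s => integral_ge0 (lebX n) (fun xi _ => G0 (s, xi))).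
  apply: (eq_trans _ F2); apply: eq_integral => s _.
  have mGs : measurable_fun setT (fun xi : n.-tuple V => G (perm_tuple sigma s, xi)).
    by apply: (measurableT_comp mG); exact: measurable_pair1.
  exact: (ge0_integral_perm (lebesgue_tuple d) sigma mGs (fun xi => G0 _)).
rewrite /noise_sqnorm integral_mkcond.
transitivity (\int[lebesgue_tuple n \x lebX n]_p
   \sum_(sigma : {perm 'I_n}) (((n`!%:R^-1) ^+ 2)%:E * G (ps sigma p)))%E.
  apply: eq_integral => -[s xi] _; rewrite patchE.
  have E : (ComplexField.Normc.normc (fourier (@chaos_kernel R d n t x s) xi) ^+ 2 * spectral_weight xi)%:E =
      (\sum_(sigma : {perm 'I_n}) (((n`!%:R^-1) ^+ 2)%:E * G (ps sigma (s, xi))))%E.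
    rewrite fourier_chaos_kernel -mulrA mulr_suml mulr_sumr -sumEFin.
    apply: eq_bigr => sigma _; rewrite -EFinM; congr EFin; congr (_ * _).
    by rewrite /chaos_density/= spectral_weight_perm mulrA.
  case: ifPn => [_|]; first exact: E.
  rewrite notin_setE => /= nD; rewrite big1// => sigma _.
  rewrite /G /chaos_density/=.
  have -> : path <%R 0 (rcons (perm_tuple sigma s) t) = false.
    apply/negP => pth; apply: nD => i.
    have /allP h : all (fun z => 0 < z) (rcons (perm_tuple sigma s) t).
      by apply: order_path_min pth; exact: lt_trans.
    apply/ltW/h; rewrite mem_rcons inE; apply/orP; right.
    by apply/tnthP; exists (sigma^-1%g i); rewrite tnth_mktuple permKV.
  by rewrite mul0r mule0.
rewrite ge0_integral_sum//; last 2 first.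
- by move=> sigma; apply: measurable_funeM; exact: mGp.
- by move=> sigma p _; rewrite mule_ge0// lee_fin sqr_ge0.
transitivity (\sum_(sigma in {perm 'I_n}) ((n`!%:R^-1) ^+ 2)%:E * I)%E.
  apply: eq_big => // sigma _; rewrite -(Gp sigma).
  by apply: ge0_integralZl => //; exact: (mGp sigma).
have I0 : (0 <= I)%E.
  by apply: integral_ge0 => s _; apply: integral_ge0 => xi _; exact: G0.
have iterE (c : \bar R) m : (0 <= c)%E -> iter m (+%E c) 0%E = (m%:R%:E * c)%E.
  move=> c0; elim: m => [|m IH]; first by rewrite mul0e.
  by rewrite iterS IH -[in RHS]natr1 EFinD ge0_muleDl// mul1e addeC.
rewrite big_const card_Sn; apply: (eq_trans (iterE _ _ _)).
  by rewrite mule_ge0// lee_fin sqr_ge0.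
by rewrite muleA -EFinM; congr (_%:E * _)%E; field.
Qed.

(** The n! summands have equal integrals by invariance under permutations,
    which cancels the normalization of the kernel. *)
Lemma chaos_second_momentE n t x : (0 < n)%N ->
  (chaos_second_moment H n t x =
  \int[lebesgue_tuple n]_s \int[lebX n]_xi (chaos_density t (s, xi))%:E)%E.
Proof.
case: n => // n _; rewrite /chaos_second_moment noise_sqnorm_chaos muleA -EFinM.
by rewrite divff ?mul1e// pnatr_eq0 -lt0n fact_gt0.
Qed.

End second_moment_formula.

(** * Upper bound on the frequency integral *)

Lemma lee_prod_EFin {R : realType} (I : Type) (r : seq I) (f : I -> \bar R) (c : I -> R) :
  (forall i, 0 <= f i)%E -> (forall i, f i <= (c i)%:E)%E ->
  (\prod_(i <- r) f i <= (\prod_(i <- r) c i)%:E)%E.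
Proof.
move=> f0 fc; elim: r => [|i r IH]; first by rewrite !big_nil.
by rewrite !big_cons EFinM; apply: lee_pmul => //; exact: prode_ge0.
Qed.

Lemma gt0_powRD {R : realType} (x p q : R) : 0 < x -> x `^ (p + q) = x `^ p * x `^ q.
Proof. by move=> x0; rewrite powRD//; apply/implyP => _; rewrite gt_eqF. Qed.

Section spectral_upper_bound.
Context {R : realType} (d : nat).
Local Notation leb := (@lebesgue_measure R).
Local Notation RR := (measurableTypeR R).
Local Notation V := (d.-tuple (measurableTypeR R)).
Local Notation lebX n := (tuple_measure (lebesgue_tuple d) n).
Implicit Types (n : nat) (t : R) (e : 'I_d -> R).

Lemma integral_tuple_prod (f : 'I_d -> R -> R) :
  (forall k, measurable_fun setT (f k)) -> (forall k y, 0 <= f k y) ->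
  (\int[lebesgue_tuple d]_x (\prod_(k < d) f k (tnth x k))%:E =
   \prod_(k < d) \int[leb]_y (f k y)%:E)%E.
Proof.
move=> mf f0.
rewrite -(@ge0_integral_tuple_prod _ RR R leb d (fun k y => (f k y)%:E)).
- by apply: eq_integral => x _; rewrite prodEFin.
- by move=> k; apply/measurable_EFinP; exact: mf.
- by move=> k y; rewrite lee_fin.
Qed.

Lemma measurable_tuple_prod (f : 'I_d -> R -> R) :
  (forall k, measurable_fun setT (f k)) ->
  measurable_fun setT (fun x : V => \prod_(k < d) f k (tnth x k)).
Proof.
move=> mf; apply: measurable_prod => k _.
by apply: (measurableT_comp (mf k)); exact: measurable_tnth.
Qed.

Lemma integral_tuple_prod_le (f : 'I_d -> R -> R) (c : 'I_d -> R) :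
  (forall k, measurable_fun setT (f k)) -> (forall k y, 0 <= f k y) ->
  (forall k, \int[leb]_y (f k y)%:E <= (c k)%:E)%E ->
  (\int[lebesgue_tuple d]_x (\prod_(k < d) f k (tnth x k))%:E <=
   (\prod_(k < d) c k)%:E)%E.
Proof.
move=> mf f0 fc; rewrite integral_tuple_prod//; apply: lee_prod_EFin => // k.
by apply: integral_ge0 => y _; rewrite lee_fin.
Qed.

Variable H : 'I_d -> R.
Local Notation a k := (1 - 2 * H k).

(** The frequency integral for given times, with the frequencies offset by e.
    *)
Definition spectral_integral n t e (s : n.-tuple RR) : \bar R :=
  (\int[lebX n]_xi (damping 1 t e s xi * spectral_weight H xi)%:E)%E.

Lemma spectral_weight_ge0 n (xi : n.-tuple V) : 0 <= spectral_weight H xi.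
Proof. by apply: prodr_ge0 => i _; apply: prodr_ge0 => k _; exact: powR_ge0. Qed.

Lemma measurable_spectral n t e (s : n.-tuple RR) :
  measurable_fun setT (fun xi : n.-tuple V => damping 1 t e s xi * spectral_weight H xi).
Proof.
apply: measurable_funM.
  apply: measurable_prod => i _; apply: measurableT_comp => //.
  apply: measurable_funN; apply: measurable_funM => //.
  apply: measurable_sum => k; apply: measurable_funX; apply: measurable_funD => //.
  rewrite (_ : (fun p => _) = (fun xi : n.-tuple V =>
    \sum_(j < n) if (j <= i)%N then tnth (tnth xi j) k else 0)); last first.
    by apply/funext => p; rewrite big_mkcond.
  apply: measurable_sum => j.
  by case: (j <= i)%N; [exact: measurable_tnth_tnth|exact: measurable_cst].
apply: measurable_prod => i _; apply: measurable_prod => k _.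
apply: (measurableT_comp (measurable_powR _)).
exact: (measurableT_comp (@normr_measurable R setT) (measurable_tnth_tnth _ _)).
Qed.

Lemma spectral_integral_ge0 n t e (s : n.-tuple RR) : (0 <= spectral_integral t e s)%E.
Proof.
apply: integral_ge0 => xi _.
by rewrite lee_fin mulr_ge0 ?damping_ge0 ?spectral_weight_ge0.
Qed.

(** The part of the integrand that depends on the first frequency alone; it is
    a product over the coordinates. *)
Definition frequency_factor (w : R) e (x : V) : R :=
  \prod_(k < d) (expR (- (w * (e k + tnth x k) ^+ 2)) * `|tnth x k| `^ a k).

Lemma frequency_factor_ge0 w e x : 0 <= frequency_factor w e x.
Proof. by apply: prodr_ge0 => k _; rewrite mulr_ge0 ?expR_ge0 ?powR_ge0. Qed.

Let spectral_cons n t e s0 x0 (s : n.-tuple RR) (xi : n.-tuple V) :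
  damping 1 t e (tuple_cons (s0, s)) (tuple_cons (x0, xi)) *
    spectral_weight H (tuple_cons (x0, xi)) =
  frequency_factor (nth t s 0 - s0) e x0 *
  (damping 1 t (fun k => e k + tnth x0 k) s xi * spectral_weight H xi).
Proof.
rewrite damping_cons /frequency_factor big_split/= -expR_sum mul1r mulr_sumr sumrN.
have -> : spectral_weight H (tuple_cons (x0, xi)) =
    \prod_(k < d) `|tnth x0 k| `^ a k * spectral_weight H xi.
  rewrite /spectral_weight big_ord_recl; congr (_ * _).
  by apply: eq_bigr => i _; apply: eq_bigr => k _; rewrite tnthS.
by rewrite mulrACA.
Qed.

Lemma spectral_integral0 t e (s : 0.-tuple RR) : spectral_integral t e s = 1%E.
Proof. by rewrite /spectral_integral integral_tuple0 /damping /spectral_weight !big_ord0 mulr1. Qed.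

Lemma spectral_integralS n t e s0 (s : n.-tuple RR) :
  (spectral_integral t e (tuple_cons (s0, s)) =
  \int[lebesgue_tuple d]_x ((frequency_factor (nth t s 0 - s0) e x)%:E *
     spectral_integral t (fun k => e k + tnth x k)%R s))%E.
Proof.
rewrite /spectral_integral ge0_integral_tupleS; last 2 first.
- by apply/measurable_EFinP; exact: measurable_spectral.
- by move=> v; rewrite lee_fin mulr_ge0 ?damping_ge0 ?spectral_weight_ge0.
apply: eq_integral => x _; rewrite -ge0_integralZl//; last 3 first.
- by apply/measurable_EFinP; exact: measurable_spectral.
- by move=> v _; rewrite lee_fin mulr_ge0 ?damping_ge0 ?spectral_weight_ge0.
- by rewrite lee_fin frequency_factor_ge0.
by apply: eq_integral => xi _; rewrite -EFinM spectral_cons.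
Qed.

Lemma measurable_spectral_integralS n t e s0 (s : n.-tuple RR) :
  measurable_fun setT (fun x : V => (frequency_factor (nth t s 0 - s0) e x)%:E *
     spectral_integral t (fun k => e k + tnth x k)%R s)%E.
Proof.
pose f (xi : n.+1.-tuple V) := (damping 1 t e (tuple_cons (s0, s)) xi *
    spectral_weight H xi)%:E.
have mf : measurable_fun setT (f \o tuple_cons).
  apply: measurableT_comp; last exact: measurable_tuple_cons.
  by apply/measurable_EFinP; exact: measurable_spectral.
have f0 p : (0 <= (f \o tuple_cons) p)%E.
  by rewrite lee_fin mulr_ge0 ?damping_ge0 ?spectral_weight_ge0.
have := @measurable_fun_fubini_tonelli_F _ _ _ _ R (lebX n) (f \o tuple_cons) mf f0.
congr measurable_fun; apply/funext => x; rewrite /fubini_F/=.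
rewrite -ge0_integralZl//; last 3 first.
- by apply/measurable_EFinP; exact: measurable_spectral.
- by move=> v _; rewrite lee_fin mulr_ge0 ?damping_ge0 ?spectral_weight_ge0.
- by rewrite lee_fin frequency_factor_ge0.
by apply: eq_integral => xi _; rewrite /f spectral_cons.
Qed.

Definition gap_power n (kappa : R) t (s : n.-tuple RR) : R :=
  \prod_(i < n) (nth t s i.+1 - nth t s i) `^ (- kappa).

Lemma gap_power_cons n kappa t s0 (s : n.-tuple RR) :
  gap_power kappa t (tuple_cons (s0, s)) = (nth t s 0 - s0) `^ (- kappa) * gap_power kappa t s.
Proof. by rewrite /gap_power big_ord_recl. Qed.

Lemma gap_power_ge0 n kappa t (s : n.-tuple RR) : 0 <= gap_power kappa t s.
Proof. by apply: prodr_ge0 => i _; exact: powR_ge0. Qed.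

Variable b : 'I_d -> R.
Hypothesis a1 : forall k, -1 < a k.
Hypothesis ba : forall k, b k <= - a k.
Hypothesis ba1 : forall k, b k < 1 + a k.
Hypothesis b1 : forall k, b k < 1.

Let D : R := \sum_(k < d) (1 + a k).
Let B : R := \sum_(k < d) b k.
Hypothesis B0 : B <= 0.

Let shift_integral (e c r : R) (g : R -> R) : 0 < r ->
  measurable_fun setT g -> (forall y, 0 <= g y) ->
  (\int[leb]_y (expR (- (r `^ (- 2) * (e + y) ^+ 2)) * `|y| `^ c * g (e + y))%:E =
   \int[leb]_y (expR (- (y / r) ^+ 2) * (`|y - e| `^ c * g y))%:E)%E.
Proof.
move=> r0 mg g0.
pose f y : \bar R := (expR (- (y / r) ^+ 2) * (`|y - e| `^ c * g y))%:E.
have f0 y : (0 <= f y)%E by rewrite lee_fin !mulr_ge0 ?expR_ge0 ?powR_ge0.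
have mf : measurable_fun setT f.
  apply/measurable_EFinP; apply: measurable_funM; last first.
    by apply: measurable_funM => //; exact: measurable_normr_powR.
  have mexp : measurable_fun setT (fun z : R => expR (- z ^+ 2)).
    exact: measurable_gauss_fun.
  by apply: (measurableT_comp mexp); exact: measurable_funM.
have := @ge0_integral_affine R 1 e f (oner_neq0 _) mf f0.
rewrite normr1 invr1 mul1e => <-; apply: eq_integral => y _.
rewrite /f mul1r addrK (addrC y) -mulrA; congr (expR (- _) * _)%:E.
by rewrite exprMn exprVn powRN powR_mulrn ?(ltW r0)// mulrC.
Qed.

Let powRsum (I : finType) (c : I -> R) (x : R) : 0 < x ->
  \prod_i x `^ c i = x `^ (\sum_i c i).
Proof.
move=> x0; elim/big_rec2 : _ => [|i y z _ ->]; first by rewrite powRr0.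
by rewrite gt0_powRD.
Qed.

(** Induction on the number of points, by smoothing_step in every coordinate.
    With the width r = w^(-1/2) attached to a time gap w, the step from the
    width r1 to the width r produces r^(D+B) max(r,r1)^-B. Since B <= 0 and
    widths are bounded below on bounded times, max(r,r1) is at most a constant
    times r r1, and the powers separate into r^D and r1^-B: every gap after the
    first ends up with the exponent D - B of its width. *)
Lemma spectral_integral_le (tau : R) : 1 <= tau ->
  exists2 C : R, 0 < C & forall n t s0 (s : n.-tuple RR) e,
    increasing_to t (tuple_cons (s0, s)) -> t - s0 <= tau ->
    forall r, r = (nth t s 0 - s0) `^ (- 2^-1) ->
    (spectral_integral t e (tuple_cons (s0, s)) <=
      (C ^+ n.+1 * gap_power (2^-1 * (D - B)) t s *
       (r `^ D * \prod_(k < d) Num.max r `|e k| `^ (- b k)))%:E)%E.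
Proof.
move=> tau1; have tau0 : 0 < tau by exact: lt_le_trans tau1.
have stepk k : exists C : R, 0 < C /\ forall r s h, 0 < r -> 0 < s ->
    (\int[leb]_y (expR (- (y / r) ^+ 2) * (`|y - h| `^ a k * Num.max s `|y| `^ (- b k)))%:E <=
     (C * (r `^ (1 + a k + b k) * Num.max r s `^ (- b k) * Num.max r `|h| `^ (- b k)))%:E)%E.
  by have [C C0 hC] := smoothing_step (a1 k) (ba k) (ba1 k) (b1 k); exists C.
have basek k : exists C : R, 0 < C /\ forall r h, 0 < r ->
    (\int[leb]_y (expR (- (y / r) ^+ 2) * `|y - h| `^ a k)%:E <=
     (C * (r `^ (1 + a k + b k) * Num.max r `|h| `^ (- b k)))%:E)%E.
  by have [C C0 hC] := smoothing_base (a1 k) (ba k) (ba1 k) (b1 k); exists C.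
have [Cs hCs] := choice stepk; have [Cb hCb] := choice basek.
(* Time gaps are at most tau, so their widths are at least 1 / theta. *)
pose theta := tau `^ (2^-1); have theta0 : 0 < theta by rewrite powR_gt0.
pose Ck k := Cs k + Cb k.
have Cs0 k : 0 < Cs k by case: (hCs k).
have Cb0 k : 0 < Cb k by case: (hCb k).
have CsC k : Cs k <= Ck k by rewrite lerDl ltW.
have CbC k : Cb k <= Ck k by rewrite lerDr ltW.
have Ck0 k : 0 < Ck k by rewrite addr_gt0.
pose P := \prod_(k < d) Ck k; have P0 : 0 < P by rewrite prodr_gt0.
pose K := P * theta `^ (- B).
have K0 : 0 < K by rewrite mulr_gt0 ?powR_gt0.
have DB : \sum_(k < d) (1 + a k + b k) = D + B by rewrite /D /B -big_split.
have small_gap w : 0 < w -> w <= tau -> theta^-1 <= w `^ (- 2^-1).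
  move=> w0 wt; rewrite powRN lef_pV2 ?posrE ?powR_gt0//.
  by apply: ge0_ler_powR; rewrite ?nnegrE ?invr_ge0// ltW.
have rsq w : 0 < w -> (w `^ (- 2^-1)) `^ (- 2) = w.
  by move=> w0; rewrite -powRrM mulrN mulNr opprK mulVf// powRr1// ltW.
have thetaB : theta `^ (- B) = theta^-1 `^ B.
  by rewrite -(powR_inv1 (ltW theta0)) -powRrM mulN1r.
exists K => // n t; elim: n => [|n IH] s0 s e.
  move=> inc tau_le r rE; have w0 : 0 < nth t s 0 - s0.
    by move: inc; rewrite increasing_to_cons => /andP[]; rewrite subr_gt0.
  have r0 : 0 < r by rewrite rE powR_gt0.
  have wt : nth t s 0 - s0 <= tau by rewrite tuple0.
  rewrite spectral_integralS.
  under eq_integral do rewrite spectral_integral0 mule1.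
  pose f k y : R := expR (- (r `^ (- 2) * (e k + y) ^+ 2)) * `|y| `^ a k * 1.
  have fE (x : V) : frequency_factor (nth t s 0 - s0) e x = \prod_(k < d) f k (tnth x k).
    by apply: eq_bigr => k _; rewrite /f mulr1 rE rsq.
  under eq_integral do rewrite fE.
  apply: (@le_trans _ _ (\prod_(k < d) (Ck k * (r `^ (1 + a k + b k) *
      Num.max r `|e k| `^ (- b k))))%:E).
    apply: integral_tuple_prod_le => k.
    - apply: measurable_funM => //; apply: measurable_funM; last first.
        by have := @measurable_normr_powR R (a k) 0; under eq_fun do rewrite subr0.
      have mexp := @measurable_expR_sqr R (r `^ (- 2)).
      by apply: (measurableT_comp mexp); exact: measurable_funD.
    - by move=> y; rewrite !mulr_ge0 ?expR_ge0 ?powR_ge0.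
    - rewrite (@shift_integral (e k) (a k) r (cst 1))//.
      under eq_integral do rewrite mulr1.
      apply: le_trans ((hCb k).2 r (e k) r0) _; rewrite lee_fin ler_wpM2r//.
      by rewrite mulr_ge0 ?powR_ge0.
  rewrite lee_fin !big_split/= powRsum// DB.
  have -> : gap_power (2^-1 * (D - B)) t s = 1 by rewrite /gap_power big_ord0.
  rewrite expr1 mulr1 /K -/P -!mulrA ler_wpM2l ?(ltW P0)// mulrA.
  rewrite ler_wpM2r//; first by apply: prodr_ge0 => k _; exact: powR_ge0.
  rewrite gt0_powRD// mulrC ler_wpM2r ?powR_ge0//.
  by rewrite thetaB; apply: gt0_ler_powRN; rewrite ?invr_gt0// rE small_gap.
have [s1 [s' ->]] := tuple_consP s.
rewrite increasing_to_cons => /andP[]; rewrite -subr_gt0 => w0 inc' tau_le r rE.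
have nthE : nth t (tuple_cons (s1, s')) 0 = s1 by [].
have s1t := increasing_to_nth0_le inc'; rewrite nthE in s1t w0.
have w1 : 0 < nth t s' 0 - s1.
  by move: inc'; rewrite increasing_to_cons => /andP[]; rewrite subr_gt0.
have tau_le' : t - s1 <= tau by lra.
have s't : nth t s' 0 <= t.
  by move: inc'; rewrite increasing_to_cons => /andP[_]; exact: increasing_to_nth0_le.
have r0 : 0 < r by rewrite rE powR_gt0.
pose r1 := (nth t s' 0 - s1) `^ (- 2^-1); have r10 : 0 < r1 by rewrite powR_gt0.
have rt : theta^-1 <= r by rewrite rE; apply: small_gap => //; rewrite nthE; lra.
have r1t : theta^-1 <= r1 by apply: small_gap => //; lra.
rewrite spectral_integralS nthE.
pose f k y : R := expR (- (r `^ (- 2) * (e k + y) ^+ 2)) * `|y| `^ a k *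
   Num.max r1 `|e k + y| `^ (- b k).
pose M := K ^+ n.+1 * gap_power (2^-1 * (D - B)) t s' * r1 `^ D.
have M0 : 0 <= M by rewrite !mulr_ge0 ?exprn_ge0 ?(ltW K0) ?gap_power_ge0 ?powR_ge0.
have mg k : measurable_fun setT (fun y : R => Num.max r1 `|y| `^ (- b k)).
  apply: (measurableT_comp (measurable_powR (- b k))).
  by apply: measurable_maxr => //; exact: measurableT_comp.
have mf k : measurable_fun setT (f k).
  apply: measurable_funM; last first.
    by apply: (measurableT_comp (mg k)); exact: measurable_funD.
  apply: measurable_funM; last first.
    by have := @measurable_normr_powR R (a k) 0; under eq_fun do rewrite subr0.
  have mexp := @measurable_expR_sqr R (r `^ (- 2)).
  by apply: (measurableT_comp mexp); exact: measurable_funD.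
have f0 k y : 0 <= f k y by rewrite !mulr_ge0 ?expR_ge0 ?powR_ge0.
have mff : measurable_fun setT (fun x : V => (\prod_(k < d) f k (tnth x k))%:E).
  by apply/measurable_EFinP; exact: measurable_tuple_prod.
apply: (@le_trans _ _ (\int[lebesgue_tuple d]_x (M%:E * (\prod_(k < d) f k (tnth x k))%:E))%E).
  apply: ge0_le_integral => //.
  - by move=> x _; rewrite mule_ge0 ?spectral_integral_ge0// lee_fin frequency_factor_ge0.
  - have := measurable_spectral_integralS t e s0 (tuple_cons (s1, s')).
    by rewrite nthE.
  - exact: measurable_funeM.
  move=> x _.
  have h := IH s1 s' (fun k => e k + tnth x k) inc' tau_le' r1 erefl.
  apply: (le_trans (lee_wpmul2l _ h)); first by rewrite lee_fin frequency_factor_ge0.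
  rewrite -!EFinM lee_fin /M.
  have -> : \prod_(k < d) f k (tnth x k) = frequency_factor (s1 - s0) e x *
      \prod_(k < d) Num.max r1 `|e k + tnth x k| `^ (- b k).
    rewrite /frequency_factor -big_split/=; apply: eq_bigr => k _.
    by rewrite /f rE nthE rsq.
  by rewrite le_eqVlt; apply/orP; left; apply/eqP; ring.
rewrite ge0_integralZl//; last first.
  by move=> x _; rewrite lee_fin prodr_ge0.
apply: (@le_trans _ _ (M%:E * (\prod_(k < d) (Ck k * (r `^ (1 + a k + b k) *
     Num.max r r1 `^ (- b k) * Num.max r `|e k| `^ (- b k))))%:E)%E).
  apply: lee_wpmul2l; first by rewrite lee_fin.
  apply: integral_tuple_prod_le => // k.
  rewrite (@shift_integral (e k) (a k) r (fun y => Num.max r1 `|y| `^ (- b k)))//.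
    apply: le_trans ((hCs k).2 r r1 (e k) r0 r10) _; rewrite lee_fin ler_wpM2r//.
    by rewrite !mulr_ge0 ?powR_ge0.
  by move=> y; exact: powR_ge0.
rewrite -EFinM lee_fin !big_split/= powRsum// DB powRsum; last by rewrite lt_max r0.
rewrite sumrN -/B gap_power_cons -/P.
have -> : (nth t s' 0 - s1) `^ (- (2^-1 * (D - B))) = r1 `^ (D - B).
  by rewrite /r1 -powRrM mulNr.
set U := \prod_(k < d) _; have U0 : 0 <= U by apply: prodr_ge0 => k _; exact: powR_ge0.
(* Both r theta and r1 theta are at least 1. *)
have mx : Num.max r r1 `^ (- B) <= theta `^ (- B) * (r `^ (- B) * r1 `^ (- B)).
  rewrite -powRM ?(ltW r0) ?(ltW r10)// -powRM ?mulr_ge0 ?(ltW r0) ?(ltW r10) ?(ltW theta0)//.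
  apply: ge0_ler_powR; rewrite ?nnegrE ?oppr_ge0//.
  - by rewrite le_max (ltW r0).
  - by rewrite !mulr_ge0 ?(ltW r0) ?(ltW r10) ?(ltW theta0).
  have h1 : 1 <= theta * r1 by rewrite -(mulfV (lt0r_neq0 theta0)) ler_pM2l.
  have h0 : (1 <= theta * r)%R by rewrite -(mulfV (lt0r_neq0 theta0)) ler_pM2l.
  rewrite ge_max; apply/andP; split.
    by rewrite mulrCA ler_peMr// ltW.
  by rewrite mulrA ler_peMl// ltW.
have e1 : r `^ (D + B) * r `^ (- B) = r `^ D by rewrite -gt0_powRD// addrK.
have e2 : r1 `^ D * r1 `^ (- B) = r1 `^ (D - B) by rewrite -gt0_powRD.
rewrite -e1 -e2 /M (exprS K n.+1) {2}/K.
apply: (@le_trans _ _ (K ^+ n.+1 * gap_power (2^-1 * (D - B)) t s' * r1 `^ D *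
  (P * (r `^ (D + B) * (theta `^ (- B) * (r `^ (- B) * r1 `^ (- B))) * U)))); last first.
  by rewrite le_eqVlt; apply/orP; left; apply/eqP; ring.
rewrite ler_wpM2l// ler_wpM2l ?(ltW P0)// ler_wpM2r// ler_wpM2l ?powR_ge0//.
Qed.

End spectral_upper_bound.

(** * Upper bound on the time integral and convergence of the chaos series *)

Section time_integrals.
Context {R : realType}.
Local Notation leb := (@lebesgue_measure R).
Local Notation RR := (measurableTypeR R).

(** Integrating out the earliest time first leaves the other gaps unchanged. *)
Lemma integral_gaps_le (psi : R -> R) (q t : R) n :
  measurable_fun setT psi -> (forall w, 0 <= psi w) -> 0 <= q ->
  (\int[leb]_w (psi w)%:E <= q%:E)%E ->
  (\int[lebesgue_tuple n]_s (\prod_(i < n) psi (nth t s i.+1 - nth t s i))%:E <=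
   (q ^+ n)%:E)%E.
Proof.
move=> mpsi psi0 q0 psiq; elim: n => [|n IH].
  by rewrite integral_tuple0 big_ord0.
have prod0 m (s : m.-tuple RR) :
    (0 <= (\prod_(i < m) psi (nth t s i.+1 - nth t s i))%:E)%E.
  by rewrite lee_fin prodr_ge0.
have mprod m : measurable_fun setT (fun s : m.-tuple RR =>
    (\prod_(i < m) psi (nth t s i.+1 - nth t s i))%:E).
  apply/measurable_EFinP; apply: measurable_prod => i _.
  apply: (measurableT_comp mpsi).
  exact: (measurable_funB (@measurable_nth _ RR m t i.+1) (@measurable_nth _ RR m t i)).
rewrite ge0_integral_tupleS_swap; [|exact: mprod|exact: prod0].
apply: (@le_trans _ _ (\int[lebesgue_tuple n]_s
    (q%:E * (\prod_(i < n) psi (nth t s i.+1 - nth t s i))%:E))%E).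
  rewrite [leLHS](_ : _ = \int[lebesgue_tuple n]_s ((\int[leb]_w (psi w)%:E) *
    (\prod_(i < n) psi (nth t s i.+1 - nth t s i))%:E))%E.
    apply: ge0_le_integral => //.
    - move=> s _; apply: mule_ge0; last exact: prod0.
      by apply: integral_ge0 => w _; rewrite lee_fin.
    - by apply: measurable_funeM; exact: mprod.
    - by apply: measurable_funeM; exact: mprod.
    - by move=> s _; apply: lee_wpmul2r.
  apply: eq_integral => s _.
  transitivity (\int[leb]_x ((\prod_(i < n) psi (nth t s i.+1 - nth t s i))%:E *
      (psi (nth t s 0 - x))%:E))%E.
    by apply: eq_integral => x _; rewrite -EFinM big_ord_recl mulrC.
  rewrite ge0_integralZl//; last 2 first.
  - apply/measurable_EFinP; apply: (measurableT_comp mpsi); exact: measurable_funB.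
  - by move=> x _; rewrite lee_fin.
  rewrite muleC; congr (_ * _)%E.
  have n1 : (-1 : R) != 0 by rewrite oppr_eq0 oner_neq0.
  have mE : measurable_fun setT (fun w => (psi w)%:E) by exact/measurable_EFinP.
  have := @ge0_integral_affine R (-1) (nth t s 0) (fun w => (psi w)%:E) n1 mE
    (fun w => psi0 w).
  rewrite normrN normr1 invr1 mul1e => <-; apply: eq_integral => x _.
  by rewrite mulN1r addrC.
rewrite ge0_integralZl//; last exact: mprod.
by rewrite exprS EFinM; apply: lee_wpmul2l.
Qed.

(** The power of one time gap with an exponential weight, which will be made
    small by the choice of lambda. *)
Definition damped_power (T lambda kappa : R) : R -> R :=
  (fun w : R => expR (- (lambda * w)) * w `^ (- kappa)) \_ `]0, T].

Lemma damped_power_ge0 T lambda kappa w : 0 <= damped_power T lambda kappa w.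
Proof.
by rewrite /damped_power patchE; case: ifPn => // _; rewrite mulr_ge0 ?expR_ge0 ?powR_ge0.
Qed.

Lemma measurable_damped_power T lambda kappa :
  measurable_fun setT (damped_power T lambda kappa).
Proof.
apply/(measurable_restrictT _ _).1; first exact: measurable_itv.
apply: measurable_funTS; apply: measurable_funM; last exact: measurable_powR.
by apply: measurableT_comp => //; apply: measurable_funN; exact: measurable_funM.
Qed.

(** Since x^delta <= exp x, the exponential converts the power w^-kappa into
    lambda^-delta w^(-kappa-delta), still integrable when delta = (1 -
    kappa)/2. *)
Lemma damped_power_small (T kappa eps : R) : 0 < T -> 0 <= kappa -> kappa < 1 -> 0 < eps ->
  exists2 lambda : R, 0 <= lambda &
    (\int[leb]_w (damped_power T lambda kappa w)%:E <= eps%:E)%E.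
Proof.
move=> T0 k0 k1 eps0.
pose delta := (1 - kappa) / 2; have delta0 : 0 < delta by rewrite divr_gt0//; lra.
have delta1 : delta <= 1 by rewrite /delta; lra.
pose c := - kappa - delta; have c1 : -1 < c by rewrite /c /delta; lra.
pose I := T `^ (c + 1) / (c + 1).
have I0 : 0 <= I by rewrite divr_ge0 ?powR_ge0//; lra.
pose L := I / eps + 1; have L0 : 0 < L by rewrite ltr_wpDl// divr_ge0// ltW.
pose lambda := L `^ (delta^-1); have l0 : 0 < lambda by rewrite powR_gt0.
exists lambda; first exact: ltW.
have lE : lambda `^ (- delta) = L^-1.
  by rewrite powRN /lambda -powRrM mulVf ?gt_eqF// powRr1// ltW.
apply: (@le_trans _ _ (\int[leb]_(w in `]0%R, T]) (L^-1%:E * (w `^ c)%:E))%E).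
  rewrite [leRHS]integral_mkcond; apply: ge0_le_integral => //.
  - by move=> w _; rewrite lee_fin damped_power_ge0.
  - by apply/measurable_EFinP; exact: measurable_damped_power.
  - apply/(measurable_restrictT _ _).1; first exact: measurable_itv.
    apply: measurable_funTS; apply: measurable_funeM.
    by apply/measurable_EFinP; exact: measurable_powR.
  move=> w _; rewrite /damped_power !patchE; case: ifPn => // /set_mem/=.
  rewrite in_itv/= => /andP[w0 _]; rewrite -EFinM lee_fin -lE.
  have x0 : 0 < lambda * w by rewrite mulr_gt0.
  have h : (lambda * w) `^ delta <= expR (lambda * w).
    apply: le_trans (expR_ge1Dx _); have [x1|x1] := leP 1 (lambda * w).
      by apply: (le_trans (ler1_powR x1 delta1)); rewrite lerDr.
    apply: (@le_trans _ _ 1); last by rewrite lerDl ltW.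
    rewrite -(powRr0 (lambda * w)); apply: ger_powR; last exact: ltW.
    by rewrite x0 ltW.
  (* The exponent of w is split so that lambda and w carry the same power delta. *)
  rewrite /c (addrC (- kappa)) gt0_powRD// mulrA ler_wpM2r ?powR_ge0//.
  rewrite -powRM ?(ltW l0) ?(ltW w0)// powRN expRN lef_pV2 ?posrE ?expR_gt0 ?powR_gt0//.
rewrite ge0_integralZl//; last 3 first.
- by apply/measurable_EFinP/measurable_funTS; exact: measurable_powR.
- by move=> w _; rewrite lee_fin powR_ge0.
- by rewrite lee_fin invr_ge0 ltW.
apply: (@le_trans _ _ (L^-1%:E * I%:E)%E).
  by apply: lee_wpmul2l; [rewrite lee_fin invr_ge0 ltW|exact: integral_powR_le].
rewrite -EFinM lee_fin mulrC ler_pdivrMr// /L mulrDr mulr1 mulrCA divff ?gt_eqF//.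
by rewrite mulr1 lerDl ltW.
Qed.

(** The gaps add up to t minus the first time, so that the exponential weights
    multiply to a factor that does not depend on the number of points. *)
Lemma gap_power_damped n (T lambda kappa t : R) (s : n.-tuple RR) :
  increasing_to t s -> 0 <= nth t s 0 -> t <= T ->
  gap_power kappa t s = expR (lambda * (t - nth t s 0)) *
    \prod_(i < n) damped_power T lambda kappa (nth t s i.+1 - nth t s i).
Proof.
elim: n s => [|n IH] s.
  by move=> _ _ _; rewrite tuple0/= subrr mulr0 expR0 /gap_power !big_ord0 mulr1.
have [s0 [s' ->]] := tuple_consP s; rewrite increasing_to_cons => /andP[h inc] /= s00 tT.
have s'0 : 0 <= nth t s' 0 by rewrite (le_trans s00)// ltW.
have s't := increasing_to_nth0_le inc.
rewrite gap_power_cons (IH s' inc s'0 tT) big_ord_recl/=.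
rewrite {2}/damped_power patchE mem_set/=; last first.
  by rewrite in_itv/=; apply/andP; split; lra.
have -> : lambda * (t - s0) = lambda * (t - nth t s' 0) + lambda * (nth t s' 0 - s0) by ring.
rewrite expRD expRN.
have e0 := expR_gt0 (lambda * (nth t s' 0 - s0)).
by field; rewrite gt_eqF.
Qed.

End time_integrals.

Lemma integral_chaos_density {R : realType} d (H : 'I_d -> R) n (t : R)
    (s : n.-tuple (measurableTypeR R)) :
  (\int[tuple_measure (lebesgue_tuple d) n]_xi (chaos_density H t (s, xi))%:E =
   (path <%R 0 (rcons s t))%:R%:E * spectral_integral H t (fun=> 0%R) s)%E.
Proof.
rewrite /spectral_integral -ge0_integralZl//.
- by apply/measurable_EFinP; exact: measurable_spectral.
- by move=> xi _; rewrite lee_fin mulr_ge0 ?damping_ge0 ?spectral_weight_ge0.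
Qed.

Section convergence.
Context {R : realType} (d : nat).
Local Notation RR := (measurableTypeR R).
Local Notation V := (d.-tuple (measurableTypeR R)).
Local Notation lebX n := (tuple_measure (lebesgue_tuple d) n).
Variables (H b : 'I_d -> R).
Local Notation a k := (1 - 2 * H k).
Hypothesis a1 : forall k, -1 < a k.
Hypothesis ba : forall k, b k <= - a k.
Hypothesis ba1 : forall k, b k < 1 + a k.
Hypothesis b1 : forall k, b k < 1.
Let D : R := \sum_(k < d) (1 + a k).
Let B : R := \sum_(k < d) b k.
Hypothesis B0 : B <= 0.
Let kappa : R := 2^-1 * (D - B).
Hypothesis kappa1 : kappa < 1.

Let kappa0 : 0 <= kappa.
Proof.
rewrite mulr_ge0// subr_ge0 (le_trans B0)// sumr_ge0// => k _.
by have := a1 k; lra.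
Qed.

(** Each point contributes the constant C of the frequency integral and the
    integral of damped_power, whose product is made at most 1/2. *)
Lemma chaos_second_moment_geometric (t : R) : 0 <= t ->
  exists2 K : R, 0 <= K & forall n x,
    (chaos_second_moment H n.+1 t x <= (K * 2^-1 ^+ n.+1)%:E)%E.
Proof.
move=> t0; pose T := Num.max 1 t.
have T1 : 1 <= T by rewrite le_max lexx.
have tT : t <= T by rewrite le_max lexx orbT.
have [C C0 hC] := spectral_integral_le a1 ba ba1 b1 B0 T1.
have eps0 : 0 < (2 * C)^-1 by rewrite invr_gt0 mulr_gt0.
have [lambda l0 hl] := damped_power_small (lt_le_trans ltr01 T1) kappa0 kappa1 eps0.
exists (expR (lambda * t)); first exact: expR_ge0.
move=> n x; rewrite chaos_second_momentE//.
pose psi := damped_power T lambda kappa.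
have psi0 := damped_power_ge0 T lambda kappa.
have bound (s : n.+1.-tuple RR) :
  (\int[lebX n.+1]_xi (chaos_density H t (s, xi))%:E <=
    (C ^+ n.+1 * expR (lambda * t))%:E *
    (\prod_(i < n.+1) psi (nth t s i.+1 - nth t s i))%:E)%E.
  rewrite integral_chaos_density.
  have rhs0 : (0 <= (C ^+ n.+1 * expR (lambda * t))%:E *
      (\prod_(i < n.+1) psi (nth t s i.+1 - nth t s i))%:E)%E.
    by rewrite -EFinM lee_fin mulr_ge0 ?prodr_ge0// mulr_ge0 ?expR_ge0 ?exprn_ge0 ?ltW.
  have [pth|_] := boolP (path _ _ _); last by rewrite mul0e.
  rewrite mul1e; move: pth; rewrite path_rcons_increasing => /andP[s0 inc].
  rewrite -EFinM; apply: (@le_trans _ _ (C ^+ n.+1 * gap_power kappa t s)%:E); last first.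
    rewrite (@gap_power_damped R n.+1 T lambda kappa t s inc (ltW s0) tT) lee_fin -mulrA ler_wpM2l//.
      by rewrite exprn_ge0 ?ltW.
    rewrite ler_wpM2r ?prodr_ge0// ler_expR ler_wpM2l//; lra.
  move: s0 inc {rhs0}; have [s0 [s' ->]] := tuple_consP s => s0p inc.
  have w0 : 0 < nth t s' 0 - s0.
    by move: inc; rewrite increasing_to_cons => /andP[]; rewrite subr_gt0.
  have tau : t - s0 <= T by move: s0p => /=; lra.
  have r0 : 0 < (nth t s' 0 - s0) `^ (- 2^-1) by rewrite powR_gt0.
  apply: (le_trans (hC n t s0 s' (fun=> 0) inc tau _ erefl)).
  rewrite lee_fin gap_power_cons -mulrA ler_wpM2l ?exprn_ge0 ?(ltW C0)//.
  rewrite mulrC ler_wpM2r ?gap_power_ge0// normr0 (max_l (ltW r0)).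
  rewrite le_eqVlt; apply/orP; left; apply/eqP.
  set r := _ `^ (- 2^-1) in r0 *.
  have -> : \prod_(k < d) r `^ (- b k) = r `^ (- B).
    rewrite -sumrN; elim/big_rec2 : _ => [|i y z _ ->]; first by rewrite powRr0.
    by rewrite gt0_powRD.
  by rewrite -gt0_powRD// /r -powRrM mulNr.
have Ce0 : 0 <= C ^+ n.+1 * expR (lambda * t).
  by rewrite mulr_ge0 ?expR_ge0 ?exprn_ge0 ?ltW.
have mprod : measurable_fun setT (fun s : n.+1.-tuple RR =>
    (\prod_(i < n.+1) psi (nth t s i.+1 - nth t s i))%:E).
  apply/measurable_EFinP; apply: measurable_prod => i _.
  apply: (measurableT_comp (measurable_damped_power T lambda kappa)).
  exact: (measurable_funB (@measurable_nth _ RR _ t i.+1) (@measurable_nth _ RR _ t i)).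
have mdens : measurable_fun setT (fun s : n.+1.-tuple RR =>
    \int[lebX n.+1]_xi (chaos_density H t (s, xi))%:E)%E.
  pose G (p : n.+1.-tuple RR * n.+1.-tuple V) := (chaos_density H t p)%:E.
  have mG : measurable_fun setT G by apply/measurable_EFinP; exact: measurable_chaos_density.
  have G0 p : (0 <= G p)%E by rewrite lee_fin chaos_density_ge0.
  exact: (@measurable_fun_fubini_tonelli_F _ _ _ _ R (lebX n.+1) G mG G0).
apply: (@le_trans _ _ (\int[lebesgue_tuple n.+1]_s ((C ^+ n.+1 * expR (lambda * t))%:E *
    (\prod_(i < n.+1) psi (nth t s i.+1 - nth t s i))%:E))%E).
  apply: ge0_le_integral => //.
  - by move=> s _; apply: integral_ge0 => xi _; rewrite lee_fin chaos_density_ge0.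
  - exact: measurable_funeM.
rewrite ge0_integralZl//; last by move=> s _; rewrite lee_fin prodr_ge0.
have h := integral_gaps_le t n.+1 (measurable_damped_power T lambda kappa)
  psi0 (ltW eps0) hl.
apply: (le_trans (lee_wpmul2l _ h)); first by rewrite lee_fin.
rewrite -EFinM lee_fin le_eqVlt; apply/orP; left; apply/eqP.
rewrite mulrAC mulrC; congr (_ * _); rewrite -exprMn; congr (_ ^+ _).
by field; rewrite gt_eqF.
Qed.

Lemma second_moment_finite (t : R) x : 0 <= t -> (second_moment H t x < +oo)%E.
Proof.
move=> t0; have [K K0 hK] := chaos_second_moment_geometric t0.
rewrite /second_moment.
have c0 n : (0 <= chaos_second_moment H n t x)%E.
  case: n => [|n]; first exact: lee01.
  rewrite chaos_second_momentE//; apply: integral_ge0 => s _.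
  by apply: integral_ge0 => xi _; rewrite lee_fin chaos_density_ge0.
pose L := Num.max 1 K.
have L0 : 0 <= L by rewrite le_max ler01.
have hL n : (chaos_second_moment H n t x <= (L * 2 / (2 ^ (n + 1))%:R)%:E)%E.
  have -> : L * 2 / (2 ^ (n + 1))%:R = L * 2^-1 ^+ n.
    by rewrite addn1 natrX exprS exprVn; field; rewrite expf_neq0.
  case: n => [|n]; first by rewrite expr0 mulr1 lee_fin le_max lexx.
  apply: (le_trans (hK n x)); rewrite lee_fin.
  by rewrite ler_wpM2r ?exprn_ge0 ?invr_ge0// le_max lexx orbT.
apply: (@le_lt_trans _ _ (\sum_(0 <= n <oo) (L * 2 / (2 ^ (n + 1))%:R)%:E)%E).
  by apply: lee_nneseries => // n _; exact: c0.
by rewrite (cvg_lim _ (@cvg_geometric_eseries_half R (L * 2) 0))// ltry.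
Qed.

End convergence.

(** * Choice of the decay exponents *)

(** Up to eps, the largest admissible exponent is - a k = 2 H k - 1 for a rough
    coordinate and 1 + a k for a smooth one, and D minus their sum is the sum
    of 1 + 2 a k over the rough coordinates: this is the second condition. When
    the sum of these exponents is positive, lowering them to the sum 0 leaves D
    alone, which is the first condition. *)
Lemma decay_exponents {R : realType} d dstar (H : 'I_d -> R) : (0 < d)%N ->
  (forall k, 0 < H k < 1) ->
  (forall k : 'I_d, (k < dstar)%N -> H k < 3 / 4) ->
  (forall k : 'I_d, (dstar <= k)%N -> 3 / 4 <= H k) ->
  \sum_(k < d) (1 + (1 - 2 * H k)) < 2 ->
  \sum_(k < d | (k < dstar)%N) (1 + 2 * (1 - 2 * H k)) < 2 ->
  exists b : 'I_d -> R,
  [/\ forall k, b k <= - (1 - 2 * H k), forall k, b k < 1 + (1 - 2 * H k),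
      forall k, b k < 1, \sum_(k < d) b k <= 0 &
      2^-1 * (\sum_(k < d) (1 + (1 - 2 * H k)) - \sum_(k < d) b k) < 1].
Proof.
move=> d0 hH hlow hhigh D2 S2.
set D := \sum_(k < d) (1 + _) in D2 *; set S := \sum_(k < d | _) _ in S2.
have dR : (0 : R) < d%:R by rewrite ltr0n.
(* d eps is half of the slack in the second condition. *)
pose eps : R := (2 - S) / (2 * d%:R).
have eps0 : 0 < eps by rewrite divr_gt0 ?mulr_gt0//; lra.
pose m k := Num.min (- (1 - 2 * H k)) (1 + (1 - 2 * H k) - eps).
pose M := \sum_(k < d) m k.
pose c := Num.max M 0 / d%:R.
have c0 : 0 <= c by rewrite divr_ge0 ?(ltW dR)// le_max lexx orbT.
have m1 k : m k <= - (1 - 2 * H k) by rewrite ge_min lexx.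
have m2 k : m k <= 1 + (1 - 2 * H k) - eps by rewrite ge_min lexx orbT.
have DM : D - M < 2.
  have -> : D - M = \sum_(k < d) ((1 + (1 - 2 * H k)) - m k) by rewrite sumrB.
  apply: (@le_lt_trans _ _ (\sum_(k < d)
      ((if (k < dstar)%N then 1 + 2 * (1 - 2 * H k) else 0) + eps))).
    apply: ler_sum => k _; rewrite /m.
    have [kd|kd] := ltnP k dstar.
      by have := hlow k kd; have := hH k; rewrite /Num.min; case: ifP => *; lra.
    by have := hhigh k kd; have := hH k; rewrite /Num.min; case: ifP => *; lra.
  rewrite big_split/= -big_mkcond -/S sumr_const card_ord -[eps *+ d]mulr_natl.
  have -> : d%:R * eps = (2 - S) / 2 by rewrite /eps; field; rewrite gt_eqF.
  lra.
have cd : \sum_(k < d) c = Num.max M 0.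
  by rewrite sumr_const card_ord -[c *+ d]mulr_natl /c mulrC divfK// gt_eqF.
exists (fun k => m k - c); split.
- by move=> k; have := m1 k; lra.
- by move=> k; have := m2 k; lra.
- by move=> k; have := m1 k; have := hH k; lra.
- rewrite sumrB cd -/M /Num.max; case: ifP => [M0|_]; lra.
- rewrite sumrB cd -/M /Num.max; case: ifP => *; lra.
Qed.

(** * Divergence of the first and of the second chaos *)

Section divergence.
Context {R : realType}.
Local Notation leb := (@lebesgue_measure R).
Local Notation RR := (measurableTypeR R).
Implicit Types a w h : R.

Lemma integral_ge_itv (f : R -> R) (p q m : R) : measurable_fun setT f ->
  (forall y, 0 <= f y) -> 0 <= m -> p <= q ->
  (forall y, p <= y <= q -> m <= f y) ->
  ((m * (q - p))%:E <= \int[leb]_y (f y)%:E)%E.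
Proof.
move=> mf f0 m0 pq mfy.
apply: (@le_trans _ _ (\int[leb]_(y in `[p, q]) (f y)%:E)%E); last first.
  apply: ge0_subset_integral => //; first exact/measurable_EFinP.
  by move=> y _; rewrite lee_fin.
apply: (@le_trans _ _ (\int[leb]_(y in `[p, q]) (cst m%:E) y)%E).
  rewrite integral_cst//= lebesgue_measure_itv/= lte_fin.
  move: pq; rewrite le_eqVlt => /predU1P[->|->]; last by rewrite -EFinB -EFinM.
  by rewrite ltxx subrr mulr0 mule0.
apply: ge0_le_integral => //.
by apply/measurable_EFinP/measurable_funTS.
Qed.

(** Lower bound for powers that is insensitive to the sign of the exponent. *)
Lemma half_powR_ge a (x y : R) : `|a| <= 1 -> 0 < x -> x / 2 <= y <= 2 * x ->
  2^-1 * x `^ a <= y `^ a.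
Proof.
move=> a1 x0 /andP[xy yx]; have y0 : 0 < y by lra.
have [a0|a0] := leP 0 a.
  apply: (@le_trans _ _ ((x / 2) `^ a)).
    rewrite powRM ?invr_ge0 ?(ltW x0)// mulrC ler_wpM2l ?powR_ge0//.
    by apply: ger1_powR; [lra|rewrite ger0_norm in a1].
  by apply: ge0_ler_powR; rewrite ?nnegrE//; lra.
apply: (@le_trans _ _ ((2 * x) `^ a)); last by apply: gt0_ler_powRN => //; exact: ltW.
rewrite powRM ?(ltW x0)// ler_wpM2r ?powR_ge0//.
rewrite -(powR_inv1 (ler0n R 2)); apply: ler_powR; first lra.
by rewrite ltr0_norm// in a1; lra.
Qed.

(** The second moments diverge because a time integrates the inverse of its
    distance to the next time. *)
Lemma integral_infty_inv (F : R -> \bar R) (h c delta : R) :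
  measurable_fun setT F -> (forall y, 0 <= F y)%E -> 0 < c -> 0 < delta ->
  (forall w, 0 < w <= delta -> ((c * w^-1)%:E <= F (h - w)%R)%E) ->
  (\int[leb]_y F y = +oo)%E.
Proof.
move=> mF F0 c0 delta0 FE.
have n1 : (-1 : R) != 0 by rewrite oppr_eq0 oner_neq0.
have := @ge0_integral_affine R (-1) h F n1 mF F0.
rewrite normrN normr1 invr1 mul1e => <-; apply/eqP; rewrite -leye_eq.
have mFh : measurable_fun setT (fun w => F (-1 * w + h)).
  by apply: (measurableT_comp mF); apply: measurable_funD => //; exact: measurable_funM.
have minv : measurable_fun `]0, delta]%classic (fun w : R => (w^-1)%:E).
  apply/measurable_EFinP; apply: (eq_measurable_fun (fun w : R => w `^ (-1))).
    by move=> x; rewrite inE/= in_itv/= => /andP[x0 _]; rewrite powR_inv1 ?ltW.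
  by apply: measurable_funTS; exact: measurable_powR.
apply: (@le_trans _ _ (\int[leb]_(w in `]0%R, delta]) (c%:E * (w^-1)%:E))%E).
  rewrite ge0_integralZl//; last 2 first.
  - by move=> w /=; rewrite in_itv/= => /andP[w0 _]; rewrite lee_fin invr_ge0 ltW.
  - by rewrite lee_fin ltW.
  by rewrite integral_invr_infty// gt0_muley.
apply: (@le_trans _ _ (\int[leb]_(w in `]0%R, delta]) F (-1 * w + h)%R)%E); last first.
  by apply: ge0_subset_integral.
apply: ge0_le_integral => //.
- move=> w /=; rewrite in_itv/= => /andP[w0 _].
  by rewrite -EFinM lee_fin mulr_ge0 ?invr_ge0 ?ltW.
- by apply: measurable_funeM.
- exact: measurable_funTS.
- by move=> w /=; rewrite in_itv/= => hw; rewrite -EFinM mulN1r addrC; exact: FE.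
Qed.

Lemma prod_EFin_le (I : Type) (r : seq I) (f : I -> \bar R) (c : I -> R) :
  (forall i, 0 <= c i) -> (forall i, (c i)%:E <= f i)%E ->
  ((\prod_(i <- r) c i)%:E <= \prod_(i <- r) f i)%E.
Proof.
move=> c0 fc; elim: r => [|i r IH]; first by rewrite !big_nil.
by rewrite !big_cons EFinM; apply: lee_pmul; rewrite ?lee_fin ?prodr_ge0.
Qed.

Let e1 : R := expR (-1).
Let e10 : 0 < e1. Proof. exact: expR_gt0. Qed.

Let exp_ge (u : R) : u <= 1 -> e1 <= expR (- u).
Proof. by move=> u1; rewrite ler_expR lerN2. Qed.

Let measurable_gauss_power (w e a : R) :
  measurable_fun setT (fun y : R => expR (- (w * (e + y) ^+ 2)) * `|y| `^ a).
Proof.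
apply: measurable_funM; last first.
  by have := @measurable_normr_powR R a 0; under eq_fun do rewrite subr0.
have mexp := @measurable_expR_sqr R w.
by apply: (measurableT_comp mexp); exact: measurable_funD.
Qed.

Let radius w : 0 < w -> exists r : R, [/\ 0 < r, w * r ^+ 2 = 1 & forall p, r `^ p = w `^ (- (p / 2))].
Proof.
move=> w0; exists (w `^ (- 2^-1)); split; first exact: powR_gt0.
- rewrite -powR_mulrn ?powR_ge0// -powRrM mulNr mulVf ?pnatr_eq0//.
  by rewrite powRN powRr1 ?divff ?gt_eqF// ltW.
- by move=> p; rewrite -powRrM; congr (_ `^ _); lra.
Qed.

(** The scale |y| ~ w^(-1/2) alone already gives the order of the integral. *)
Lemma integral_gauss_power_ge a w : `|a| <= 1 -> 0 < w ->
  ((e1 / 4 * w `^ (- ((1 + a) / 2)))%:E <=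
   \int[leb]_y (expR (- (w * (0 + y) ^+ 2)) * `|y| `^ a)%:E)%E.
Proof.
move=> a1 w0; have [r [r0 wr rp]] := radius w0.
rewrite -rp gt0_powRD// powRr1 ?(ltW r0)//.
have -> : e1 / 4 * (r * r `^ a) = (e1 * (2^-1 * r `^ a)) * (r - r / 2) by field.
apply: integral_ge_itv; [exact: measurable_gauss_power| | |lra|].
- by move=> y; rewrite mulr_ge0 ?expR_ge0 ?powR_ge0.
- by rewrite !mulr_ge0 ?powR_ge0 ?invr_ge0 ?(ltW e10).
move=> y /andP[ry yr]; have y0 : 0 < y by lra.
rewrite add0r gtr0_norm//; apply: ler_pM; rewrite ?mulr_ge0 ?powR_ge0 ?invr_ge0 ?(ltW e10)//.
  apply: exp_ge; rewrite -wr ler_wpM2l ?(ltW w0)// ler_sqr ?nnegrE; lra.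
by apply: half_powR_ge => //; apply/andP; split; lra.
Qed.

(** Only y with h + y in [-1,-1/2] is used, where |y| is comparable to 1 + h.
    *)
Lemma integral_gauss_power_shift_ge a w h : `|a| <= 1 -> 0 <= w <= 1 -> 0 <= h ->
  ((e1 / 4 * (1 + h) `^ a)%:E <=
   \int[leb]_y (expR (- (w * (h + y) ^+ 2)) * `|y| `^ a)%:E)%E.
Proof.
move=> a1 /andP[w0 w1] h0.
have -> : e1 / 4 * (1 + h) `^ a = (e1 * (2^-1 * (1 + h) `^ a)) * ((- h - 2^-1) - (- h - 1)).
  by field.
apply: integral_ge_itv; [exact: measurable_gauss_power| | |lra|].
- by move=> y; rewrite mulr_ge0 ?expR_ge0 ?powR_ge0.
- by rewrite !mulr_ge0 ?powR_ge0 ?invr_ge0 ?(ltW e10).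
move=> y /andP[ry yr]; have y0 : y < 0 by lra.
rewrite ltr0_norm//; apply: ler_pM; rewrite ?mulr_ge0 ?powR_ge0 ?invr_ge0 ?(ltW e10)//.
  apply: exp_ge; apply: (@le_trans _ _ (1 * 1)); last by rewrite mulr1.
  by apply: ler_pM => //; [exact: sqr_ge0|rewrite -sqrrN expr_le1//; lra].
by apply: half_powR_ge => //; [lra|apply/andP; split; lra].
Qed.

(** Weight, in one coordinate, of two successive frequency steps, when the
    second one brings the sum of the frequencies back to size one. The
    restriction to 0 <= y is what integral_gauss_power_shift_ge asks for in the
    second step. *)
Definition two_step a w (y : R) : R :=
  expR (- (w * (0 + y) ^+ 2)) * `|y| `^ a * (e1 / 4 * (1 + y) `^ a * (0 <= y)%R%:R).

Lemma two_step_ge0 a w y : 0 <= two_step a w y.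
Proof. by rewrite !mulr_ge0 ?expR_ge0 ?powR_ge0 ?invr_ge0 ?(ltW e10). Qed.

Lemma measurable_two_step a w : measurable_fun setT (two_step a w).
Proof.
apply: measurable_funM; first exact: measurable_gauss_power.
apply: measurable_funM.
  apply: measurable_funM => //; apply: (measurableT_comp (measurable_powR a)).
  exact: measurable_funD.
rewrite (_ : (fun y => _) = (fun y : R => if 0 <= y then 1 else 0)); last first.
  by apply/funext => y; case: ifP.
by apply: measurable_fun_ifT => //; exact: measurable_fun_ler.
Qed.

(** A first frequency of size w^(-1/2) meets the kernel |y|^a twice, going out
    and coming back. *)
Lemma two_step_rough a w : `|a| <= 1 -> 0 < w -> w <= 1 ->
  ((e1 ^+ 2 / 32 * w `^ (- ((1 + 2 * a) / 2)))%:E <= \int[leb]_y (two_step a w y)%:E)%E.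
Proof.
move=> a1 w0 w1; have [r [r0 wr rp]] := radius w0.
have r1 : 1 <= r.
  rewrite leNgt; apply/negP => rlt.
  have r2 : r ^+ 2 < 1 by rewrite expr_lt1// ltW.
  have : w * r ^+ 2 <= 1 * r ^+ 2 by rewrite ler_wpM2r// sqr_ge0.
  by rewrite wr; lra.
have rE : r `^ (1 + 2 * a) = r * (r `^ a * r `^ a).
  rewrite (_ : 1 + 2 * a = 1 + (a + a)); last by ring.
  by rewrite (gt0_powRD 1)// (gt0_powRD a)// powRr1// ltW.
rewrite -rp rE.
have -> : e1 ^+ 2 / 32 * (r * (r `^ a * r `^ a)) =
    (e1 * (2^-1 * r `^ a) * (e1 / 4 * (2^-1 * r `^ a) * 1)) * (r - r / 2) by field.
have ra := powR_ge0 r a.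
apply: integral_ge_itv; [exact: measurable_two_step|exact: two_step_ge0| |lra|].
  by rewrite !mulr_ge0 ?invr_ge0 ?(ltW e10).
move=> y /andP[ry yr]; have y0 : 0 < y by lra.
rewrite /two_step add0r (gtr0_norm y0) (ltW y0).
have h1 : 2^-1 * r `^ a <= y `^ a by apply: half_powR_ge => //; apply/andP; split; lra.
have h2 : 2^-1 * r `^ a <= (1 + y) `^ a by apply: half_powR_ge => //; apply/andP; split; lra.
apply: ler_pM; rewrite ?mulr_ge0 ?invr_ge0 ?(ltW e10)//.
  apply: ler_pM; rewrite ?mulr_ge0 ?invr_ge0 ?(ltW e10)//.
  by apply: exp_ge; rewrite -wr ler_wpM2l ?(ltW w0)// ler_sqr ?nnegrE; lra.
by rewrite !mulr1 ler_wpM2l// divr_ge0// ltW.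
Qed.

(** A smooth coordinate does not have to move. *)
Lemma two_step_smooth a w : `|a| <= 1 -> 0 < w -> w <= 1 ->
  ((e1 ^+ 2 / 32)%:E <= \int[leb]_y (two_step a w y)%:E)%E.
Proof.
move=> a1 w0 w1.
have -> : e1 ^+ 2 / 32 = (e1 * 2^-1 * (e1 / 4 * 2^-1 * 1)) * (1 - 1 / 2) by field.
apply: integral_ge_itv; [exact: measurable_two_step|exact: two_step_ge0| |lra|].
  by rewrite !mulr_ge0 ?invr_ge0 ?(ltW e10).
move=> y /andP[ry yr]; have y0 : 0 < y by lra.
rewrite /two_step add0r (gtr0_norm y0) (ltW y0).
have h1 : 2^-1 * 1 `^ a <= y `^ a by apply: half_powR_ge => //; apply/andP; split; lra.
have h2 : 2^-1 * 1 `^ a <= (1 + y) `^ a by apply: half_powR_ge => //; apply/andP; split; lra.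
rewrite powR1 mulr1 in h1 h2.
apply: ler_pM; rewrite ?mulr_ge0 ?invr_ge0 ?(ltW e10)//.
  apply: ler_pM; rewrite ?(ltW e10)//.
  apply: exp_ge; apply: (@le_trans _ _ (1 * 1)); last by rewrite mulr1.
  by apply: ler_pM; rewrite ?sqr_ge0 ?(ltW w0)// expr_le1//; lra.
by rewrite !mulr1 ler_wpM2l// divr_ge0// ltW.
Qed.

Variables (d : nat) (H : 'I_d -> R).
Hypothesis H01 : forall k, 0 < H k < 1.
Local Notation a k := (1 - 2 * H k).
Local Notation V := (d.-tuple (measurableTypeR R)).

Let a1 k : `|a k| <= 1.
Proof. by have := H01 k; rewrite ler_norml => /andP[h h']; apply/andP; split; lra. Qed.

Let powR_sum_prod (c : R) (P : pred 'I_d) (g : 'I_d -> R) w : 0 < w ->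
  \prod_(k < d) (c * (if P k then w `^ (- g k) else 1)) =
  c ^+ d * w `^ (- \sum_(k < d | P k) g k).
Proof.
move=> w0; rewrite big_split/= prodr_const card_ord; congr (_ * _).
rewrite -big_mkcond -sumrN/=.
by elim/big_rec2 : _ => [|k y z _ ->]; rewrite ?powRr0// gt0_powRD.
Qed.

Let powR_ge_inv w p : 0 < w -> w <= 1 -> 1 <= p -> w^-1 <= w `^ (- p).
Proof.
move=> w0 w1 p1; rewrite -(powR_inv1 (ltW w0)); apply: ger_powR.
  by rewrite w0.
by rewrite lerN2.
Qed.

Lemma spectral_integral1 (t : R) (e : 'I_d -> R) s0 (s : 0.-tuple RR) :
  (spectral_integral H t e (tuple_cons (s0, s)) =
   \prod_(k < d) \int[leb]_y (expR (- ((t - s0) * (e k + y) ^+ 2)) * `|y| `^ a k)%:E)%E.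
Proof.
rewrite spectral_integralS -integral_tuple_prod.
- by apply: eq_integral => x _; rewrite spectral_integral0 mule1 tuple0.
- by move=> k; exact: measurable_gauss_power.
- by move=> k y; rewrite mulr_ge0 ?expR_ge0 ?powR_ge0.
Qed.

Let increasing_to0 (t : R) (s : 0.-tuple RR) : increasing_to t s.
Proof. by apply/forallP => -[]. Qed.

(** For one point at distance w from the final time, scaling gives w to the
    power minus half the sum of 1 + a k, at least 1 in absolute value. *)
Lemma first_chaos_infty x : 2 <= \sum_(k < d) (1 + a k) ->
  (chaos_second_moment H 1 1 x = +oo)%E.
Proof.
move=> D2; rewrite chaos_second_momentE//.
pose G (p : 1.-tuple RR * 1.-tuple V) := (chaos_density H 1 p)%:E.
have mG : measurable_fun setT G by apply/measurable_EFinP; exact: measurable_chaos_density.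
have G0 p : (0 <= G p)%E by rewrite lee_fin chaos_density_ge0.
pose F (s : 1.-tuple RR) : \bar R := (\int[tuple_measure (lebesgue_tuple d) 1]_xi G (s, xi))%E.
have mF : measurable_fun setT F.
  exact: (@measurable_fun_fubini_tonelli_F _ _ _ _ R (tuple_measure (lebesgue_tuple d) 1) G mG G0).
have F0 s : (0 <= F s)%E by apply: integral_ge0 => xi _; exact: G0.
rewrite -/F (ge0_integral_tupleS_swap leb mF F0) integral_tuple0.
apply: (@integral_infty_inv _ 1 ((e1 / 4) ^+ d) 2^-1).
- apply: (measurableT_comp mF); apply: (measurableT_comp (@measurable_tuple_cons _ RR 0)).
  exact: measurable_pair2.
- by move=> y; exact: F0.
- by rewrite exprn_gt0// divr_gt0.
- by rewrite invr_gt0.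
move=> w /andP[w0 w2]; rewrite /F /G integral_chaos_density.
have w1 : w <= 1 by lra.
rewrite path_rcons_increasing increasing_to_cons increasing_to0 andbT/=.
rewrite (_ : (0 < 1 - w) && (1 - w < 1)); last by apply/andP; split; lra.
rewrite mul1e spectral_integral1.
apply: (@le_trans _ _ (\prod_(k < d) (e1 / 4 * w `^ (- ((1 + a k) / 2))))%:E); last first.
  apply: prod_EFin_le => k; first by rewrite mulr_ge0 ?powR_ge0// divr_ge0// ltW.
  by rewrite subKr; exact: integral_gauss_power_ge.
rewrite lee_fin (powR_sum_prod (e1 / 4) xpredT (fun k => (1 + a k) / 2) w0).
rewrite ler_wpM2l ?exprn_ge0 ?divr_ge0 ?(ltW e10)//.
by apply: powR_ge_inv => //; rewrite -mulr_suml; lra.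
Qed.

(** Two points at distance w of each other, the later one kept away from 0 and
    from the final time: the rough coordinates P contribute w to the power
    minus half the sum of 1 + 2 a k, at least 1 in absolute value. *)
Lemma second_chaos_infty (P : pred 'I_d) x : 2 <= \sum_(k < d | P k) (1 + 2 * a k) ->
  (chaos_second_moment H 2 1 x = +oo)%E.
Proof.
move=> S2; rewrite chaos_second_momentE//.
pose G (p : 2.-tuple RR * 2.-tuple V) := (chaos_density H 1 p)%:E.
have mG : measurable_fun setT G by apply/measurable_EFinP; exact: measurable_chaos_density.
have G0 p : (0 <= G p)%E by rewrite lee_fin chaos_density_ge0.
pose F (s : 2.-tuple RR) : \bar R := (\int[tuple_measure (lebesgue_tuple d) 2]_xi G (s, xi))%E.
have mF : measurable_fun setT F.
  exact: (@measurable_fun_fubini_tonelli_F _ _ _ _ R (tuple_measure (lebesgue_tuple d) 2) G mG G0).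
have F0 s : (0 <= F s)%E by apply: integral_ge0 => xi _; exact: G0.
rewrite -/F (ge0_integral_tupleS_swap leb mF F0).
(* Q keeps the later time away from 0 and from the final time 1. *)
pose Q : set (1.-tuple RR) := [set v | forall k, `[2^-1, 3 / 4]%classic (tnth v k : R)].
have mQ : measurable Q.
  by apply: (@measurable_box _ RR 1 (fun=> `[2^-1, 3 / 4]%classic)) => k; exact: measurable_itv.
have Qp : (0 < lebesgue_tuple 1 Q)%E.
  rewrite (@tuple_measure_box _ RR R leb 1 (fun=> `[2^-1, 3 / 4]%classic)); last first.
    by move=> k; exact: measurable_itv.
  have E : @lebesgue_measure R `[2^-1, 3 / 4]%classic = (1 / 4)%:E.
    rewrite lebesgue_measure_itv/= lte_fin ifT; last by lra.
    by rewrite -EFinB; congr EFin; lra.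
  by rewrite big_ord1 [X in (_ < X)%E]E lte_fin; lra.
have inner s : Q s -> (\int[leb]_x F (tuple_cons (x, s)) = +oo)%E.
  have [s1 [s' ->]] := tuple_consP s => /(_ ord0) /=; rewrite in_itv/= => /andP[s1l s1u].
  have {}s1l : 2^-1 <= (s1 : R) by exact: s1l.
  have {}s1u : (s1 : R) <= 3 / 4 by exact: s1u.
  apply: (@integral_infty_inv _ s1 ((e1 ^+ 2 / 32) ^+ d) (1 / 4)).
  - apply: (measurableT_comp mF); apply: (measurableT_comp (@measurable_tuple_cons _ RR 1)).
    exact: measurable_pair2.
  - by move=> y; exact: F0.
  - by rewrite exprn_gt0// divr_gt0// exprn_gt0.
  - by rewrite divr_gt0.
  move=> w /andP[w0 w2]; rewrite /F /G integral_chaos_density.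
  have w1 : w <= 1 by lra.
  rewrite path_rcons_increasing !increasing_to_cons increasing_to0 andbT/= (tuple0 s')/=.
  rewrite (_ : [&& 0 < s1 - w, s1 - w < s1 & s1 < 1]); last first.
    by apply/and3P; split; lra.
  rewrite mul1e spectral_integralS.
  have wE : nth 1 (tuple_cons (s1, [tuple])) 0 - (s1 - w) = w by rewrite /= subKr.
  apply: (@le_trans _ _ (\int[lebesgue_tuple d]_y
      (\prod_(k < d) two_step (a k) w (tnth y k))%:E)%E); last first.
    apply: ge0_le_integral => //.
    - by move=> y _; rewrite lee_fin prodr_ge0// => k _; exact: two_step_ge0.
    - apply/measurable_EFinP; apply: (@measurable_tuple_prod R d (fun k => two_step (a k) w)) => k.
      exact: measurable_two_step.
    - exact: measurable_spectral_integralS.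
    move=> y _; rewrite wE /two_step big_split/= EFinM.
    rewrite -[X in (X%:E * _ <= _)%E]/(frequency_factor H w (fun=> 0) y).
    apply: lee_wpmul2l; first by rewrite lee_fin frequency_factor_ge0.
    have [/forallP y0|] := boolP [forall k, 0 <= (tnth y k : R)]; last first.
      rewrite negb_forall => /existsP[k /negbTE yk].
      by rewrite (bigD1 k)//= yk mulr0 mul0r spectral_integral_ge0.
    rewrite spectral_integral1; apply: prod_EFin_le => k.
      by rewrite !mulr_ge0 ?powR_ge0 ?invr_ge0 ?(ltW e10).
    rewrite y0 mulr1 add0r; apply: integral_gauss_power_shift_ge => //.
    by apply/andP; split; lra.
  rewrite (@integral_tuple_prod R d (fun k => two_step (a k) w)); last 2 first.
  - by move=> k; exact: measurable_two_step.
  - by move=> k y; exact: two_step_ge0.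
  apply: (@le_trans _ _ (\prod_(k < d) (e1 ^+ 2 / 32 *
      (if P k then w `^ (- ((1 + 2 * a k) / 2)) else 1)))%:E); last first.
    apply: prod_EFin_le => k.
      by rewrite !mulr_ge0 ?invr_ge0 ?exprn_ge0 ?(ltW e10)//; case: ifP => // _; exact: powR_ge0.
    case: ifP => _; first exact: two_step_rough.
    by rewrite mulr1; exact: two_step_smooth.
  rewrite lee_fin (powR_sum_prod (e1 ^+ 2 / 32) P (fun k => (1 + 2 * a k) / 2) w0).
  rewrite ler_wpM2l ?exprn_ge0 ?divr_ge0 ?exprn_ge0 ?(ltW e10)//.
  by apply: powR_ge_inv => //; rewrite -mulr_suml; lra.
apply/eqP; rewrite -leye_eq.
apply: (@le_trans _ _ (\int[lebesgue_tuple 1]_(s in Q) (cst +oo%E) s)%E).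
  by rewrite integral_cst// gt0_mulye.
have mI : measurable_fun setT (fun s : 1.-tuple RR => \int[leb]_x F (tuple_cons (x, s)))%E.
  have mFc : measurable_fun setT (F \o @tuple_cons _ RR 1).
    by apply: (measurableT_comp mF); exact: measurable_tuple_cons.
  exact: (@measurable_fun_fubini_tonelli_G _ _ _ _ R leb (F \o @tuple_cons _ RR 1) mFc
    (fun p => F0 _)).
have I0 s : (0 <= \int[leb]_x F (tuple_cons (x, s)))%E by apply: integral_ge0 => y _; exact: F0.
apply: (@le_trans _ _ (\int[lebesgue_tuple 1]_(s in Q) \int[leb]_x F (tuple_cons (x, s)))%E).
  rewrite le_eqVlt; apply/orP; left; apply/eqP; apply: eq_integral => s.
  by rewrite inE => /inner ->.
by apply: ge0_subset_integral.
Qed.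

End divergence.

(** * The criterion *)

Theorem proposition1p6 (R : realType) (d dstar : nat) (H : 'I_d -> R)
    (hd : (1 <= d)%N)
    (hH : forall k, 0 < H k < 1)
    (hdstar : (dstar <= d)%N)
    (hlow : forall k : 'I_d, (k < dstar)%N -> H k < 3 / 4)
    (hhigh : forall k : 'I_d, (dstar <= k)%N -> 3 / 4 <= H k) :
  (forall (t : R) (x : d.-tuple R), 0 <= t -> (second_moment H t x < +oo)%E) <->
  (d%:R - 1 < \sum_(k < d) H k /\
   3 / 4 * dstar%:R - 1 / 2 < \sum_(k < d | (k < dstar)%N) H k).
Proof.
have DE : \sum_(k < d) (1 + (1 - 2 * H k)) = 2 * (d%:R - \sum_(k < d) H k).
  transitivity (\sum_(k < d) 2 * (1 - H k)); first by apply: eq_bigr => k _; ring.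
  by rewrite -mulr_sumr sumrB sumr_const card_ord.
have SE : \sum_(k < d | (k < dstar)%N) (1 + 2 * (1 - 2 * H k)) =
    3 * dstar%:R - 4 * \sum_(k < d | (k < dstar)%N) H k.
  transitivity (\sum_(k < d | (k < dstar)%N) (3 - 4 * H k)).
    by apply: eq_bigr => k _; ring.
  rewrite sumrB -mulr_sumr (big_ord_narrow hdstar) sumr_const card_ord.
  by rewrite -[3 *+ dstar]mulr_natr.
split=> [fin|[h1 h2] t x t0].
  pose origin : d.-tuple R := nseq_tuple d 0.
  have chaos_fin n : (chaos_second_moment H n 1 origin < +oo)%E.
    apply: (le_lt_trans _ (fin 1%R origin ler01)).
    have c0 m : (0 <= chaos_second_moment H m 1 origin)%E.
      case: m => [|m]; first exact: lee01.
      rewrite chaos_second_momentE//; apply: integral_ge0 => s _.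
      by apply: integral_ge0 => xi _; rewrite lee_fin chaos_density_ge0.
    apply: (le_trans _ (nneseries_lim_ge n.+1 (fun m _ _ => c0 m))).
    by rewrite big_nat_recr//= leeDr// sume_ge0.
  split; rewrite ltNge; apply/negP => h.
    by have := chaos_fin 1%N; rewrite (first_chaos_infty hH) ?ltxx// DE; lra.
  have := chaos_fin 2; rewrite (second_chaos_infty hH (P := fun k => (k < dstar)%N)) ?ltxx//.
  by rewrite SE; lra.
have [||b [b1 b2 b3 b4 b5]] := decay_exponents hd hH hlow hhigh; [rewrite DE; lra|rewrite SE; lra|].
have a1 k : -1 < 1 - 2 * H k by have := hH k; lra.
exact: (second_moment_finite a1 b1 b2 b3 b4 b5 x t0).
Qed.
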